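(* Let $m\in(0,\infty)$ and assume (A1) and (A2). Let $\nu\in\mathcal P_f$ be a product measure on $\mathbb N^S$ and let $S(t)$ denote the semigroup of the SIP$(m)$. Suppose that $$\mu=\lim_{n\to\infty}\nu S(t_n)$$ for some sequence $t_n\uparrow\infty$. Then $\mu\in\mathcal P_f$, $\mu$ is invariant for the SIP$(m)$, and for all $n\ge1$ and $x_1,\dots,x_n\in S$, $$K_\mu(x_1,\dots,x_n)\ \ge\ \prod_{i=1}^nK_\mu(x_i).$$
   Context: $S$ is either a finite set or $S=\mathbb Z^d$. $p(x,y)$ is an irreducible symmetric random walk transition probability on $S$: $p(x,y)=p(y,x)\ge 0$, $\sum_y p(x,y)=1$, $p(x,x)=0$. If $S=\mathbb Z^d$, $p$ is moreover translation invariant and of finite range. SIP$(m)$ is the Markov process on $\mathbb N^S$ ($\mathbb N=\{0,1,2,\dots\}$) with generator, on local functions, $$Lf(\eta)=\sum_{x,y\in S}p(x,y)\,2\eta_x(m+2\eta_y)\big(f(\eta^{x,y})-f(\eta)\big),$$ where $\eta^{x,y}$ is obtained from $\eta$ by moving one particle from $x$ to $y$. $\mathbb E^{SIP(m)}_\eta$ is expectation for the process started from $\eta$; $\nu S(t)$ is the law at time $t$ when started from $\nu$. If $S=\mathbb Z^d$, the process is started from tempered configurations (at most polynomially growing in the site; this holds $\nu$-a.s. for $\nu\in\mathcal P_f$), and it is constructed via self-duality, i.e. it satisfies $\mathbb E^{SIP(m)}_\eta D(\xi,\eta_t)=\mathbb E^{SIP(m)}_\xi D(\xi_t,\eta)$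 for all finite particle configurations $\xi$, with $D$ defined next. Duality functions: $D(\xi,\eta)=\prod_x d(\xi_x,\eta_x)$ with $d(k,l)=\frac{l!}{(l-k)!}\frac{\Gamma(m/2)}{\Gamma(m/2+k)}$ for $k\le l$ and $d(k,l)=0$ for $k>l$. $\sum_{i=1}^n\delta_{x_i}$ is the configuration $\xi$ with $\xi(x)=\sum_i I(x_i=x)$; $|\xi|=\sum_x\xi_x$. The duality moment function of $\mu$ is $K_\mu(x_1,\dots,x_n)=\int D(\sum_{i=1}^n\delta_{x_i},\eta)\,\mu(d\eta)$. $\mathcal P_f$ is the set of probability measures $\mu$ on $\mathbb N^S$ such that for every $n\in\mathbb N$, $\sup_{|\xi|=n}\int D(\xi,\eta)\mu(d\eta)<\infty$. Convergence $\mu_n\to\mu$ means $\int D(\xi,\eta)\mu_n(d\eta)\to\int D(\xi,\eta)\mu(d\eta)$ for every finite particle configuration $\xi$. (A1): $\lim_{t\to\infty}\sup_{x,y\in S}\mathbb P^{IRW(m)}_{x,y}(X_t=Y_t)=0$, where $X_t,Y_t$ are independent continuous-time random walks started at $x,y$, each jumping at rate $2m$ according to $p$. (A2): $\lim_{t\to\infty}\sup_{x,y\in S}\mathbb P^{SIP(m)}_{x,y}(X'_t=Y'_t)=0$, where $(X'_t,Y'_t)$ are two (labelled) SIP$(m)$ particles started at $x,y$: the Markov chain on $S^2$ in which the particle at $x_i$ jumps to $z$ at rate $2p(x_i,z)\big(m+2\sum_{j=1}^2I(z=x_j)\big)$. *)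

(* Defs.v *)
From HB Require Import structures.
From mathcomp Require Import all_boot all_order all_algebra.
From mathcomp Require Import all_classical all_reals all_analysis.

Set Implicit Arguments.
Unset Strict Implicit.
Unset Printing Implicit Defensive.

Import Order.TTheory GRing.Theory Num.Theory.
Import numFieldNormedType.Exports.

Local Open Scope classical_set_scope.
Local Open Scope ring_scope.

Inductive geometry : Type :=
  | FiniteSites of finType
  | Lattice of nat.

Definition sites (G : geometry) : countType :=
  match G with
  | FiniteSites T => T
  | Lattice d => 'rV[int]_d
  end.

(* N^S with the product sigma-algebra, N being discrete. *)
Definition cylinders (S : Type) : set (set (S -> nat)) :=
  [set [set eta : S -> nat | eta xk.1 = xk.2] | xk in [set: S * nat]].

Notation config S := (g_sigma_algebraType (@cylinders S)).

Section RandomWalk.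
Variable R : realType.

Definition homogeneous_finite_range (G : geometry) :
    (sites G -> sites G -> R) -> Prop :=
  match G return (sites G -> sites G -> R) -> Prop with
  | FiniteSites _ => fun=> True
  | Lattice d => fun p : 'rV[int]_d -> 'rV[int]_d -> R =>
      (forall x y z : 'rV[int]_d, p (x + z) (y + z) = p x y) /\
      (exists r : nat, forall x y : 'rV[int]_d, p x y != 0 ->
         forall i, (absz ((y - x)%R 0%R i) <= r)%N)
  end.

Record random_walk (G : geometry) (p : sites G -> sites G -> R) : Prop := {
  rw_ge0 : forall x y, 0 <= p x y;
  rw_sym : forall x y, p x y = p y x;
  rw_sum1 : forall x, (\esum_(y in [set: sites G]) (p x y)%:E)%E = 1%E;
  rw_diag : forall x, p x x = 0;
  rw_irreducible : forall x y,
    exists s, path (fun a b => 0 < p a b) x s && (last x s == y);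
  rw_homogeneous : homogeneous_finite_range p }.

End RandomWalk.

Section Generators.
Variable R : realType.

(* e^{tL}.  It is only used below on bounded functions and for generators with
   bounded jump rates (a fixed finite number of particles), where it is the
   transition semigroup of the continuous-time Markov chain generated by L. *)
Definition exp_semigroup (E : Type) (L : (E -> R) -> E -> R) (t : R)
    (f : E -> R) (x : E) : R :=
  limn (series (fun k => t ^+ k / k`!%:R * iter k L f x)).

(* P_x(X_t \in A) for the Markov chain with generator L *)
Definition chain_prob (E : Type) (L : (E -> R) -> E -> R) (t : R) (x : E)
    (A : set E) : R :=
  exp_semigroup L t (\1_A : E -> R) x.

Variable S : countType.
Variable p : S -> S -> R.
Variable m : R.

Definition rw_generator (f : S -> R) (x : S) : R :=
  \sum_(y \in [set: S]) 2 * m * p x y * (f y - f x).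

Definition move_particle (eta : S -> nat) (x y : S) : S -> nat :=
  fun z => (eta z + (z == y) - (z == x))%N.

(* The sums \sum_(_ \in _) range over the finite support of the summand.  For
   p of finite range, this support is indeed finite when f is local or when eta
   has finitely many particles. *)
Definition sip_generator (f : (S -> nat) -> R) (eta : S -> nat) : R :=
  \sum_(xy \in [set: S * S])
    p xy.1 xy.2 * (2 * (eta xy.1)%:R) * (m + 2 * (eta xy.2)%:R) *
    (f (move_particle eta xy.1 xy.2) - f eta).

Definition sip2_rate (w : S * S) (x z : S) : R :=
  2 * p x z * (m + 2 * ((z == w.1)%:R + (z == w.2)%:R)).

Definition sip2_generator (f : S * S -> R) (w : S * S) : R :=
  \sum_(z \in [set: S]) sip2_rate w w.1 z * (f (z, w.2) - f w) +
  \sum_(z \in [set: S]) sip2_rate w w.2 z * (f (w.1, z) - f w).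

Definition irw_meet (t : R) (x y : S) : \bar R :=
  (\esum_(z in [set: S]) (chain_prob rw_generator t x [set z] *
                          chain_prob rw_generator t y [set z])%:E)%E.

Definition sip_meet (t : R) (x y : S) : \bar R :=
  (chain_prob sip2_generator t (x, y) [set w | w.1 = w.2])%:E.

Definition A1 : Prop :=
  ereal_sup [set irw_meet t xy.1 xy.2 | xy in [set: S * S]] @[t --> +oo%R]
    --> 0%E.

Definition A2 : Prop :=
  ereal_sup [set sip_meet t xy.1 xy.2 | xy in [set: S * S]] @[t --> +oo%R]
    --> 0%E.

End Generators.

Section Duality.
Variable R : realType.

Definition Gamma (a : R) : R :=
  \int[@lebesgue_measure R]_(x in `]0, +oo[) (x `^ (a - 1) * expR (- x)).

Definition duality_factor (m : R) (k l : nat) : R :=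
  if (k <= l)%N then
    l`!%:R / (l - k)`!%:R * (Gamma (m / 2) / Gamma (m / 2 + k%:R))
  else 0.

Variable S : countType.
Variable m : R.

Definition finite_config (xi : S -> nat) : Prop :=
  finite_set [set x | xi x <> 0%N].

Definition mass (xi : S -> nat) : nat := \sum_(x \in [set: S]) xi x.

(* For finite xi all but finitely many factors equal duality_factor m 0 _ = 1. *)
Definition D (xi eta : S -> nat) : R :=
  \big[*%R/1]_(x \in [set: S]) duality_factor m (xi x) (eta x).

Definition occupation (n : nat) (x : 'I_n -> S) : S -> nat :=
  fun z => (\sum_(i < n) (x i == z))%N.

Implicit Type mu : {measure set (config S) -> \bar R}.

Definition dual_moment mu (xi : S -> nat) : \bar R :=
  (\int[mu]_eta (D xi eta)%:E)%E.

Definition K mu (n : nat) (x : 'I_n -> S) : \bar R :=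
  dual_moment mu (occupation x).

Definition Pf mu : Prop :=
  forall n : nat,
    (ereal_sup [set dual_moment mu xi
               | xi in [set xi | finite_config xi /\ mass xi = n]] < +oo)%E.

Definition moment_cvg (mus : nat -> {measure set (config S) -> \bar R}) mu :
    Prop :=
  forall xi, finite_config xi ->
    dual_moment (mus n) xi @[n --> \oo] --> dual_moment mu xi.

Definition product_measure mu : Prop :=
  exists rho : S -> probability nat R,
    forall (s : seq S) (B : S -> set nat), uniq s ->
      mu [set eta : config S | forall x, x \in s -> B x (eta x)] =
      (\prod_(x <- s) rho x (B x))%E.

End Duality.

Definition tempered (G : geometry) : set (sites G -> nat) :=
  match G return set (sites G -> nat) with
  | FiniteSites _ => setT
  | Lattice d => [set eta : 'rV[int]_d -> nat |
      exists c k : nat, forall x : 'rV[int]_d,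
        (eta x <= c * (1 + \sum_(i < d) absz (x 0%R i)) ^ k)%N]
  end.

Definition is_lattice (G : geometry) : bool :=
  if G is Lattice _ then true else false.

Section Process.
Variable R : realType.

Definition local_fun (S : countType) (f : (S -> nat) -> R) : Prop :=
  exists s : seq S, forall eta zeta : S -> nat,
    (forall x, x \in s -> eta x = zeta x) -> f eta = f zeta.

Definition sup_bounded (T : Type) (f : T -> R) : Prop :=
  exists M, forall x, `|f x| <= M.

(* P t eta is the law at time t >= 0 of the process started from eta.  Nothing
   is required of P t eta when eta is not tempered. *)
Record SIP (G : geometry) (p : sites G -> sites G -> R) (m : R)
    (P : R -> R.-pker (config (sites G)) ~> (config (sites G))) : Prop := {
  sip_start : forall (eta : config (sites G)) (A : set (config (sites G))),
    tempered eta -> measurable A -> P 0 eta A = \d_eta A;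
  sip_markov : forall (s t : R) (eta : config (sites G)) (A : set (config (sites G))),
    0 <= s -> 0 <= t -> tempered eta -> measurable A ->
    P (s + t) eta A = (\int[P s eta]_zeta P t zeta A)%E;
  sip_tempered : forall (t : R) (eta : config (sites G)),
    0 <= t -> tempered eta -> P t eta (@tempered G) = 1%E;
  sip_generated : forall (f : (sites G -> nat) -> R)
      (eta : config (sites G)),
    local_fun f -> sup_bounded f -> tempered eta ->
    h^-1 * (\int[P h eta]_zeta f zeta - f eta) @[h --> 0^'+]
      --> sip_generator p m f eta;
  (* With finitely many particles the jump rates are bounded. *)
  sip_finite : forall (t : R) (xi xi' : config (sites G)),
    0 <= t -> finite_config xi -> finite_config xi' ->
    P t xi [set xi'] = (chain_prob (sip_generator p m) t xi [set xi'])%:E;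
  sip_duality : forall (t : R) (xi eta : config (sites G)),
    is_lattice G -> 0 <= t -> finite_config xi -> tempered eta ->
    (\int[P t eta]_zeta (D m xi zeta)%:E =
     \int[P t xi]_(zeta in [set zeta | finite_config zeta])
        (D m zeta eta)%:E)%E }.

(* \nu S(t) = \int P t eta nu(d eta), as a measure *)
Definition evolve (S : countType) (P : R.-pker (config S) ~> (config S))
    (nu : probability (config S) R) : {measure set (config S) -> \bar R} :=
  mkcomp_noparam
    (kprobability (measurable_cst (nu : pprobability (config S) R)) :
       R.-pker unit ~> (config S)) P tt.

Definition invariant_law (S : countType)
    (P : R -> R.-pker (config S) ~> (config S))
    (mu : probability (config S) R) : Prop :=
  forall (t : R) (A : set (config S)), 0 <= t -> measurable A ->
    evolve (P t) mu A = mu A.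

End Process.

(* Main.v *)
(* On a finite set (A1) fails, so S = Z^d.  By duality K_{nu S(t)}, restricted to
   n labelled particles, is e^{tL_n} K_nu, where L_n has bounded rates: e^{tL_n} is
   a Poisson mixture of the powers of a Markov operator Q_n.  Since a Poisson law
   of large mean is almost invariant under a unit shift, the limit K_mu is fixed
   by Q_n, hence by every e^{tL_n}.  As nu is a product measure, K_nu(x) equals
   the product of the rho(x_i) = K_nu(x_i) when the x_i are distinct; two labelled
   particles of the n-particle process evolve, after summation over pairs, like
   the two-particle process, so by (A2) coincidences disappear and K_mu is the
   limit of e^{t_k L_n} applied to the product function.  Hence K_mu(x_1,...,x_n)
   is at most C^n, so mu is determined by its duality moments and is invariant;
   and L_n applied to a product function exceeds the generator of independent
   walkers by nonnegative multiples of (rho(x_i) - rho(x_j))^2, which gives the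
   correlation inequality. *)

Require Import Defs.
From HB Require Import structures.
From mathcomp Require Import all_boot all_order all_algebra.
From mathcomp Require Import all_classical all_reals all_analysis.
From mathcomp Require Import measurable_realfun zify ring lra.
Import Order.TTheory GRing.Theory Num.Theory.
Import numFieldNormedType.Exports.
Local Open Scope classical_set_scope.
Local Open Scope ring_scope.

Set Implicit Arguments.
Unset Strict Implicit.
Unset Printing Implicit Defensive.

(** * Exponential series *)

(** The infinite system is reached only through duality from tempered configurations, and finite
    systems only through point probabilities given by power series in [t]. So bounded first moments
    have to force temperedness almost surely, and the signed series of [lam (Q - 1)] has to become a
    Poisson mixture, where positivity allows comparison and Tonelli. Invariance needs the geometric
    bound because membership in [P_f] allows moments of any growth in [n], hence no determinacy. As
    Gamma(m/2 + k) / (Gamma(m/2) k!) also grows geometrically, the bound gives each site an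
    exponential moment with base slightly above 1. The generating function is therefore carried from
    1 (factorial moments) to 0 (point probabilities) in many small Taylor steps. The correlation
    inequality compares Euler schemes rather than semigroups: moving each factor of a product by a
    walk step agrees with the generator of independent walkers up to the squared step size, and a
    small Euler step of the SIP is monotone. *)

Section ExponentialSeries.
Variable R : realType.
Implicit Types (q a b A B : nat -> R) (t x tau M C : R).

Lemma exp_dominated_cvg t M C q : (forall k, `|q k| <= M * C ^+ k) ->
  cvgn (series (fun k => t ^+ k / k`!%:R * q k)).
Proof.
move=> hq; apply: normed_cvg.
have C0 : 0 <= `|C| by [].
apply: (@series_le_cvg _ _ (fun k => `|M| * exp_coeff (`|t| * `|C|) k)) => //.
- by move=> k /=.
- by move=> k; rewrite mulr_ge0// exp_coeff_ge0// mulr_ge0.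
- move=> k /=; rewrite normrM normf_div normrX (ger0_norm (ler0n _ _)).
  rewrite [leRHS](_ : _ = `|t| ^+ k / k`!%:R * (`|M| * `|C| ^+ k)); last first.
    by rewrite /exp_coeff /= exprMn; ring.
  rewrite ler_wpM2l//.
  by rewrite (le_trans (hq k))// (le_trans (ler_norm _))// normrM normrX.
- exact: (@is_cvg_seriesZ _ (exp_coeff _) `|M| (is_cvg_series_exp_coeff _)).
Qed.

(** Coefficients of the Cauchy product of two series. *)
Definition conv (a b : nat -> R) n := \sum_(k < n.+1) a (n - k)%N * b k.

(** With [j = n - k], a partial sum of the Cauchy product runs over a triangle inside the square
    belonging to the product of partial sums. *)
Lemma conv_triangle a b N :
  series (conv a b) N = \sum_(k < N) \sum_(j < N | (j + k < N)%N) a j * b k.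
Proof.
rewrite /series /= /conv big_mkord.
transitivity (\sum_(n < N) \sum_(k < N | (k <= n)%N) a (n - k)%N * b k).
  apply: eq_bigr => n _.
  rewrite (big_ord_widen _ (fun k => a (n - k)%N * b k) (ltn_ord n)).
  by apply: eq_bigl => k; rewrite ltnS.
rewrite (exchange_big_dep xpredT)//=; apply: eq_bigr => k _.
rewrite -(big_mkord (fun n => k <= n)%N (fun n => a (n - k)%N * b k)).
rewrite -(big_mkord (fun j => j + k < N)%N (fun n => a n * b k)).
rewrite [LHS](_ : _ = \sum_(0 + k <= i < N) a (i - k)%N * b k); last first.
  by rewrite add0n [RHS](@big_nat_widenl _ _ _ _ 0%N).
rewrite big_addn; under eq_bigr do rewrite addnK.
rewrite [RHS](_ : _ = \sum_(0 <= i < N | (i < N - k)%N) a i * b k); last first.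
  by apply: eq_bigl => i; rewrite ltn_subRL addnC.
by rewrite [LHS](big_nat_widen 0 (N - k) N)// leq_subr.
Qed.

Lemma square_sub_triangle a b N :
  series a N * series b N - series (conv a b) N =
  \sum_(k < N) \sum_(j < N | ~~ (j + k < N)%N) a j * b k.
Proof.
rewrite conv_triangle /series /= !big_mkord mulrC big_distrl/= -sumrB.
apply: eq_bigr => k _; rewrite mulrC big_distrl/=.
by rewrite (bigID (fun j : 'I_N => (j + k < N)%N))/= addrAC subrr add0r.
Qed.

(* Square minus triangle of the partial sums is controlled by the same
   difference for the majorants, for which the identity is assumed. *)
Lemma cauchy_product_dominated a b A B (la lb lA lB : R) :
  (forall k, `|a k| <= A k) -> (forall k, `|b k| <= B k) ->
  series a @ \oo --> la -> series b @ \oo --> lb ->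
  series A @ \oo --> lA -> series B @ \oo --> lB ->
  series (conv A B) @ \oo --> lA * lB ->
  series (conv a b) @ \oo --> la * lb.
Proof.
move=> hA hB ca cb cA cB cAB.
have cAB0 : series A N * series B N - series (conv A B) N @[N --> \oo] --> 0.
  by rewrite -[X in _ --> X](subrr (lA * lB)); apply: cvgB => //; exact: cvgM.
have c0 : series a N * series b N - series (conv a b) N @[N --> \oo] --> 0.
  apply/norm_cvg0P/(squeeze_cvgr _ (@cvg_cst _ _ _ _ _) cAB0).
  near=> N; rewrite normr_ge0/= !square_sub_triangle.
  apply: (le_trans (ler_norm_sum _ _ _)); apply: ler_sum => k _.
  apply: (le_trans (ler_norm_sum _ _ _)); apply: ler_sum => j _.
  by rewrite normrM ler_pM.
rewrite [X in X @ _ --> _](_ : _ = (fun N => series a N * series b N -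
   (series a N * series b N - series (conv a b) N))); last first.
  by apply/funext => N; rewrite subKr.
rewrite -[X in _ --> X]subr0; apply: cvgB => //; exact: cvgM.
Unshelve. all: by end_near. Qed.

Lemma exp_conv x y : conv (exp_coeff x) (exp_coeff y) = exp_coeff (x + y) :> (nat -> R).
Proof.
apply/funext => n; rewrite /conv /exp_coeff /= exprDn mulr_suml.
apply: eq_bigr => k _; rewrite -mulr_natr -(bin_fact (n := n) (m := k)) ?natrM -1?ltnS//.
have h : (0 < 'C(n, k))%N by rewrite bin_gt0 -ltnS.
by field; rewrite !pnatr_eq0 -!lt0n h !fact_gt0.
Qed.

Lemma series_exp_cvg x : series (exp_coeff x) @ \oo --> expR x.
Proof. exact: is_cvg_series_exp_coeff. Qed.

(* e^(tau (Q - 1)) = e^(- tau) e^(tau Q), read along an orbit q k = Q^k f x. *)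
Lemma poissonize tau M q : 0 <= tau -> (forall k, `|q k| <= M) ->
  limn (series (fun n => tau ^+ n / n`!%:R *
          \sum_(k < n.+1) (-1) ^+ (n - k) * 'C(n, k)%:R * q k)) =
  expR (- tau) * limn (series (fun k => tau ^+ k / k`!%:R * q k)).
Proof.
move=> tau0 hq.
have M0 : 0 <= M by exact: le_trans (hq 0%N).
apply/cvg_lim => //.
(* Distributing [tau^n / n!] turns the alternating binomial sum into the Cauchy product of the
   coefficients of [e^(- tau)] with the series of [q]. *)
rewrite [X in series X @ _ --> _](_ : _ =
    conv (exp_coeff (- tau)) (fun k => tau ^+ k / k`!%:R * q k)); last first.
  apply/funext => n; rewrite /conv mulr_sumr; apply: eq_bigr => k _.
  rewrite /exp_coeff /= -(bin_fact (n := n) (m := k)) ?natrM -1?ltnS//.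
  have h : (0 < 'C(n, k))%N by rewrite bin_gt0 -ltnS.
  rewrite (exprNn tau) -{1}(@subnK k n) -1?ltnS// exprD.
  by field; rewrite !pnatr_eq0 -!lt0n h !fact_gt0.
(* Both majorants are exponential series, so [exp_conv] computes their Cauchy product. *)
pose B k := M * exp_coeff tau k.
apply: (@cauchy_product_dominated _ _ (exp_coeff tau) B _ _ (expR tau) (M * expR tau)).
- by move=> k; rewrite /exp_coeff /= normf_div normrX normrN ger0_norm// (ger0_norm (ler0n _ _)).
- move=> k; rewrite /B /exp_coeff /= normrM ger0_norm ?divr_ge0 ?exprn_ge0//.
  by rewrite mulrC ler_wpM2r// divr_ge0 ?exprn_ge0.
- exact: series_exp_cvg.
- by apply: (@exp_dominated_cvg _ M 1) => k; rewrite expr1n mulr1.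
- exact: series_exp_cvg.
- have -> : series B = M *: series (exp_coeff tau) by rewrite -seriesZ.
  by apply: cvgZ; [exact: cvg_cst | exact: series_exp_cvg].
- have -> : conv (exp_coeff tau) B = M *: conv (exp_coeff tau) (exp_coeff tau).
    apply/funext => n; rewrite /conv /B /= fctE /= scaler_sumr; apply: eq_bigr => k _.
    by rewrite mulrCA.
  rewrite seriesZ exp_conv mulrCA -expRD.
  by apply: cvgZ; [exact: cvg_cst | exact: series_exp_cvg].
Qed.

Lemma bernoulli (y : R) n : y <= 1 -> 1 - y *+ n <= (1 - y) ^+ n.
Proof.
move=> y1; elim: n => [|k IH]; first by rewrite mulr0n expr0 subr0.
rewrite exprS mulrS; apply: (@le_trans _ _ ((1 - y) * (1 - y *+ k))); last first.
  by rewrite ler_wpM2l// subr_ge0.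
rewrite -subr_ge0 [leRHS](_ : _ = y * y *+ k); last by rewrite -mulr_natl -[y *+ k]mulr_natl; ring.
by rewrite mulrn_wge0// -expr2 sqr_ge0.
Qed.

(** Squeeze with [y = x / N]: above, [1 + y <= e^y]; below, [e^(- y) >= 1 - y] gives
    [1 + y >= e^y (1 - y^2)], and Bernoulli bounds [(1 - y^2)^N] from below by [1 - x^2 / N]. *)
Lemma cvg_compound x : 0 <= x -> (1 + x / N%:R) ^+ N @[N --> \oo] --> expR x.
Proof.
move=> x0.
have cx : expR x * (1 - x ^+ 2 / N%:R) @[N --> \oo] --> expR x.
  rewrite -[X in _ --> X]mulr1; apply: cvgM; first exact: cvg_cst.
  rewrite -[X in _ --> X]subr0; apply: cvgB; first exact: cvg_cst.
  rewrite -[X in _ --> X](mulr0 (x ^+ 2)); apply: cvgM; first exact: cvg_cst.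
  by rewrite -cvg_shiftS; exact: cvg_harmonic.
apply: (squeeze_cvgr _ cx (@cvg_cst _ _ _ _ _)).
near=> N.
have N0 : 0 < N%:R :> R by rewrite ltr0n; near: N; exact: nbhs_infty_gt.
have Nx : x < N%:R by near: N; exact: nbhs_infty_gtr.
have y0 : 0 <= x / N%:R by rewrite divr_ge0// ltW.
have y1 : x / N%:R <= 1 by rewrite ler_pdivrMr// mul1r ltW.
have xE : expR x = expR (x / N%:R) ^+ N by rewrite -expRM_natr divfK// gt_eqF.
apply/andP; split; last first.
  by rewrite xE lerXn2r// ?nnegrE ?expR_ge0 ?addr_ge0// expR_ge1Dx.
have step : expR (x / N%:R) * (1 - (x / N%:R) ^+ 2) <= 1 + x / N%:R.
  rewrite -(ler_pM2l (expR_gt0 (- (x / N%:R)))) mulrA -expRD addNr expR0 mul1r.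
  have := expR_ge1Dx (- (x / N%:R)); nra.
apply: (@le_trans _ _ (expR x * (1 - (x / N%:R) ^+ 2) ^+ N)).
  rewrite ler_pM2l ?expR_gt0//.
  have -> : x ^+ 2 / N%:R = (x / N%:R) ^+ 2 *+ N.
    by rewrite -mulr_natr; field; rewrite gt_eqF.
  have h2 : (x / N%:R) ^+ 2 <= 1 by rewrite exprn_ile1.
  exact: bernoulli.
rewrite xE -exprMn lerXn2r ?nnegrE//.
  by rewrite mulr_ge0 ?expR_ge0// subr_ge0 exprn_ile1.
by rewrite addr_ge0.
Unshelve. all: by end_near. Qed.

Lemma bin_ffact_le (N k : nat) : ('C(N, k)%:R / N%:R ^+ k : R) <= k`!%:R^-1.
Proof.
have [->|N0] := posnP N.
  by case: k => [|k]; rewrite ?bin0 ?bin0n ?expr0 ?fact0 ?divr1 ?invr1// mul0r invr_ge0.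
rewrite ler_pdivrMr ?exprn_gt0 ?ltr0n// ler_pdivlMl ?ltr0n ?fact_gt0//.
rewrite -natrM -natrX ler_nat mulnC bin_ffact.
elim: k => // k IH; by rewrite ffactnSr expnSr leq_mul// leq_subr.
Qed.

(** The gaps [1 / k! - 'C(N, k) / N^k] are nonnegative, so the error is at most the error for
    [|M| |C|^k] in place of [q k], which tends to 0 by the scalar limit [cvg_compound]. *)
Lemma binomial_cvg_exp x M C q : 0 <= x -> (forall k, `|q k| <= M * C ^+ k) ->
  \sum_(k < N.+1) 'C(N, k)%:R * (x / N%:R) ^+ k * q k @[N --> \oo] -->
  limn (series (fun k => x ^+ k / k`!%:R * q k)).
Proof.
move=> x0 hq.
have hq' k : `|q k| <= `|M| * `|C| ^+ k.
  by rewrite (le_trans (hq k))// (le_trans (ler_norm _))// normrM normrX.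
have cS := @exp_dominated_cvg x M C q hq.
pose y := x * `|C|.
have y0 : 0 <= y by rewrite mulr_ge0.
have c0 : `|M| * (series (exp_coeff y) N.+1 - (1 + y / N%:R) ^+ N) @[N --> \oo] --> 0.
  rewrite -[X in _ --> X](mulr0 `|M|); apply: cvgM; first exact: cvg_cst.
  rewrite -[X in _ --> X](subrr (expR y)); apply: cvgB; last exact: cvg_compound.
  by rewrite (cvg_shiftS (series (exp_coeff y))); exact: series_exp_cvg.
pose s N := \sum_(k < N.+1) 'C(N, k)%:R * (x / N%:R) ^+ k * q k.
pose S := series (fun k => x ^+ k / k`!%:R * q k).
have d0 : S N.+1 - s N @[N --> \oo] --> 0.
  apply/norm_cvg0P/(squeeze_cvgr _ (@cvg_cst _ _ _ _ _) c0).
  near=> N; rewrite normr_ge0/=.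
  have N0 : 0 < N%:R :> R by rewrite ltr0n; near: N; exact: nbhs_infty_gt.
  rewrite /S /s /series /= !big_mkord exprDn -sumrB -sumrB mulr_sumr.
  apply: (le_trans (ler_norm_sum _ _ _)); apply: ler_sum => k _.
  rewrite expr1n mul1r -[_ ^+ k *+ _]mulr_natl -mulrBl normrM /exp_coeff /y [X in _ * X]/=.
  have -> : x ^+ k / k`!%:R - 'C(N, k)%:R * (x / N%:R) ^+ k =
            (k`!%:R^-1 - 'C(N, k)%:R / N%:R ^+ k) * x ^+ k.
    by rewrite expr_div_n; ring.
  rewrite normrM ger0_norm ?subr_ge0 ?bin_ffact_le//.
  rewrite (ger0_norm (exprn_ge0 _ x0)).
  have -> : (x * `|C|) ^+ k / k`!%:R - 'C(N, k)%:R * (x * `|C| / N%:R) ^+ k =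
            (k`!%:R^-1 - 'C(N, k)%:R / N%:R ^+ k) * x ^+ k * `|C| ^+ k.
    by rewrite expr_div_n exprMn; ring.
  rewrite [leRHS]mulrCA ler_wpM2l//.
  by rewrite mulr_ge0 ?exprn_ge0// subr_ge0 bin_ffact_le.
rewrite (_ : (fun N => _) = (fun N => S N.+1 - (S N.+1 - s N))); last first.
  by apply/funext => N; rewrite subKr.
rewrite -[X in _ --> X]subr0; apply: cvgB => //.
by rewrite (cvg_shiftS S).
Unshelve. all: by end_near. Qed.

End ExponentialSeries.
(** * Poisson mixtures of the powers of a Markov operator *)

Lemma cvg_sumr (R : realType) (I : Type) (r : seq I) (P : pred I)
    (u : I -> nat -> R) (l : I -> R) :
  (forall i, P i -> u i @ \oo --> l i) ->
  \sum_(i <- r | P i) u i N @[N --> \oo] --> \sum_(i <- r | P i) l i.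
Proof.
move=> ul; elim: r => [|i r IH].
  by under eq_fun do rewrite big_nil; rewrite big_nil; exact: cvg_cst.
under eq_fun do rewrite big_cons; rewrite big_cons.
by case: ifP => // Pi; apply: cvgD => //; exact: ul.
Qed.

Section MarkovOperator.
Variables (R : realType) (E : Type).
Implicit Types (f g : E -> R) (T : (E -> R) -> E -> R) (t tau M : R).

Definition sum_linear T := forall n (a : 'I_n -> R) (g : 'I_n -> E -> R) x,
  T (fun y => \sum_(k < n) a k * g k y) x = \sum_(k < n) a k * T (g k) x.

(** Induction step of the binomial theorem for [al + be T], with [q k] in the role of [T^k f x]. *)
Lemma pascal_step (al be : R) N (q : nat -> R) :
  \sum_(k < N.+1) 'C(N, k)%:R * al ^+ (N - k) * be ^+ k * (al * q k + be * q k.+1) =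
  \sum_(k < N.+2) 'C(N.+1, k)%:R * al ^+ (N.+1 - k) * be ^+ k * q k.
Proof.
under eq_bigr do rewrite mulrDr.
rewrite big_split /= big_ord_recl [in RHS]big_ord_recl /= !bin0 !subn0 expr0.
rewrite [X in _ + X + _]/= big_ord_recr /= [in RHS]big_ord_recr /= !binn !subnn.
rewrite -!addrA; congr (_ + _); first by rewrite exprS; ring.
rewrite !addrA -big_split /=; congr (_ + _); last by rewrite exprS; ring.
apply: eq_bigr => k _; rewrite /bump /= add1n binS subSS natrD.
have kN := ltn_ord k.
have -> : (N - k = (N - k.+1).+1)%N by rewrite subnSK.
by rewrite !exprS; ring.
Qed.

(** Used with [al = - lam], [be = lam] for a generator, and with [al = 1], [be = t / N] for an Euler
    step. *)
Lemma iter_affine T A (al be : R) f N x : sum_linear T ->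
  (forall g y, A g y = al * g y + be * T g y) ->
  iter N A f x =
  \sum_(k < N.+1) 'C(N, k)%:R * al ^+ (N - k) * be ^+ k * iter k T f x.
Proof.
move=> Tlin hA; elim: N x => [|N IH] x.
  by rewrite big_ord1 bin0 subn0 !expr0 !mul1r.
rewrite iterS hA (_ : iter N A f = (fun y => \sum_(k < N.+1)
    'C(N, k)%:R * al ^+ (N - k) * be ^+ k * iter k T f y)); last exact/funext.
rewrite Tlin !mulr_sumr -big_split /= -(pascal_step al be N (fun k => iter k T f x)).
apply: eq_bigr => k _; rewrite iterS.
by rewrite (_ : [eta iter k T f] = iter k T f)//; ring.
Qed.

Variables (J : finType) (c : J -> E -> R) (phi : J -> E -> E).

Definition transition f x := \sum_j c j x * f (phi j x).

(** Mean of [Q^N f x] for [N] Poisson of mean [tau], that is [e^(tau (Q - 1)) f x] for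
    [Q = transition]. *)
Definition heat (tau : R) f x :=
  expR (- tau) * limn (series (fun k => tau ^+ k / k`!%:R * iter k transition f x)).

Lemma markov_linear : sum_linear transition.
Proof.
move=> n a g x; rewrite /transition.
under eq_bigr do rewrite mulr_sumr.
rewrite exchange_big /=; apply: eq_bigr => k _; rewrite mulr_sumr.
by apply: eq_bigr => j _; rewrite mulrCA.
Qed.

Lemma iter_markovB k f g x :
  iter k transition (f \- g) x = iter k transition f x - iter k transition g x.
Proof.
elim: k x => // k IH x; rewrite !iterS {1}/transition -sumrB.
by apply: eq_bigr => j _; rewrite IH mulrBr.
Qed.

Lemma iter_markovZ k (a : R) f x :
  iter k transition (fun y => a * f y) x = a * iter k transition f x.
Proof.
elim: k x => // k IH x; rewrite !iterS {1}/transition mulr_sumr.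
by apply: eq_bigr => j _; rewrite IH mulrCA.
Qed.

Hypothesis c_ge0 : forall j x, 0 <= c j x.
Hypothesis c_sum1 : forall x, \sum_j c j x = 1.

Lemma iter_markov_ge0 k f x : (forall y, 0 <= f y) -> 0 <= iter k transition f x.
Proof.
move=> f0; elim: k x => // k IH x.
by rewrite iterS; apply: sumr_ge0 => j _; rewrite mulr_ge0.
Qed.

Lemma iter_markov_fixed k f x : (forall y, transition f y = f y) ->
  iter k transition f x = f x.
Proof.
by move=> /funext hf; elim: k => // k IH; rewrite iterSr hf.
Qed.

Lemma iter_markov_cst k (a : R) x : iter k transition (fun=> a) x = a.
Proof.
by rewrite iter_markov_fixed// => y; rewrite /transition -mulr_suml c_sum1 mul1r.
Qed.

Lemma iter_markov_le k f g x : (forall y, f y <= g y) ->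
  iter k transition f x <= iter k transition g x.
Proof.
move=> fg; rewrite -subr_ge0 -iter_markovB.
by apply: iter_markov_ge0 => y /=; rewrite subr_ge0.
Qed.

Lemma iter_markov_norm k f M x : (forall y, `|f y| <= M) ->
  `|iter k transition f x| <= M.
Proof.
move=> fM; rewrite ler_norml -[in X in X <= _](iter_markov_cst k (- M) x).
rewrite -[in X in _ && X](iter_markov_cst k M x).
by apply/andP; split; apply: iter_markov_le => y;
  have := fM y; rewrite ler_norml => /andP[].
Qed.

Lemma heat_cvg tau f M x : (forall y, `|f y| <= M) ->
  cvgn (series (fun k => tau ^+ k / k`!%:R * iter k transition f x)).
Proof.
move=> fM; apply: (@exp_dominated_cvg _ tau M 1) => k.
by rewrite expr1n mulr1; exact: iter_markov_norm.
Qed.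

Lemma heat_fixed tau f x : (forall y, transition f y = f y) -> heat tau f x = f x.
Proof.
move=> hf; rewrite /heat.
rewrite (_ : (fun k => _) = f x *: exp_coeff tau); last first.
  by apply/funext => k; rewrite iter_markov_fixed// mulrC.
rewrite lim_seriesZ; last exact: is_cvg_series_exp_coeff.
by rewrite -/(expR tau) [_ *: _]mulrC mulrA -expRD addNr expR0 mul1r.
Qed.

Lemma heat_cst tau (a : R) x : heat tau (fun=> a) x = a.
Proof. by rewrite heat_fixed// => y; exact: (iter_markov_cst 1). Qed.

Lemma heat_le tau f g M x : 0 <= tau ->
  (forall y, `|f y| <= M) -> (forall y, `|g y| <= M) ->
  (forall y, f y <= g y) -> heat tau f x <= heat tau g x.
Proof.
move=> tau0 fM gM fg; rewrite ler_wpM2l ?expR_ge0//.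
apply: lim_series_le; [exact: heat_cvg fM|exact: heat_cvg gM|move=> k].
by rewrite ler_wpM2l ?divr_ge0 ?exprn_ge0// iter_markov_le.
Qed.

Lemma heatZ tau (a : R) f M x : (forall y, `|f y| <= M) ->
  heat tau (fun y => a * f y) x = a * heat tau f x.
Proof.
move=> fM; rewrite /heat mulrCA; congr (_ * _).
rewrite (_ : (fun k => _) = a *: (fun k => tau ^+ k / k`!%:R * iter k transition f x)).
  by rewrite lim_seriesZ//; exact: heat_cvg fM.
by apply/funext => k; rewrite iter_markovZ mulrCA.
Qed.

Lemma heatB tau f g M x : (forall y, `|f y| <= M) -> (forall y, `|g y| <= M) ->
  heat tau (f \- g) x = heat tau f x - heat tau g x.
Proof.
move=> fM gM; rewrite /heat -mulrBr; congr (_ * _).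
rewrite -lim_seriesB; [|exact: heat_cvg fM|exact: heat_cvg gM].
congr (limn (series _)); apply/funext => k.
by rewrite iter_markovB mulrBr.
Qed.

(** * Generators of the form lam (Q - 1) *)

Section Generator.
Variables (L : (E -> R) -> E -> R) (lam : R).
Hypothesis lam0 : 0 <= lam.
Hypothesis LE : forall f x, L f x = lam * (transition f x - f x).

Lemma generator_linear : sum_linear L.
Proof.
move=> n a g x; rewrite LE markov_linear -sumrB mulr_sumr.
by apply: eq_bigr => k _; rewrite LE; ring.
Qed.

(** The series defining [exp_semigroup] has terms of both signs; as a Poisson mixture it visibly
    preserves order and constants. *)
Lemma exp_semigroupE t f M x : 0 <= t -> (forall y, `|f y| <= M) ->
  exp_semigroup L t f x = heat (lam * t) f x.
Proof.
move=> t0 fM; rewrite /heat.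
rewrite -(@poissonize _ _ M) ?mulr_ge0//; last first.
  by move=> k; exact: iter_markov_norm.
congr (limn (series _)); apply/funext => n.
rewrite (@iter_affine transition L (- lam) lam f n x markov_linear); last first.
  by move=> g y; rewrite LE; ring.
rewrite !mulr_sumr; apply: eq_bigr => k _.
have -> : (lam * t) ^+ n = lam ^+ (n - k) * lam ^+ k * t ^+ n.
  by rewrite exprMn -exprD subnK// -ltnS.
by rewrite (exprNn lam); ring.
Qed.

Lemma iter_generator_norm k f M x : (forall y, `|f y| <= M) ->
  `|iter k L f x| <= M * (lam + lam) ^+ k.
Proof.
move=> fM; have M0 : 0 <= M by exact: le_trans (fM x).
elim: k x => [|k IH] x; first by rewrite expr0 mulr1.
rewrite iterS LE normrM ger0_norm//.
have := @iter_markov_norm 1 _ _ x IH; rewrite /= => h1.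
have h2 := IH x.
rewrite exprS mulrCA.
have -> : (lam + lam) * (M * (lam + lam) ^+ k) =
    lam * (M * (lam + lam) ^+ k + M * (lam + lam) ^+ k) by ring.
by rewrite ler_wpM2l// (le_trans (ler_normB _ _))// lerD.
Qed.

(** Euler schemes later turn an inequality between generators into one between semigroups. The
    binomial expansion of [(1 + (t / N) L)^N] is compared with the exponential series term by
    term. *)
Lemma euler_cvg t f M x : 0 <= t -> (forall y, `|f y| <= M) ->
  iter N (fun g y => g y + t / N%:R * L g y) f x @[N --> \oo] -->
  heat (lam * t) f x.
Proof.
move=> t0 fM; rewrite -(exp_semigroupE _ t0 fM) /exp_semigroup.
rewrite (_ : (fun N => _) = (fun N => \sum_(k < N.+1)
   'C(N, k)%:R * (t / N%:R) ^+ k * iter k L f x)); last first.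
  apply/funext => N; rewrite (@iter_affine L _ 1 (t / N%:R) f N x generator_linear).
    by apply: eq_bigr => k _; rewrite expr1n mulr1.
  by move=> g y; rewrite mul1r.
apply: (@binomial_cvg_exp _ _ M (lam + lam)) => // k.
exact: iter_generator_norm.
Qed.

End Generator.

(** Truncation of [E (X / tau - 1)^2 = 1 / tau] for [X] Poisson. Writing [k^2 = k (k - 1) + k]
    shifts the exponential series by two and by one, whence the three lengths. *)
Lemma poisson_variance_partial (tau : R) N : tau != 0 ->
  series (fun k => tau ^+ k / k`!%:R * (k%:R / tau - 1) ^+ 2) N.+2 =
  series (exp_coeff tau) N + series (exp_coeff tau) N.+1 / tau -
  2 * series (exp_coeff tau) N.+1 + series (exp_coeff tau) N.+2.
Proof.
move=> t0; elim: N => [|N IH].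
  rewrite /series /= /exp_coeff /= !big_nat_recr ?big_geq//= fact0 factS fact0 muln1.
  by field.
rewrite seriesSr IH !(seriesSr (exp_coeff tau) N.+2) !(seriesSr (exp_coeff tau) N.+1).
rewrite !(seriesSr (exp_coeff tau) N) /exp_coeff /= !factS !natrM !exprS.
field; rewrite t0 !pnatr_eq0 -!lt0n fact_gt0 /=.
by rewrite !gt_eqF// ltr_wpDr.
Qed.

(* Shifting a Poisson variable by one costs its relative standard deviation in
   total variation. *)
Lemma heat_mixing tau f M x : 0 < tau -> (forall y, `|f y| <= M) ->
  `|transition (heat tau f) x - heat tau f x| <= M / Num.sqrt tau.
Proof.
move=> tau0 fM; have M0 : 0 <= M by exact: le_trans (fM x).
have tn0 : tau != 0 by rewrite gt_eqF.
set s := Num.sqrt tau; have s0 : 0 < s by rewrite sqrtr_gt0.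
have ss : s ^+ 2 = tau by rewrite sqr_sqrtr// ltW.
pose q k := iter k transition f x.
pose h k : R := tau ^+ k / k`!%:R.
have h0 k : 0 <= h k by rewrite divr_ge0 ?exprn_ge0// ltW.
have cq : series (fun k => h k * q k) @ \oo --> limn (series (fun k => h k * q k)).
  exact: heat_cvg fM.
have cq' : series (fun k => h k * q k.+1) @ \oo --> expR tau * transition (heat tau f) x.
  have -> : expR tau * transition (heat tau f) x = \sum_j c j x *
      limn (series (fun k => h k * iter k transition f (phi j x))).
    rewrite /transition mulr_sumr; apply: eq_bigr => j _; rewrite mulrCA /heat.
    by congr (_ * _); rewrite mulrA -expRD subrr expR0 mul1r.
  rewrite (_ : series _ = (fun N => \sum_j c j x *
      series (fun k => h k * iter k transition f (phi j x)) N)); last first.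
    apply/funext => N; rewrite /series /=.
    under [RHS]eq_bigr do rewrite mulr_sumr.
    rewrite exchange_big /=; apply: eq_bigr => k _; rewrite /q iterS /transition mulr_sumr.
    by apply: eq_bigr => j _; rewrite mulrCA.
  apply: cvg_sumr => j _; apply: cvgM; [exact: cvg_cst|exact: heat_cvg fM].
have -> : transition (heat tau f) x - heat tau f x =
    expR (- tau) * (expR tau * transition (heat tau f) x - limn (series (fun k => h k * q k))).
  by rewrite mulrBr mulrA -expRD addNr expR0 mul1r.
rewrite normrM ger0_norm ?expR_ge0// -(ler_pM2l (expR_gt0 tau)) mulrA -expRD subrr.
rewrite expR0 mul1r.
(* Up to the factor [e^tau], the limit is the variance of a Poisson variable divided by [tau^2]. *)
pose V := series (fun k => h k * (k%:R / tau - 1) ^+ 2).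
have cV : V N.+1 @[N --> \oo] --> expR tau / tau.
  rewrite -(cvg_shiftS (fun N => V N.+1)).
  rewrite (_ : [sequence _]_n = (fun N =>
      series (exp_coeff tau) N + series (exp_coeff tau) N.+1 / tau -
      2 * series (exp_coeff tau) N.+1 + series (exp_coeff tau) N.+2)); last first.
    by apply/funext => N; exact: poisson_variance_partial.
  have c0 := @series_exp_cvg _ tau.
  have c1 : series (exp_coeff tau) N.+1 @[N --> \oo] --> expR tau.
    by rewrite (cvg_shiftS (series (exp_coeff tau))).
  have c2 : series (exp_coeff tau) N.+2 @[N --> \oo] --> expR tau.
    by rewrite (cvg_shiftS (fun n => series (exp_coeff tau) n.+1)).
  have -> : expR tau / tau = expR tau + expR tau / tau - 2 * expR tau + expR tau by ring.
  apply: cvgD => //; apply: cvgB; first by apply: cvgD => //; apply: cvgM => //; exact: cvg_cst.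
  by apply: cvgM => //; exact: cvg_cst.
(* The inequality [|a| <= (1 + (s a)^2) / (2 s)] replaces Cauchy-Schwarz; with [s = sqrt tau] both
   halves contribute the same amount [M / (2 s)]. *)
have cB : M * ((2 * s)^-1 * series (exp_coeff tau) N.+1 + s / 2 * V N.+1) @[N --> \oo]
    --> expR tau * (M / s).
  have -> : expR tau * (M / s) = M * ((2 * s)^-1 * expR tau + s / 2 * (expR tau / tau)).
    by rewrite -ss; field; rewrite gt_eqF.
  apply: cvgM; first exact: cvg_cst.
  apply: cvgD; apply: cvgM => //; try exact: cvg_cst.
  by rewrite (cvg_shiftS (series (exp_coeff tau))); exact: series_exp_cvg.
have cA : `|series (fun k => h k * q k.+1) N - series (fun k => h k * q k) N.+1|
    @[N --> \oo] --> `|expR tau * transition (heat tau f) x - limn (series (fun k => h k * q k))|.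
  apply: cvg_norm; apply: cvgB => //.
  by rewrite (cvg_shiftS (series (fun k => h k * q k))).
apply: ler_cvg_to cA cB _; near=> N.
(* Since [h k.+1 * k.+1 / tau = h k], the shifted sum puts weight [h k * k / tau] on [q k]; the term
   [k = 0] is [- h 0 * q 0]. *)
have -> : series (fun k => h k * q k.+1) N - series (fun k => h k * q k) N.+1 =
   \sum_(0 <= k < N.+1) h k * (k%:R / tau - 1) * q k.
  rewrite /series /= big_nat_recl//= [in RHS]big_nat_recl//= opprD addrCA -sumrB mul0r sub0r.
  rewrite mulrN1 mulNr; congr (_ + _); apply: eq_bigr => k _.
  rewrite /h factS natrM exprS; field.
  by rewrite tn0 pnatr_eq0 -lt0n fact_gt0 gt_eqF// ltr_wpDr.
rewrite /V /series /= !mulr_sumr -big_split /= mulr_sumr.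
apply: (le_trans (ler_norm_sum _ _ _)); apply: ler_sum => k _.
rewrite normrM mulrC; apply: ler_pM => //; first exact: iter_markov_norm.
rewrite normrM ger0_norm// -/(h k) /exp_coeff /= -/(h k).
have -> : (2 * s)^-1 * h k + s / 2 * (h k * (k%:R / tau - 1) ^+ 2) =
   h k * ((1 + (s * (k%:R / tau - 1)) ^+ 2) / (2 * s)).
  by field; rewrite gt_eqF.
rewrite ler_wpM2l// ler_pdivlMr ?mulr_gt0//.
set a := k%:R / tau - 1.
have := sqr_ge0 (s * `|a| - 1); rewrite -[X in _ -> _ <= 1 + X]real_normK ?num_real//.
by rewrite normrM (gtr0_norm s0); lra.
Unshelve. all: by end_near. Qed.

End MarkovOperator.
(** * The Gamma function *)

Section GammaFunction.
Variable R : realType.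
Implicit Types a x : R.
Local Notation mu := (@lebesgue_measure R).

Definition gamma_fun a x : R := x `^ (a - 1) * expR (- x).
Definition gamma_int a : \bar R :=
  (\int[mu]_(x in `]0%R, +oo[) (gamma_fun a x)%:E)%E.

Lemma gamma_fun_ge0 a x : 0 <= gamma_fun a x.
Proof. by rewrite mulr_ge0 ?powR_ge0 ?expR_ge0. Qed.

Lemma measurable_gamma_fun a (A : set R) : measurable_fun A (gamma_fun a).
Proof.
apply/measurable_funTS/measurable_funM; first exact: measurable_powR.
by apply: (@measurableT_comp _ _ _ _ _ _ expR) => //; exact: measurable_expR.
Qed.

(** [x^a e^(- x)] is the boundary term in the integration by parts behind the functional
    equation. *)
Lemma gamma_fun_deriv a x : 0 < x ->
  is_derive x 1 (gamma_fun (a + 1)) (a * gamma_fun a x - gamma_fun (a + 1) x).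
Proof.
move=> x0.
have h1 := is_derive1_powR a x0.
have h2 : is_derive x 1 (fun y : R => expR (- y)) (- expR (- x)).
  have h3 : is_derive x 1 (fun y : R => - y) (- 1) by exact: is_deriveN.
  have h4 := @is_derive1_comp R expR _ x _ _ (is_derive_expR (- x)) h3.
  by apply: is_derive_eq; rewrite mulrN1.
rewrite (_ : gamma_fun (a + 1) = (fun y => y `^ a) * (fun y => expR (- y))).
  have h3 := is_deriveM h1 h2.
  by apply: is_derive_eq; rewrite /gamma_fun !fctE /GRing.scale /=; ring.
by apply/funext => y; rewrite /gamma_fun addrK.
Qed.

Lemma continuous_gamma_fun a x : 0 < x -> {for x, continuous (gamma_fun a)}.
Proof.
move=> x0; have [+ _] := @gamma_fun_deriv (a - 1) x x0; rewrite subrK => h.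
by apply: differentiable_continuous; apply/derivable1_diffP.
Qed.

(** Compact exhaustion of the positive half-line that stays away from 0, where [gamma_fun a] is
    singular for [a < 1]. *)
Definition seg n : set R := `[n.+1%:R^-1, n.+1%:R].

Lemma bigcup_seg : \bigcup_n seg n = `]0, +oo[%classic.
Proof.
apply/seteqP; split => x /=.
  move=> [n _]; rewrite /seg /= !in_itv /= andbT => /andP[h _].
  by rewrite (lt_le_trans _ h)// invr_gt0.
rewrite in_itv /= andbT => x0.
have y0 : 0 <= Num.max x x^-1 by rewrite le_max ltW.
exists (Num.bound (Num.max x x^-1)) => //; rewrite /seg /= in_itv /=.
have := archi_boundP y0; set N := Num.bound _ => hN.
have hS : N%:R <= N.+1%:R :> R by rewrite ler_nat.
have : x < N.+1%:R by rewrite (lt_le_trans _ hS)// (le_lt_trans _ hN)// le_max lexx.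
have : x^-1 < N.+1%:R by rewrite (lt_le_trans _ hS)// (le_lt_trans _ hN)// le_max lexx orbT.
move=> h1 h2; rewrite (ltW h2) andbT -[leRHS]invrK lef_pV2 ?posrE ?invr_gt0//.
exact: ltW.
Qed.

Lemma seg_gt0 n x : seg n x -> 0 < x.
Proof. by rewrite /seg /= in_itv /= => /andP[h _]; rewrite (lt_le_trans _ h)// invr_gt0. Qed.

Lemma gamma_int_seg a : (\int[mu]_(x in seg n) (gamma_fun a x)%:E)%E @[n --> \oo]
  --> gamma_int a.
Proof.
rewrite /gamma_int -bigcup_seg; apply: ge0_nondecreasing_set_cvg_integral.
- move=> n k nk; rewrite subsetEset => x; rewrite /seg /= !in_itv /= => /andP[h1 h2].
  rewrite (le_trans _ h1) ?(le_trans h2) ?ler_nat//.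
  by rewrite lef_pV2 ?posrE// ler_nat.
- by move=> n; exact: measurable_itv.
- by move=> n; apply/measurable_EFinP; exact: measurable_gamma_fun.
- by move=> n x _; rewrite lee_fin gamma_fun_ge0.
Qed.

Lemma gamma_fun_integrable_seg a n : mu.-integrable (seg n) (EFin \o gamma_fun a).
Proof.
apply: continuous_compact_integrable; first exact: segment_compact.
apply: continuous_in_subspaceT => x /set_mem xs.
exact: (continuous_gamma_fun (seg_gt0 xs)).
Qed.

Lemma gamma_seg_parts a n : 0 < a ->
  (a%:E * \int[mu]_(x in seg n.+1) (gamma_fun a x)%:E =
   \int[mu]_(x in seg n.+1) (gamma_fun (a + 1) x)%:E +
   (gamma_fun (a + 1) n.+2%:R - gamma_fun (a + 1) n.+2%:R^-1)%:E)%E.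
Proof.
move=> a0.
have mS : measurable (seg n.+1) by exact: measurable_itv.
have ia := @gamma_fun_integrable_seg a n.+1.
have ia1 := @gamma_fun_integrable_seg (a + 1) n.+1.
have lt1 : n.+2%:R^-1 < n.+2%:R :> R.
  by rewrite (@lt_trans _ _ 1)// ?invf_lt1// ltr1n.
have ftc := @continuous_FTC2 R (fun x => a * gamma_fun a x - gamma_fun (a + 1) x)
  (gamma_fun (a + 1)) _ _ lt1.
have mEg b : measurable_fun (seg n.+1) (fun x => (gamma_fun b x)%:E).
  by apply/measurable_EFinP; exact: measurable_gamma_fun.
have seg_oo x : x \in `]n.+2%:R^-1, n.+2%:R[ -> 0 < x.
  by rewrite in_itv /= => /andP[h _]; rewrite (lt_trans _ h)// invr_gt0.
have der x : 0 < x -> derivable (gamma_fun (a + 1)) x 1.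
  by move=> x0; have [] := gamma_fun_deriv a x0.
rewrite EFinB -ftc.
- rewrite -integralZl// -integralD//=; last first.
    rewrite (_ : (fun x => _) = (fun x => a%:E * (EFin \o gamma_fun a) x) \-
        (EFin \o gamma_fun (a + 1)))%E; last by apply/funext => x; rewrite /= -EFinM -EFinB.
    have iZ : mu.-integrable (seg n.+1) (fun x => a%:E * (EFin \o gamma_fun a) x)%E.
      exact: integrableZl.
    exact: integrableB.
  by apply: eq_integral => x _ /=; rewrite -EFinM -EFinD; congr EFin; ring.
- apply: continuous_in_subspaceT => x /set_mem xs.
  apply: cvgB; last exact: (continuous_gamma_fun (seg_gt0 xs)).
  by apply: cvgM; [exact: cvg_cst|exact: (continuous_gamma_fun (seg_gt0 xs))].
- split.
  + by move=> x xs; apply: der; exact: seg_oo.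
  + by apply: cvg_at_right_filter; apply: continuous_gamma_fun; rewrite invr_gt0.
  + by apply: cvg_at_left_filter; apply: continuous_gamma_fun.
- move=> x xs; rewrite derive1E; apply: derive_val.
  exact: gamma_fun_deriv (seg_oo _ xs).
Qed.

(** [e^x >= x^(k+1) / (k+1)!] with [k >= a] leaves a bound of order [1 / x]. *)
Lemma gamma_fun_cvg_y a : gamma_fun a n.+2%:R @[n --> \oo] --> 0.
Proof.
pose k := Num.bound (`|a|).
have hk : a <= k%:R.
  by rewrite (le_trans (ler_norm a))// ltW// archi_boundP.
have c0 : k.+1`!%:R * harmonic n.+1 @[n --> \oo] --> (0 : R).
  rewrite -[X in _ --> X](mulr0 k.+1`!%:R); apply: cvgM; first exact: cvg_cst.
  by rewrite (cvg_shiftS (@harmonic R)); exact: cvg_harmonic.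
apply: (squeeze_cvgr _ (@cvg_cst _ _ _ _ _) c0); near=> n.
rewrite gamma_fun_ge0 /= /harmonic /= /gamma_fun expRN.
set x : R := n.+2%:R; have x0 : 0 < x by rewrite ltr0n.
have x1 : 1 <= x by rewrite ler1n.
rewrite ler_pdivrMr ?expR_gt0//.
have := expR_ge1Dxn k (ltW x0) => h.
apply: (@le_trans _ _ (x ^+ k)).
  by rewrite -powR_mulrn ?(ltW x0)// ler_powR// (le_trans _ hk)// gerBl.
rewrite mulrAC ler_pdivlMr// -exprSr.
rewrite mulrC -ler_pdivrMr ?ltr0n ?fact_gt0//.
by rewrite (le_trans _ h)// lerDr.
Unshelve. all: by end_near. Qed.

Lemma gamma_fun_cvg_0 a : 0 < a -> gamma_fun (a + 1) n.+2%:R^-1 @[n --> \oo] --> 0.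
Proof.
move=> a0.
have c : n.+2%:R^-1 `^ a @[n --> \oo] --> (0 : R).
  have /cvg_at_rightP := powR_cvg0 a0; apply; split=> [n|].
    by rewrite invr_gt0.
  by rewrite (cvg_shiftS (@harmonic R)); exact: cvg_harmonic.
apply: (squeeze_cvgr _ (@cvg_cst _ _ _ _ _) c); near=> n.
by rewrite gamma_fun_ge0 /= /gamma_fun addrK ler_piMr ?powR_ge0// expR_le1 oppr_le0.
Unshelve. all: by end_near. Qed.

Lemma gamma_int_ge0 a : (0 <= gamma_int a)%E.
Proof. by apply: integral_ge0 => x _; rewrite lee_fin gamma_fun_ge0. Qed.

(** Stated in [\bar R], before finiteness is known: finiteness for small [a] is deduced from it. *)
Lemma gamma_int_rec a : 0 < a -> gamma_int (a + 1) = (a%:E * gamma_int a)%E.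
Proof.
move=> a0.
have c1 b : (\int[mu]_(x in seg n.+1) (gamma_fun b x)%:E)%E @[n --> \oo] --> gamma_int b.
  rewrite (cvg_shiftS (fun n => (\int[mu]_(x in seg n) (gamma_fun b x)%:E)%E)).
  exact: gamma_int_seg.
have cL := cvgeZl (isT : a%:E \is a fin_num) (c1 a).
have cR : (\int[mu]_(x in seg n.+1) (gamma_fun (a + 1) x)%:E +
   (gamma_fun (a + 1) n.+2%:R - gamma_fun (a + 1) n.+2%:R^-1)%:E)%E @[n --> \oo]
   --> (gamma_int (a + 1) + (0 - 0)%:E)%E.
  apply: cvgeD; [exact: fin_num_adde_defl|exact: c1|].
  apply: cvg_EFin; first exact: nearW.
  by apply: cvgB; [exact: gamma_fun_cvg_y|exact: gamma_fun_cvg_0].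
rewrite subrr adde0 in cR.
apply/esym/(cvg_unique _ cL) => //.
rewrite (_ : (fun n => _) = (fun n => (\int[mu]_(x in seg n.+1) (gamma_fun (a + 1) x)%:E +
   (gamma_fun (a + 1) n.+2%:R - gamma_fun (a + 1) n.+2%:R^-1)%:E)%E))//.
by apply/funext => n; rewrite gamma_seg_parts.
Qed.

Lemma gamma_int_lt_pinfty a : 0 < a -> (gamma_int a < +oo)%E.
Proof.
(* The recurrence transfers finiteness from [a + 1 >= 1] to [a], because [a > 0]. *)
suff main b : 1 <= b -> (gamma_int b < +oo)%E.
  move=> a0; have := main (a + 1); rewrite lerDr (ltW a0) gamma_int_rec// => /(_ isT).
  have := gamma_int_ge0 a; case: (gamma_int a) => [r _ _|_|//]; first exact: ltry.
  by rewrite mulry gtr0_sg// mul1e.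
move=> b1; pose k := Num.bound `|b|.
have hk : b <= k%:R by rewrite (le_trans (ler_norm b))// ltW// archi_boundP.
(* [gamma_fun b] is dominated by [C e^(- x / 2)], which is [2 C] times the exponential density of
   rate 1/2. The summand 1 of [C] serves [x <= 1]; the other bounds [x^(k+1) e^(- x / 2)], used for
   [x > 1]. *)
pose C : R := 1 + k.+1`!%:R * 2 ^+ k.+1.
pose h (x : R) := ((2 * C)%:E * (exponential_pdf 2^-1 x)%:E)%E.
have C0 : 0 <= C by rewrite addr_ge0// mulr_ge0// exprn_ge0.
have h0 x : (0 <= h x)%E.
  by rewrite mule_ge0// lee_fin ?mulr_ge0// exponential_pdf_ge0.
have mpdf : measurable_fun setT (fun x : R => (exponential_pdf 2^-1 x)%:E).
  by apply/measurable_EFinP; exact: measurable_exponential_pdf.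
have mh : measurable_fun setT h by exact: measurable_funeM.
apply: (@le_lt_trans _ _ (\int[mu]_x h x)%E); last first.
  rewrite ge0_integralZl//.
  - by rewrite integral_exponential_pdf// mule1 ltry.
  - by move=> x _; rewrite lee_fin exponential_pdf_ge0.
  - by rewrite lee_fin mulr_ge0.
apply: (@le_trans _ _ (\int[mu]_(x in `]0%R, +oo[) h x)%E); last first.
  by apply: ge0_subset_integral => //.
apply: ge0_le_integral => //.
- by move=> x _; rewrite lee_fin gamma_fun_ge0.
- by apply/measurable_EFinP; exact: measurable_gamma_fun.
- exact: measurable_funTS.
move=> x /=; rewrite in_itv /= andbT => x0.
rewrite /h -EFinM lee_fin (exponential_pdfE _ (ltW x0))//= mulrA.
rewrite (_ : 2 * C * 2^-1 = C); last by field.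
have -> : - 2^-1 * x = - (x / 2) by ring.
rewrite /gamma_fun [in expR (- x)](_ : x = x / 2 + x / 2); last by field.
rewrite opprD expRD mulrA ler_wpM2r ?expR_ge0// expRN ler_pdivrMr ?expR_gt0//.
have xk : x ^+ k.+1 <= k.+1`!%:R * 2 ^+ k.+1 * expR (x / 2).
  have := expR_ge1Dxn k (ltW (divr_gt0 x0 (ltr0Sn R 1))).
  set e := expR _ => he.
  have : (x / 2) ^+ k.+1 / k.+1`!%:R <= e by rewrite (le_trans _ he)// lerDr.
  rewrite ler_pdivrMr ?ltr0n ?fact_gt0// expr_div_n ler_pdivrMr ?exprn_gt0//.
  by rewrite -mulrA (mulrC e).
have e1 : 1 <= expR (x / 2).
  by rewrite (le_trans _ (expR_ge1Dx _))// lerDl divr_ge0// ltW.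
rewrite /C mulrDl mul1r.
have [x1|x1] := leP x 1.
  apply: (@le_trans _ _ 1).
    rewrite [leRHS](_ : 1 = 1 `^ (b - 1)); last by rewrite powR1.
    by rewrite ge0_ler_powR ?nnegrE ?subr_ge0 ?(ltW x0).
  rewrite (le_trans e1)// lerDl; apply: mulr_ge0; last exact: expR_ge0.
  by rewrite mulr_ge0// exprn_ge0.
apply: (@le_trans _ _ (x ^+ k.+1)).
  rewrite -powR_mulrn ?(ltW x0)// ler_powR ?(ltW x1)//.
  by rewrite -natr1; lra.
by rewrite (le_trans xk)// lerDr ltW// expR_gt0.
Qed.

Lemma gamma_int_gt0 a : 0 < a -> (0 < gamma_int a)%E.
Proof.
move=> a0.
(* On [[1, 2]] one has [x^(a - 1) >= 1 / x >= 1 / 2] for every [a > 0], and [e^(- x) >= e^(- 2)]. *)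
apply: (@lt_le_trans _ _ (\int[mu]_(x in `[1%R, 2%R]) (cst (expR (- 2) / 2)%:E x))%E).
  rewrite integral_cst//= lebesgue_measure_itv/= lte_fin ltr1n/= -EFinB -EFinM lte_fin.
  by rewrite !mulr_gt0 ?expR_gt0//; lra.
apply: (@le_trans _ _ (\int[mu]_(x in `[1%R, 2%R]) (gamma_fun a x)%:E)%E).
  apply: ge0_le_integral => //.
  - by move=> x _; rewrite lee_fin divr_ge0 ?expR_ge0.
  - by apply/measurable_EFinP; exact: measurable_gamma_fun.
  move=> x /=; rewrite in_itv /= => /andP[x1 x2]; rewrite lee_fin /gamma_fun mulrC.
  apply: ler_pM; rewrite ?invr_ge0 ?expR_ge0//; last by rewrite ler_expR lerN2.
  have x0 : 0 < x by rewrite (lt_le_trans _ x1).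
  apply: (@le_trans _ _ (x `^ (-1))).
    by rewrite powR_inv1 ?(ltW x0)// lef_pV2// posrE.
  by rewrite ler_powR//; lra.
apply: ge0_subset_integral => //.
- by apply/measurable_EFinP; exact: measurable_gamma_fun.
- by move=> x _; rewrite lee_fin gamma_fun_ge0.
- by move=> x /=; rewrite !in_itv /= andbT => /andP[x1 _]; rewrite (lt_le_trans _ x1).
Qed.

Lemma GammaE a : 0 < a -> (Gamma a)%:E = gamma_int a.
Proof.
move=> a0; rewrite /Gamma /Rintegral fineK// ge0_fin_numE ?gamma_int_lt_pinfty//.
exact: gamma_int_ge0.
Qed.

Lemma Gamma_gt0 a : 0 < a -> 0 < Gamma a.
Proof. by move=> a0; rewrite -lte_fin GammaE// gamma_int_gt0. Qed.

Lemma Gamma_rec a : 0 < a -> Gamma (a + 1) = a * Gamma a.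
Proof.
move=> a0; apply: EFin_inj; rewrite EFinM !GammaE ?addr_gt0//.
exact: gamma_int_rec.
Qed.

(** The quotient is the rising factorial [a (a + 1) ... (a + k - 1)], and
    [a + j <= (1 + a) (j + 1)]. *)
Lemma Gamma_addn_le (a : R) k : 0 < a ->
  Gamma (a + k%:R) / Gamma a <= (1 + a) ^+ k * k`!%:R.
Proof.
move=> a0; have G0 := Gamma_gt0 a0.
elim: k => [|k IH]; first by rewrite addr0 divff ?gt_eqF// fact0 mulr1.
have ak : 0 < a + k%:R by rewrite ltr_wpDr.
rewrite -natr1 addrA Gamma_rec// -mulrA exprS factS natrM.
rewrite [leRHS](_ : _ = ((1 + a) * k.+1%:R) * ((1 + a) ^+ k * k`!%:R)); last by ring.
apply: ler_pM => //; first exact: ltW.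
  by apply: divr_ge0; apply: ltW; [exact: (Gamma_gt0 ak)|exact: G0].
by rewrite -natr1; have : 0 <= k%:R :> R by []; nra.
Qed.

End GammaFunction.
(** * Configurations and duality polynomials *)

Section ConfigMeasurability.
Variable S : countType.
Implicit Types (x : S) (B : set nat) (xi : S -> nat).

Lemma measurable_coord x B : measurable ([set eta | B (eta x)] : set (config S)).
Proof.
rewrite (_ : [set eta | _] = \bigcup_(k in B) [set eta : config S | eta x = k]).
  apply: bigcup_measurable => k _; apply: sub_sigma_algebra.
  by exists (x, k).
by apply/seteqP; split=> [eta|eta [k Bk /= ->]] //= Be; exists (eta x).
Qed.

Lemma measurable_fun_coord d (T : sigmaRingType d) (g : nat -> T) x :
  measurable_fun setT (fun eta : config S => g (eta x)).
Proof. by move=> _ Y _; rewrite setTI; exact: (measurable_coord x (g @^-1` Y)). Qed.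

Lemma countable_bigcap_measurable (F : S -> set (config S)) :
  (forall x, measurable (F x)) -> measurable (\bigcap_x F x).
Proof.
move=> mF; rewrite -[\bigcap_x _]setCK setC_bigcap; apply: measurableC.
by apply: countable_bigcupT_measurable => // x; exact: measurableC.
Qed.

Lemma measurable_config1 xi : measurable ([set xi] : set (config S)).
Proof.
rewrite (_ : [set xi] = \bigcap_x [set eta : config S | [set xi x] (eta x)]).
  by apply: countable_bigcap_measurable => x; exact: measurable_coord.
apply/seteqP; split => [eta -> //|eta /= h]; apply/funext => x; exact: h.
Qed.

Lemma finite_occupation n (x : 'I_n -> S) : finite_config (occupation x).
Proof.
apply: (@sub_finite_set _ _ [set y | y \in codom x]); last first.
  apply: finite_seq.
move=> y /= /eqP; rewrite /occupation sum_nat_eq0 negb_forall => /existsP[i] /=.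
by rewrite eqb0 negbK => /eqP <-; exact: codom_f.
Qed.

Lemma occupationE n (x : 'I_n -> S) y : occupation x y = count_mem y (codom x).
Proof.
rewrite /occupation -sum1_count /codom /image_mem big_map big_enum_cond /=.
by rewrite [RHS]big_mkcond /=; apply: eq_bigr => i _; case: eqP.
Qed.

Lemma count_occupation (s : seq S) :
  (fun y => count_mem y s) = occupation (tnth (in_tuple s)).
Proof.
apply/funext => y; rewrite occupationE; congr count.
by rewrite /codom /image_mem map_tnth_enum.
Qed.

Lemma finite_config_occupation xi : finite_config xi ->
  exists s : seq S, xi = occupation (tnth (in_tuple s)).
Proof.
move=> /finite_seqP[s0 es]; pose r := undup s0.
have xir y : (y \in r) = (xi y != 0%N).
  rewrite mem_undup; have /seteqP[h1 h2] := es.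
  by apply/idP/idP => [/h2/eqP//|/eqP/h1].
exists (flatten [seq nseq (xi y) y | y <- r]); rewrite -count_occupation.
apply/funext => y; rewrite count_flatten -map_comp sumnE big_map.
under eq_bigr do rewrite /= count_nseq.
have [yr|yr] := boolP (y \in r).
  rewrite (bigD1_seq y) ?undup_uniq//= eqxx mul1n big1 ?addn0// => z.
  by rewrite eq_sym /= => /negbTE; rewrite eq_sym => ->.
rewrite big1_seq => [|z /= zr].
  by move: yr; rewrite xir negbK => /eqP.
by case: eqP => //= zy; rewrite -zy zr in yr.
Qed.

Lemma mass_occupation n (x : 'I_n -> S) : mass (occupation x) = n.
Proof.
rewrite /mass (@fsbigE _ _ _ _ _ (undup (codom x))) ?undup_uniq//; last first.
  move=> y _; rewrite mem_undup occupationE => yx; apply/eqP.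
  by rewrite -leqn0 leqNgt -has_count has_pred1.
rewrite (eq_bigl xpredT) => [|y]; last by rewrite in_setT.
rewrite /occupation exchange_big /= (eq_bigr (fun=> 1%N)) => [|i _].
  by rewrite sum1_card card_ord.
rewrite (bigD1_seq (x i)) ?undup_uniq ?mem_undup ?codom_f//= eqxx big1// => y.
by rewrite eq_sym => /negbTE ->.
Qed.

Lemma mass_occupationP xi n : finite_config xi -> mass xi = n ->
  exists x : 'I_n -> S, xi = occupation x.
Proof.
by move=> /finite_config_occupation[s ->]; rewrite mass_occupation => <-; eexists.
Qed.

Lemma countable_finite_config : countable [set xi : S -> nat | finite_config xi].
Proof.
apply: (@sub_countable _ _ _ [set occupation (tnth (in_tuple s)) | s in [set: seq S]]).
  apply: subset_card_le => xi /finite_config_occupation[s ->].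
  by exists s.
exact: (card_le_trans (card_image_le _ _) (countableP _)).
Qed.

(** There are only countably many finite configurations and points are measurable; so every function
    is measurable on them. *)
Lemma measurable_finite_config (A : set (config S)) :
  A `<=` [set xi | finite_config xi] -> measurable A.
Proof.
move=> Af; have cA : countable A.
  by apply: (sub_countable _ countable_finite_config); exact: subset_card_le.
by apply: countable_measurable => // xi; exact: measurable_config1.
Qed.

(** Serves to cut the finite configurations into countably many slices of at most one element. *)
Lemma finite_config_code : exists code : (S -> nat) -> nat,
  {in [set xi | finite_config xi] &, injective code}.
Proof.
by have /countable_injP[f finj] := countable_finite_config; exists f.
Qed.

End ConfigMeasurability.

Section DualityPolynomials.
Variables (R : realType) (S : countType) (m : R).
Hypothesis m_gt0 : 0 < m.
Implicit Types (xi eta : S -> nat) (r : seq S).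
Let m2 : 0 < m / 2. Proof. by rewrite divr_gt0. Qed.

Lemma Gamma_shift_gt0 k : 0 < Gamma (m / 2 + k%:R).
Proof. by apply: Gamma_gt0; rewrite ltr_wpDr. Qed.

Lemma duality_factor0 l : duality_factor m 0 l = 1.
Proof.
have G0 := Gamma_gt0 m2.
by rewrite /duality_factor leq0n subn0 addr0 !divff ?mulr1// gt_eqF// ltr0n fact_gt0.
Qed.

Lemma duality_factor_ge0 k l : 0 <= duality_factor m k l.
Proof.
rewrite /duality_factor; case: ifP => // _; apply: mulr_ge0; apply: divr_ge0 => //.
  exact: ltW (Gamma_gt0 m2).
exact: ltW (Gamma_shift_gt0 k).
Qed.

Lemma duality_factor1 l : duality_factor m 1 l = l%:R * (2 / m).
Proof.
have G0 := Gamma_gt0 m2.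
rewrite /duality_factor Gamma_rec//; case: l => [|l]; first by rewrite ltnn mul0r.
rewrite ltnS leq0n subn1 factS natrM mulfK ?pnatr_eq0 -?lt0n ?fact_gt0//.
by congr (_ * _); field; rewrite !gt_eqF.
Qed.

(** Links duality moments to factorial moments, the form used for determinacy. *)
Lemma duality_factor_bin k l : 'C(l, k)%:R =
  duality_factor m k l * (Gamma (m / 2 + k%:R) / Gamma (m / 2) / k`!%:R).
Proof.
rewrite /duality_factor; case: leqP => [kl|lk]; last by rewrite bin_small ?mul0r.
move: (Gamma_gt0 m2) (Gamma_shift_gt0 k).
move: (Gamma (m / 2)) (Gamma (m / 2 + k%:R)) => G0 Gk G00 Gk0.
rewrite -(bin_fact kl) !natrM; field.
by rewrite !pnatr_eq0 -!lt0n !fact_gt0 !gt_eqF.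
Qed.

Lemma D_seq xi eta r : uniq r -> (forall x, x \notin r -> xi x = 0%N) ->
  D m xi eta = \prod_(x <- r) duality_factor m (xi x) (eta x).
Proof.
move=> ur xir; rewrite /D (@fsbigE _ _ _ _ _ r)//; last first.
  by move=> x _ /xir ->; rewrite duality_factor0.
by apply: eq_bigl => x; rewrite in_setT.
Qed.

Lemma D_occupation n (x : 'I_n -> S) eta :
  D m (occupation x) eta =
  \prod_(y <- undup (codom x)) duality_factor m (occupation x y) (eta y).
Proof.
rewrite (@D_seq _ _ (undup (codom x))) ?undup_uniq// => y.
rewrite mem_undup occupationE => yx; apply/eqP.
by rewrite -leqn0 leqNgt -has_count has_pred1.
Qed.

Lemma D_ge0 xi eta : 0 <= D m xi eta.
Proof. by rewrite /D prodr_ge0// => y _; exact: duality_factor_ge0. Qed.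

Lemma measurable_D n (x : 'I_n -> S) :
  measurable_fun setT (fun eta : config S => D m (occupation x) eta).
Proof.
rewrite (_ : (fun eta => _) = (fun eta : config S =>
    \prod_(y <- undup (codom x)) duality_factor m (occupation x y) (eta y))); last first.
  by apply/funext => eta; exact: D_occupation.
elim: (undup _) => [|y r IH].
  rewrite (_ : (fun eta => _) = cst 1); first exact: measurable_cst.
  by apply/funext => eta; rewrite big_nil.
rewrite (_ : (fun eta => _) = (fun eta : config S =>
    duality_factor m (occupation x y) (eta y) *
    \prod_(z <- r) duality_factor m (occupation x z) (eta z))).
  by apply: measurable_funM => //; exact: measurable_fun_coord.
by apply/funext => eta; rewrite big_cons.
Qed.

Lemma D_injective n (x : 'I_n -> S) eta : injective x ->
  D m (occupation x) eta = \prod_i ((eta (x i))%:R * (2 / m)).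
Proof.
move=> xinj; rewrite D_occupation undup_id; last first.
  by rewrite map_inj_uniq ?enum_uniq.
rewrite /codom /image_mem big_map big_enum /=; apply: eq_bigr => i _.
rewrite -duality_factor1; congr duality_factor.
rewrite /occupation (bigD1 i)//= eqxx big1// => j ji.
by rewrite (inj_eq xinj) (negbTE ji).
Qed.

Lemma D_site k x eta :
  D m (occupation (fun _ : 'I_k => x)) eta = duality_factor m k (eta x).
Proof.
rewrite (@D_seq _ _ [:: x])//; last first.
  move=> y; rewrite inE /occupation => yx; rewrite big1// => _ _.
  by rewrite eq_sym (negbTE yx).
rewrite big_seq1 /occupation (eq_bigr (fun=> 1%N)) ?sum1_card ?card_ord// => i _.
by rewrite eqxx.
Qed.

End DualityPolynomials.

(** * Integrating iterates of a Markov operator over a parameter *)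

Section MarkovIntegral.
Variables (R : realType) (d : measure_display) (T : measurableType d).
Variables (mu : {measure set T -> \bar R}) (E : Type) (J : finType).
Variables (c : J -> E -> R) (phi : J -> E -> E).
Hypothesis c_ge0 : forall j x, 0 <= c j x.
Variables (h : T -> E -> R) (hbar : E -> R).
Hypothesis h_ge0 : forall tau x, 0 <= h tau x.
Hypothesis mh : forall x, measurable_fun setT (h ^~ x).
Hypothesis int_h : forall x, (\int[mu]_tau (h tau x)%:E = (hbar x)%:E)%E.

Lemma measurable_iter_markov k x :
  measurable_fun setT (fun tau => iter k (transition c phi) (h tau) x).
Proof.
elim: k x => [|k IH] x; first exact: mh.
under eq_fun do rewrite iterS /transition.
apply: measurable_sum => j.
by apply: measurable_funM => //; exact: IH.
Qed.

(** Tonelli, one step at a time. Applied to the counting measure on [nat], for a function cut into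
    slices, and to the initial law. *)
Lemma integral_iter_markov k x :
  (\int[mu]_tau (iter k (transition c phi) (h tau) x)%:E =
   (iter k (transition c phi) hbar x)%:E)%E.
Proof.
elim: k x => [|k IH] x; first exact: int_h.
rewrite iterS /transition -sumEFin.
under eq_integral do rewrite iterS /transition -sumEFin.
rewrite ge0_integral_sum//; first last.
- move=> j tau _; rewrite lee_fin mulr_ge0//.
  exact: (iter_markov_ge0 phi c_ge0).
- move=> j; apply/measurable_EFinP/measurable_funM => //.
  exact: measurable_iter_markov.
apply: eq_bigr => j _; rewrite EFinM -IH -ge0_integralZl_EFin//.
- by move=> tau _; rewrite lee_fin (iter_markov_ge0 phi c_ge0).
- by apply/measurable_EFinP; exact: measurable_iter_markov.
Qed.

End MarkovIntegral.
(** Moments as real functions of the labels, on which the flow acts. [fine] sends an infinite moment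
    to 0, so the way back to [dual_moment] goes through a finite bound, in [momentE]. *)
Definition moment (R : realType) (S : countType) (m : R) n
    (mu : {measure set (config S) -> \bar R}) (x : 'I_n -> S) : R :=
  fine (dual_moment m mu (occupation x)).

Section MomentBounds.
Variables (R : realType) (S : countType) (m : R).
Implicit Type mu : {measure set (config S) -> \bar R}.

Lemma Pf_bound mu n : Pf m mu ->
  exists2 c : R, 0 <= c & forall x : 'I_n -> S,
    (dual_moment m mu (occupation x) <= c%:E)%E.
Proof.
move=> /(_ n); set s := ereal_sup _ => soo.
exists (Num.max 0 (fine s)); first by rewrite le_max lexx.
move=> x; have : (dual_moment m mu (occupation x) <= s)%E.
  apply: ereal_sup_ubound; exists (occupation x) => //; split.
    exact: finite_occupation.
  exact: mass_occupation.
case: s soo => [r| |] //= _ h; last by rewrite (le_trans h)// leNye.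
by rewrite (le_trans h)// lee_fin le_max lexx orbT.
Qed.

Lemma bound_Pf mu (c : nat -> R) :
  (forall n (x : 'I_n -> S), (dual_moment m mu (occupation x) <= (c n)%:E)%E) ->
  Pf m mu.
Proof.
move=> hc n; apply: (@le_lt_trans _ _ (c n)%:E); last exact: ltry.
apply: ge_ereal_sup => _ [xi [fxi mxi] <-].
by have [x ->] := mass_occupationP fxi mxi.
Qed.

Hypothesis m_gt0 : 0 < m.

Lemma moment_ge0 mu n (x : 'I_n -> S) : 0 <= moment m mu x.
Proof. by apply: fine_ge0; apply: integral_ge0 => eta _; rewrite lee_fin D_ge0. Qed.

Lemma momentE mu n (x : 'I_n -> S) (c : R) :
  (dual_moment m mu (occupation x) <= c%:E)%E ->
  dual_moment m mu (occupation x) = (moment m mu x)%:E.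
Proof.
move=> h; rewrite /moment fineK// ge0_fin_numE; last first.
  by apply: integral_ge0 => eta _; rewrite lee_fin D_ge0.
by rewrite (le_lt_trans h)// ltry.
Qed.

Lemma first_moment mu x : (\int[mu]_eta (eta x)%:R%:E =
  (m / 2)%:E * dual_moment m mu (occupation (fun _ : 'I_1 => x)))%E.
Proof.
rewrite -ge0_integralZl_EFin//.
- apply: eq_integral => eta _; rewrite -EFinM D_site// duality_factor1//.
  by congr EFin; field; rewrite gt_eqF.
- by move=> eta _; rewrite lee_fin D_ge0.
- by apply/measurable_EFinP; exact: measurable_D.
- by rewrite divr_ge0// ltW.
Qed.

End MomentBounds.

Lemma cvg_prodr (R : realType) (I : Type) (r : seq I) (P : pred I)
    (u : I -> nat -> R) (l : I -> R) :
  (forall i, P i -> u i @ \oo --> l i) ->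
  \prod_(i <- r | P i) u i N @[N --> \oo] --> \prod_(i <- r | P i) l i.
Proof.
move=> ul; elim: r => [|i r IH].
  by under eq_fun do rewrite big_nil; rewrite big_nil; exact: cvg_cst.
under eq_fun do rewrite big_cons; rewrite big_cons.
by case: ifP => // Pi; apply: cvgM => //; exact: ul.
Qed.

(** * Labelled particles *)

Section JumpRates.
Variables (R : realType) (E : Type) (J : finType).
Variables (r : J -> E -> R) (phi : J -> E -> E) (lam : R).
Hypothesis r_ge0 : forall j x, 0 <= r j x.
Hypothesis lam_gt0 : 0 < lam.
Hypothesis r_le : forall x, \sum_j r j x <= lam.

Definition jump_generator (f : E -> R) x := \sum_j r j x * (f (phi j x) - f x).

(* Uniformization: a clock of rate [lam] rings, and [None] means staying put. *)
Definition lazy_rate (o : option J) x : R :=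
  if o is Some j then r j x / lam else 1 - (\sum_j r j x) / lam.

Definition lazy_jump (o : option J) x : E := if o is Some j then phi j x else x.

Lemma big_option (F : option J -> R) : \sum_o F o = F None + \sum_j F (Some j).
Proof.
rewrite (bigD1 None)//=; congr (_ + _).
rewrite (reindex_omap Some id)//=; last by case.
by apply: eq_bigl => j; rewrite eqxx.
Qed.

Lemma lazy_rate_ge0 o x : 0 <= lazy_rate o x.
Proof.
case: o => [j|] /=; first by rewrite divr_ge0// ltW.
by rewrite subr_ge0 ler_pdivrMr// mul1r.
Qed.

Lemma lazy_rate_sum1 x : \sum_o lazy_rate o x = 1.
Proof. by rewrite big_option /= -mulr_suml subrK. Qed.

Lemma jump_generatorE f x :
  jump_generator f x = lam * (transition lazy_rate lazy_jump f x - f x).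
Proof.
rewrite /transition big_option /= /jump_generator.
rewrite [LHS](_ : _ = \sum_j r j x * f (phi j x) - (\sum_j r j x) * f x); last first.
  by rewrite mulr_suml -sumrB; apply: eq_bigr => j _; rewrite mulrBr.
have -> : \sum_j r j x / lam * f (phi j x) = (\sum_j r j x * f (phi j x)) / lam.
  by rewrite mulr_suml; apply: eq_bigr => j _; rewrite mulrAC.
by field; rewrite gt_eqF.
Qed.

End JumpRates.

Section Antisymmetry.
Variables (R : realType) (I : finType).

Lemma antisym_sum0 (P : pred I) (h : I -> I -> R) :
  (forall i j, h i j = - h j i) -> \sum_(i | P i) \sum_(j | P j) h i j = 0.
Proof.
move=> hh; set s := LHS.
have : s = - s.
  rewrite {2}/s exchange_big /= -sumrN; apply: eq_bigr => i _.
  by rewrite -sumrN; apply: eq_bigr => j _.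
by move=> /eqP; rewrite -subr_eq0 opprK -mulr2n mulrn_eq0 /= => /eqP.
Qed.

Lemma sym_sum_ge0 (h : I -> I -> R) :
  (forall i j, 0 <= h i j + h j i) -> 0 <= \sum_i \sum_j h i j.
Proof.
move=> hh; set s := (X in _ <= X).
have : 0 <= s + s.
  rewrite {2}/s exchange_big /= -big_split /=; apply: sumr_ge0 => i _.
  by rewrite -big_split /=; apply: sumr_ge0.
lra.
Qed.

End Antisymmetry.

(* [step x] enumerates without repetition a finite set containing every site
   reached from [x] with positive probability. *)
Section Particles.
Variables (R : realType) (S : countType) (p : S -> S -> R) (m : R).
Variables (J0 : finType) (step : S -> J0 -> S).
Hypothesis m_gt0 : 0 < m.
Hypothesis p_ge0 : forall x y, 0 <= p x y.
Hypothesis p_sym : forall x y, p x y = p y x.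
Hypothesis p_diag : forall x, p x x = 0.
Hypothesis step_inj : forall x, injective (step x).
Hypothesis step_surj : forall x y, p x y != 0 -> exists b, y = step x b.
Hypothesis p_sum1 : forall x, \sum_b p x (step x b) = 1.

Lemma p_le1 x y : p x y <= 1.
Proof.
have [->//|/step_surj[b ->]] := eqVneq (p x y) 0.
by rewrite -(p_sum1 x) (bigD1 b)//= lerDl; apply: sumr_ge0.
Qed.

Lemma fsum_step x (h : S -> R) : (forall y, p x y = 0 -> h y = 0) ->
  \sum_(y \in [set: S]) h y = \sum_b h (step x b).
Proof.
move=> h0; rewrite (@fsbigE _ _ _ _ _ [seq step x b | b <- enum J0])//.
- rewrite (eq_bigl xpredT) => [|y]; last by rewrite in_setT.
  by rewrite big_map big_enum.
- by rewrite map_inj_uniq ?enum_uniq//; exact: step_inj.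
- move=> y _ ynr; apply: h0; apply: contraNeq ynr => /step_surj[b ->].
  by rewrite map_f// mem_enum.
Qed.

Lemma sum_step_pick x y (g : S -> R) :
  \sum_b p x (step x b) * (y == step x b)%:R * g (step x b) = p x y * g y.
Proof.
have [py|/step_surj[b ->]] := eqVneq (p x y) 0.
  rewrite py mul0r big1// => b _; case: eqP => [<-|_].
    by rewrite py !mul0r.
  by rewrite mulr0 mul0r.
rewrite (bigD1 b)//= eqxx mulr1 big1 ?addr0// => b' b'b.
by rewrite (inj_eq (@step_inj x)) eq_sym (negbTE b'b) mulr0 mul0r.
Qed.

Definition walk (rho : S -> R) x := \sum_b p x (step x b) * rho (step x b).

Definition walk_generator (rho : S -> R) x := 2 * m * (walk rho x - rho x).

Lemma walk_generatorE rho x :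
  walk_generator rho x = \sum_b 2 * m * p x (step x b) * (rho (step x b) - rho x).
Proof.
rewrite /walk_generator /walk.
rewrite -[X in _ - X]mul1r -(p_sum1 x) mulr_suml -sumrB mulr_sumr.
by apply: eq_bigr => b _; ring.
Qed.

Section Labelled.
Variable n : nat.
Local Notation E := ('I_n -> S).
Implicit Types (x : E) (f : E -> R) (t M : R) (rho : S -> R).

Definition relocate x (i : 'I_n) z : E := fun k => if k == i then z else x k.

Lemma relocate_same x i : relocate x i (x i) = x.
Proof. by apply/funext => k; rewrite /relocate; case: eqP => [->|]. Qed.

(** The site [x i] is occupied, so the truncated subtraction in [move_particle] loses nothing. *)
Lemma occupation_relocate x i z :
  move_particle (occupation x) (x i) z = occupation (relocate x i z).
Proof.
apply/funext => y; rewrite /move_particle /occupation.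
rewrite (bigD1 i)//= [in RHS](bigD1 i)//= /relocate eqxx.
rewrite [in RHS](eq_bigr (fun k => (x k == y : nat))); last first.
  by move=> k /negbTE ->.
by rewrite (eq_sym z) (eq_sym (x i)) -addnA addKn addnC.
Qed.

Lemma sum_occupation x (r : seq S) (G : S -> R) :
  uniq r -> (forall i, x i \in r) ->
  \sum_(y <- r) (occupation x y)%:R * G y = \sum_i G (x i).
Proof.
move=> ur xr; rewrite /occupation.
under eq_bigr do rewrite natr_sum mulr_suml.
rewrite exchange_big /=; apply: eq_bigr => i _.
rewrite (bigD1_seq (x i))//= eqxx mul1r big1 ?addr0// => y.
by rewrite eq_sym => /negbTE ->; rewrite mul0r.
Qed.

(** The occupation of the target counts particle [ib.1] itself only if the target is its own site,
    where [p] vanishes. *)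
Definition sip_rate (ib : 'I_n * J0) x : R :=
  2 * p (x ib.1) (step (x ib.1) ib.2) *
  (m + 2 * (occupation x (step (x ib.1) ib.2))%:R).

Definition sip_jump (ib : 'I_n * J0) x : E :=
  relocate x ib.1 (step (x ib.1) ib.2).

(* The [+ 1] keeps the clock rate positive when [n = 0]. *)
Definition sip_lam : R := 2 * n%:R * (m + 2 * n%:R) + 1.

Local Notation Lam := (jump_generator sip_rate sip_jump).

Lemma occupation_le x y : (occupation x y <= n)%N.
Proof.
rewrite /occupation; apply: (@leq_trans (\sum_(i < n) 1)%N).
  by apply: leq_sum => i _; exact: leq_b1.
by rewrite sum1_card card_ord.
Qed.

Lemma sip_rate_ge0 ib x : 0 <= sip_rate ib x.
Proof. by rewrite /sip_rate !mulr_ge0// addr_ge0 ?mulr_ge0// ltW. Qed.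

Lemma sip_lam_gt0 : 0 < sip_lam.
Proof.
by rewrite /sip_lam ltr_wpDl// !mulr_ge0// addr_ge0 ?mulr_ge0// ltW.
Qed.

Lemma sip_rate_le x : \sum_ib sip_rate ib x <= sip_lam.
Proof.
rewrite /sip_lam -(pair_bigA _ (fun i b => sip_rate (i, b) x)) /=.
apply: (@le_trans _ _ (\sum_(i < n) 2 * (m + 2 * n%:R))); last first.
  by rewrite sumr_const card_ord -mulr_natr; lra.
apply: ler_sum => i _.
rewrite -[leRHS]mul1r -[X in X * _](p_sum1 (x i)) mulr_suml; apply: ler_sum => b _.
rewrite /sip_rate /= -mulrA mulrCA ler_wpM2l// ler_wpM2l// lerD2l ler_wpM2l//.
by rewrite ler_nat occupation_le.
Qed.

(** The factor [eta y] counts the labels at [y], so a sum over sites weighted by it is a sum over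
    labels. *)
Lemma sip_generator_labelled (F : (S -> nat) -> R) x :
  sip_generator p m F (occupation x) = Lam (fun y => F (occupation y)) x.
Proof.
rewrite /sip_generator /jump_generator.
rewrite -(pair_bigA _ (fun i b => sip_rate (i, b) x *
  (F (occupation (sip_jump (i, b) x)) - F (occupation x)))) /=.
pose r := undup (codom x).
have xr i : x i \in r by rewrite mem_undup codom_f.
pose G y := \sum_b p y (step y b) * 2 * (m + 2 * (occupation x (step y b))%:R) *
  (F (move_particle (occupation x) y (step y b)) - F (occupation x)).
transitivity (\sum_(y <- r) (occupation x y)%:R * G y); last first.
  rewrite sum_occupation ?undup_uniq//; apply: eq_bigr => i _; rewrite /G.
  by apply: eq_bigr => b _; rewrite occupation_relocate /sip_rate /=; ring.
rewrite (@fsbigE _ _ _ _ _ [seq (y, step y b) | y <- r, b <- enum J0])//.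
- rewrite (eq_bigl xpredT) => [|y]; last by rewrite in_setT.
  rewrite big_allpairs_dep; apply: eq_bigr => y _; rewrite /G mulr_sumr big_enum.
  by apply: eq_bigr => b _ /=; ring.
- apply: allpairs_uniq_dep; rewrite ?undup_uniq//.
    by move=> y _; exact: enum_uniq.
  by move=> [y b] [y' b'] _ _ /= [-> /step_inj ->].
- move=> [y z] _ /= ynr.
  have [->|pyz] := eqVneq (p y z) 0; first by rewrite !mul0r.
  have [->|oy] := eqVneq (occupation x y) 0%N; first by rewrite !(mulr0, mul0r).
  exfalso; move/negP: ynr; apply; have [b ->] := step_surj pyz.
  apply/allpairsPdep; exists y, b; split; rewrite ?mem_enum//.
  move: oy; rewrite /occupation sum_nat_eq0 negb_forall => /existsP[i] /=.
  by rewrite eqb0 negbK => /eqP <-.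
Qed.

Lemma iter_sip_generator k (F : (S -> nat) -> R) x :
  iter k (sip_generator p m) F (occupation x) =
  iter k Lam (fun y => F (occupation y)) x.
Proof.
elim: k x => // k IH x; rewrite !iterS sip_generator_labelled.
by congr (Lam _ x); apply/funext.
Qed.

Definition sip_flow (t : R) f x : R :=
  heat (lazy_rate sip_rate sip_lam) (lazy_jump sip_jump) (sip_lam * t) f x.

Definition sip_jumps : option ('I_n * J0) -> E -> E := lazy_jump sip_jump.
Definition sip_lazy_ge0 := lazy_rate_ge0 sip_rate_ge0 sip_lam_gt0 sip_rate_le.
Definition sip_lazy_sum1 := lazy_rate_sum1 sip_rate sip_lam.

Lemma sip_labelledE f x : Lam f x = sip_lam *
  (transition (lazy_rate sip_rate sip_lam) (lazy_jump sip_jump) f x - f x).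
Proof. exact: (jump_generatorE sip_rate sip_jump sip_lam_gt0). Qed.

Lemma sip_flowE t f M x : 0 <= t -> (forall y : E, `|f y| <= M) ->
  exp_semigroup Lam t f x = sip_flow t f x.
Proof.
move=> t0 fM.
exact: (exp_semigroupE sip_lazy_ge0 sip_lazy_sum1 (ltW sip_lam_gt0) sip_labelledE x t0 fM).
Qed.

Lemma sip_clock_ge0 t : 0 <= t -> 0 <= sip_lam * t.
Proof. by move=> t0; rewrite mulr_ge0// ltW// sip_lam_gt0. Qed.

Lemma sip_flow_le t f g M x : 0 <= t ->
  (forall y, `|f y| <= M) -> (forall y, `|g y| <= M) ->
  (forall y, f y <= g y) -> sip_flow t f x <= sip_flow t g x.
Proof.
move=> t0 fM gM fg.
exact: (heat_le sip_jumps sip_lazy_ge0 sip_lazy_sum1 x (sip_clock_ge0 t0) fM gM fg).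
Qed.

Lemma sip_flow_le_cst t f M x : 0 <= t -> 0 <= M -> (forall y, 0 <= f y <= M) ->
  0 <= sip_flow t f x <= M.
Proof.
move=> t0 M0 fM.
have := @sip_flow_le t f (fun=> M) M x t0; have := @sip_flow_le t (fun=> 0) f M x t0.
rewrite /sip_flow !(heat_cst _ sip_lazy_sum1) => h1 h2.
have nf y : `|f y| <= M by have /andP[f0 f1] := fM y; rewrite ger0_norm.
apply/andP; split; [apply: h1|apply: h2] => // y; rewrite ?normr0// ?ger0_norm//;
  by have /andP[] := fM y.
Qed.

Lemma sip_flowB t f g M x : (forall y, `|f y| <= M) -> (forall y, `|g y| <= M) ->
  sip_flow t (f \- g) x = sip_flow t f x - sip_flow t g x.
Proof. exact: (heatB sip_jumps sip_lazy_ge0 sip_lazy_sum1). Qed.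

Lemma sip_flowZ t (a : R) f M x : (forall y, `|f y| <= M) ->
  sip_flow t (fun y => a * f y) x = a * sip_flow t f x.
Proof. exact: (heatZ sip_jumps sip_lazy_ge0 sip_lazy_sum1). Qed.

Lemma sip_exp_labelled t (F : (S -> nat) -> R) M x : 0 <= t ->
  (forall y : E, `|F (occupation y)| <= M) ->
  exp_semigroup (sip_generator p m) t F (occupation x) =
  sip_flow t (fun y => F (occupation y)) x.
Proof.
move=> t0 FM.
rewrite (_ : sip_flow t _ x = exp_semigroup Lam t (fun y => F (occupation y)) x).
  by rewrite /exp_semigroup; under [in LHS]eq_fun do rewrite iter_sip_generator.
by rewrite (sip_flowE _ t0 FM).
Qed.

(** The occupation of the target is a sum over particles [j], so the interaction moves [i] onto
    [x j] at rate [4 p (x i) (x j)]; independent walks remain. *)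
Lemma sip_generator_split f x : Lam f x =
  \sum_i \sum_b 2 * m * p (x i) (step (x i) b) * (f (relocate x i (step (x i) b)) - f x) +
  \sum_i \sum_j 4 * p (x i) (x j) * (f (relocate x i (x j)) - f x).
Proof.
rewrite /jump_generator -(pair_bigA _ (fun i b => sip_rate (i, b) x *
  (f (sip_jump (i, b) x) - f x))) /= -big_split /=; apply: eq_bigr => i _.
have -> : \sum_j 4 * p (x i) (x j) * (f (relocate x i (x j)) - f x) =
  \sum_b 4 * p (x i) (step (x i) b) * (occupation x (step (x i) b))%:R *
    (f (relocate x i (step (x i) b)) - f x).
  rewrite [RHS](_ : _ = \sum_j 4 * \sum_b p (x i) (step (x i) b) *
      (x j == step (x i) b)%:R * (f (relocate x i (step (x i) b)) - f x)).
    apply: eq_bigr => j _.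
    by rewrite (sum_step_pick _ _ (fun z => f (relocate x i z) - f x)) mulrA.
  under [RHS]eq_bigr do rewrite mulr_sumr.
  rewrite exchange_big /=; apply: eq_bigr => b _; rewrite /occupation natr_sum.
  by rewrite mulr_sumr mulr_suml; apply: eq_bigr => j _; ring.
by rewrite -big_split /=; apply: eq_bigr => b _; rewrite /sip_rate /=; ring.
Qed.

Definition product_fun (rho : S -> R) x := \prod_i rho (x i).

Lemma product_fun_bound rho M x : (forall y, 0 <= rho y <= M) ->
  0 <= product_fun rho x <= M ^+ n.
Proof.
move=> rhoM; rewrite /product_fun prodr_ge0/=; last by move=> i _; case/andP: (rhoM (x i)).
rewrite [leRHS](_ : _ = \prod_(i < n) M); last by rewrite prodr_const card_ord.
by apply: ler_prod => i _; exact: rhoM.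
Qed.

Definition others (rho : S -> R) x i := \prod_(k | k != i) rho (x k).

Lemma product_fun_relocate rho x i z :
  product_fun rho (relocate x i z) = others rho x i * rho z.
Proof.
rewrite /product_fun (bigD1 i)//= /relocate eqxx mulrC; congr (_ * _).
by apply: eq_bigr => k /negbTE ->.
Qed.

Lemma others_split rho x i j : i != j ->
  others rho x i = rho (x j) * \prod_(k | (k != i) && (k != j)) rho (x k).
Proof. by move=> ij; rewrite /others (bigD1 j)// eq_sym. Qed.

(* The inclusion part contributes, for each pair of particles, a nonnegative
   multiple of [(rho x_i - rho x_j)^2]. *)
Lemma sip_generator_product_ge rho x : (forall y, 0 <= rho y) ->
  \sum_i others rho x i * walk_generator rho (x i) <= Lam (product_fun rho) x.
Proof.
move=> rho0.
rewrite sip_generator_split.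
have e i z : product_fun rho (relocate x i z) - product_fun rho x =
    others rho x i * (rho z - rho (x i)).
  by rewrite -[in X in _ - X](relocate_same x i) !product_fun_relocate mulrBr.
rewrite [X in _ <= X + _](eq_bigr (fun i => others rho x i * walk_generator rho (x i))); last first.
  move=> i _; rewrite walk_generatorE mulr_sumr; apply: eq_bigr => b _.
  by rewrite e; ring.
rewrite lerDl; apply: sym_sum_ge0 => i j; rewrite !e.
have [->|ij] := eqVneq i j; first by rewrite p_diag !mulr0 !mul0r addr0.
rewrite (others_split rho x ij) (@others_split rho x j i) 1?eq_sym//.
rewrite [X in _ + _ * (_ * X * _)](eq_bigl (fun k => (k != i) && (k != j))); last first.
  by move=> k; rewrite andbC.
rewrite (p_sym (x j)); set P := \prod_(_ | _) _.
have P0 : 0 <= P by apply: prodr_ge0.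
rewrite [leRHS](_ : _ = 4 * p (x i) (x j) * P * (rho (x i) - rho (x j)) ^+ 2); last by ring.
by apply: mulr_ge0; [rewrite !mulr_ge0|exact: sqr_ge0].
Qed.

Definition pair_lift (g : S * S -> R) x := \sum_i \sum_(j | j != i) g (x i, x j).

End Labelled.

Lemma sip2_generatorE (g : S * S -> R) w : sip2_generator p m g w =
  \sum_b 2 * m * p w.1 (step w.1 b) * (g (step w.1 b, w.2) - g w) +
  4 * p w.1 w.2 * (g (w.2, w.2) - g w) +
  \sum_b 2 * m * p w.2 (step w.2 b) * (g (w.1, step w.2 b) - g w) +
  4 * p w.1 w.2 * (g (w.1, w.1) - g w).
Proof.
rewrite /sip2_generator (@fsum_step w.1); last first.
  by move=> y py; rewrite /sip2_rate py !(mulr0, mul0r).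
rewrite (@fsum_step w.2); last by move=> y py; rewrite /sip2_rate py !(mulr0, mul0r).
have e b : sip2_rate p m w w.1 (step w.1 b) * (g (step w.1 b, w.2) - g w) =
   2 * m * p w.1 (step w.1 b) * (g (step w.1 b, w.2) - g w) +
   4 * (p w.1 (step w.1 b) * (w.2 == step w.1 b)%:R * (g (step w.1 b, w.2) - g w)).
  rewrite /sip2_rate (eq_sym w.2).
  (* The attraction of a particle by its own site is killed by [p_diag]. *)
  have [->|_] := eqVneq (step w.1 b) w.1; first by rewrite p_diag; ring.
  by rewrite /=; ring.
rewrite (eq_bigr _ (fun b _ => e b)) big_split /= -mulr_sumr.
rewrite (sum_step_pick _ _ (fun z => g (z, w.2) - g w)).
have e' b : sip2_rate p m w w.2 (step w.2 b) * (g (w.1, step w.2 b) - g w) =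
   2 * m * p w.2 (step w.2 b) * (g (w.1, step w.2 b) - g w) +
   4 * (p w.2 (step w.2 b) * (w.1 == step w.2 b)%:R * (g (w.1, step w.2 b) - g w)).
  rewrite /sip2_rate (eq_sym w.1).
  have [->|_] := eqVneq (step w.2 b) w.2; first by rewrite p_diag; ring.
  by rewrite /=; ring.
rewrite [X in _ + X = _](eq_bigr _ (fun b _ => e' b)) big_split /= -[X in _ + (_ + X) = _]mulr_sumr.
rewrite (sum_step_pick _ _ (fun z => g (w.1, z) - g w)) (p_sym w.2 w.1).
by ring.
Qed.

(** Each of the two walks has total rate [2 m] and each of the two attractions rate at most 4, all
    acting on differences of size at most [2 M]: together [8 m + 16]. *)
Lemma sip2_generator_norm (g : S * S -> R) (M : R) w : (forall v, `|g v| <= M) ->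
  `|sip2_generator p m g w| <= M * (8 * m + 16).
Proof.
move=> gM; have M0 : 0 <= M by exact: le_trans (gM w).
have d v w' : `|g v - g w'| <= 2 * M.
  by rewrite (le_trans (ler_normB _ _))// mulr_natl mulr2n lerD.
have sum_le y (h : J0 -> R) : (forall b, `|h b| <= 2 * M) ->
    `|\sum_b 2 * m * p y (step y b) * h b| <= 2 * m * (2 * M).
  move=> hM; rewrite (le_trans (ler_norm_sum _ _ _))//.
  rewrite [leRHS](_ : _ = \sum_b p y (step y b) * (2 * m * (2 * M))); last first.
    by rewrite -mulr_suml p_sum1 mul1r.
  apply: ler_sum => b _.
  have r0 : 0 <= 2 * m * p y (step y b) by rewrite !mulr_ge0// ltW.
  rewrite normrM ger0_norm// [leRHS](_ : _ = 2 * m * p y (step y b) * (2 * M)); last by ring.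
  by rewrite ler_wpM2l.
have pick_le v : `|4 * p w.1 w.2 * (g v - g w)| <= 4 * (2 * M).
  have r0 : 0 <= 4 * p w.1 w.2 by rewrite mulr_ge0.
  rewrite normrM ger0_norm//; apply: ler_pM => //.
  by rewrite ler_piMr// p_le1.
rewrite sip2_generatorE.
have h4 (a b c e : R) : `|a + b + c + e| <= `|a| + `|b| + `|c| + `|e|.
  by do 3 (rewrite (le_trans (ler_normD _ _))// lerD2r).
apply: (le_trans (h4 _ _ _ _)).
have := sum_le w.1 (fun b => g (step w.1 b, w.2) - g w) (fun b => d _ _).
have := sum_le w.2 (fun b => g (w.1, step w.2 b) - g w) (fun b => d _ _).
have := pick_le (w.1, w.1); have := pick_le (w.2, w.2).
lra.
Qed.

Lemma iter_sip2_generator_norm k (g : S * S -> R) (M : R) w :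
  (forall v, `|g v| <= M) ->
  `|iter k (sip2_generator p m) g w| <= M * (8 * m + 16) ^+ k.
Proof.
move=> gM; elim: k w => [|k IH] w; first by rewrite mulr1.
by rewrite iterS exprSr mulrA; exact: sip2_generator_norm.
Qed.

(** * Sums over pairs of particles *)

Section Lift.
Variable n : nat.
Local Notation Lam := (@jump_generator R ('I_n -> S) _ (@sip_rate n) (@sip_jump n)).

Lemma pair_lift_relocate (g : S * S -> R) (x : 'I_n -> S) i z :
  pair_lift g (relocate x i z) - pair_lift g x =
  \sum_(j | j != i) ((g (z, x j) - g (x i, x j)) + (g (x j, z) - g (x j, x i))).
Proof.
rewrite /pair_lift (bigD1 i)//= [X in _ - X](bigD1 i)//= opprD addrACA -sumrB.
rewrite [RHS]big_split /=; congr (_ + _).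
  by apply: eq_bigr => j ji; rewrite /relocate eqxx (negbTE ji).
rewrite -sumrB; apply: eq_bigr => j ji.
rewrite (bigD1 i) 1?eq_sym//= [X in _ - X](bigD1 i) 1?eq_sym//=.
rewrite /relocate eqxx (negbTE ji) opprD addrACA [X in _ + X](_ : _ = 0) ?addr0//.
apply/eqP; rewrite subr_eq0; apply/eqP; apply: eq_bigr => k /andP[_ ki].
by rewrite (negbTE ki).
Qed.

(* A third particle acts on a fixed pair through an antisymmetric term, so the
   sum over all pairs evolves as two-particle systems. *)
Lemma sip_generator_lift (g : S * S -> R) (x : 'I_n -> S) :
  Lam (pair_lift g) x = pair_lift (sip2_generator p m g) x.
Proof.
pose d1 i k z := g (z, x k) - g (x i, x k).
pose d2 i k z := g (x k, z) - g (x k, x i).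
have eD i z : pair_lift g (relocate x i z) - pair_lift g x =
    \sum_(k | k != i) d1 i k z + \sum_(k | k != i) d2 i k z.
  by rewrite pair_lift_relocate big_split.
(* For fixed [k], the terms with [j] different from [k] cancel under the exchange of [i] and [j];
   only [j = k] is left, the attraction inside the pair. *)
have third (d : 'I_n -> 'I_n -> S -> R) :
    (forall i j k, d i k (x j) = - d j k (x i)) ->
    \sum_i \sum_j 4 * p (x i) (x j) * \sum_(k | k != i) d i k (x j) =
    \sum_i \sum_(k | k != i) 4 * p (x i) (x k) * d i k (x k).
  move=> dd.
  transitivity (\sum_k \sum_(i | i != k) \sum_j 4 * p (x i) (x j) * d i k (x j)).
    rewrite [RHS](exchange_big_dep xpredT)//=; apply: eq_bigr => i _.
    under eq_bigr do rewrite mulr_sumr.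
    rewrite (exchange_big_dep (fun k => k != i))//=.
    apply: eq_big => [k|k ki]; first by rewrite eq_sym.
    by apply: eq_bigl => j; rewrite ki.
  rewrite [RHS](exchange_big_dep xpredT)//=; apply: eq_bigr => k _.
  rewrite (eq_bigr (fun i => 4 * p (x i) (x k) * d i k (x k) +
      \sum_(j | j != k) 4 * p (x i) (x j) * d i k (x j))); last first.
    by move=> i _; rewrite (bigD1 k).
  rewrite big_split /= antisym_sum0 ?addr0; last first.
    by move=> i j; rewrite (dd i j) (p_sym (x i)); ring.
  by apply: eq_bigl => i; rewrite eq_sym.
have first_ (d : 'I_n -> 'I_n -> S -> R) :
    \sum_i \sum_b 2 * m * p (x i) (step (x i) b) *
       \sum_(k | k != i) d i k (step (x i) b) =
    \sum_i \sum_(k | k != i) \sum_b 2 * m * p (x i) (step (x i) b) * d i k (step (x i) b).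
  apply: eq_bigr => i _; under eq_bigr do rewrite mulr_sumr.
  by rewrite exchange_big.
rewrite sip_generator_split.
under eq_bigr do under eq_bigr do rewrite eD mulrDr.
under [X in _ + X]eq_bigr do under eq_bigr do rewrite eD mulrDr.
under eq_bigr do rewrite big_split /=.
under [X in _ + X]eq_bigr do rewrite big_split /=.
rewrite !big_split /= !first_ !third; first last.
- by move=> i j k; rewrite /d1 opprB.
- by move=> i j k; rewrite /d2 opprB.
(* In the [d2] terms the moving particle is the second member of the pair; renaming puts them in the
   order of [pair_lift]. *)
have swap (F : 'I_n -> 'I_n -> R) :
    \sum_i \sum_(k | k != i) F i k = \sum_i \sum_(k | k != i) F k i.
  rewrite (exchange_big_dep xpredT)//=; apply: eq_bigr => i _.
  by apply: eq_bigl => k; rewrite eq_sym.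
rewrite [X in _ + X + _ = _]swap [X in _ + (_ + X) = _]swap.
rewrite /pair_lift -!big_split /=; apply: eq_bigr => i _.
rewrite -!big_split /=; apply: eq_bigr => k _.
by rewrite sip2_generatorE /d1 /d2 /= (p_sym (x k) (x i)); ring.
Qed.

(** The generators intertwine, hence so do their powers, and the two exponential series agree term
    by term. *)
Lemma sip_flow_lift (g : S * S -> R) (M t : R) (x : 'I_n -> S) : 0 <= t ->
  (forall w, `|g w| <= M) ->
  sip_flow t (pair_lift g) x =
  pair_lift (fun w => exp_semigroup (sip2_generator p m) t g w) x.
Proof.
move=> t0 gM.
have LM (y : 'I_n -> S) : `|pair_lift g y| <= \sum_(i < n) \sum_(j | j != i) M.
  rewrite (le_trans (ler_norm_sum _ _ _))//; apply: ler_sum => i _.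
  by rewrite (le_trans (ler_norm_sum _ _ _))//; apply: ler_sum => j _.
rewrite -(sip_flowE _ t0 LM) /exp_semigroup.
have it k (y : 'I_n -> S) : iter k Lam (pair_lift g) y =
    pair_lift (iter k (sip2_generator p m) g) y.
  elim: k y => // k IH y; rewrite !iterS -sip_generator_lift.
  by congr (Lam _ y); apply/funext.
apply/cvg_lim => //.
rewrite (_ : series _ = (fun N => \sum_i \sum_(j | j != i)
    series (fun k => t ^+ k / k`!%:R * iter k (sip2_generator p m) g (x i, x j)) N)).
  apply: cvg_sumr => i _; apply: cvg_sumr => j _.
  by apply: (@exp_dominated_cvg _ _ M (8 * m + 16)) => k; exact: iter_sip2_generator_norm.
apply/funext => N; rewrite /series /=.
under [RHS]eq_bigr do rewrite exchange_big /=.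
rewrite [RHS]exchange_big /=; apply: eq_bigr => k _; rewrite it /pair_lift mulr_sumr.
by apply: eq_bigr => i _; rewrite mulr_sumr.
Qed.

(** Union bound: the indicator of a coincidence is at most the sum over ordered pairs of the pair
    indicators, whose flow reduces to two-particle systems. *)
Lemma sip_flow_collision (t eps : R) (x : 'I_n -> S) : 0 <= t -> 0 <= eps ->
  (forall w, chain_prob (sip2_generator p m) t w [set v | v.1 = v.2] <= eps) ->
  sip_flow t (fun y => (~~ injectiveb y)%:R) x <= n%:R * n%:R * eps.
Proof.
move=> t0 eps0 heps.
pose g : S * S -> R := \1_[set v | v.1 = v.2].
have g01 w : g w = (w.1 == w.2)%:R.
  by rewrite /g indicE; case: eqP => e; [rewrite mem_set|rewrite memNset].
have gM w : `|g w| <= 1 by rewrite g01; case: eqP; rewrite ?normr1 ?normr0.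
have n0 : 0 <= n%:R :> R by [].
have M1 : 1 <= n%:R * n%:R + 1 :> R by rewrite lerDr mulr_ge0.
apply: (@le_trans _ _ (sip_flow t (pair_lift g) x)).
  apply: (@sip_flow_le _ _ _ _ (n%:R * n%:R + 1)) => //.
  - move=> y; rewrite (le_trans _ M1)//.
    by case: injectiveb; rewrite /= ?normr0 ?normr1.
  - move=> y; rewrite (@le_trans _ _ (n%:R * n%:R))//; last by rewrite lerDl.
    apply: (@le_trans _ _ (\sum_(i < n) \sum_(j < n) 1)); last first.
      by rewrite !sumr_const !card_ord mulr_natr.
    rewrite (le_trans (ler_norm_sum _ _ _))//; apply: ler_sum => i _.
    rewrite (le_trans (ler_norm_sum _ _ _))// big_mkcond /=; apply: ler_sum => j _.
    by case: ifP.
  - move=> y; case: injectivePn => [[i [j ji yij]]|_] /=; last first.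
      by apply: sumr_ge0 => i _; apply: sumr_ge0 => j _; rewrite g01.
    rewrite /pair_lift (bigD1 i)//= (bigD1 j) 1?eq_sym//= g01 yij eqxx -addrA lerDl.
    rewrite addr_ge0//; first by apply: sumr_ge0 => k _; rewrite g01.
    by apply: sumr_ge0 => k _; apply: sumr_ge0 => l _; rewrite g01.
rewrite (sip_flow_lift _ t0 gM).
rewrite /pair_lift; apply: (@le_trans _ _ (\sum_(i < n) \sum_(j < n) eps)).
  apply: ler_sum => i _; rewrite big_mkcond /=; apply: ler_sum => j _.
  by case: ifP => // _; exact: heps.
by rewrite !sumr_const !card_ord -mulrnA -[leLHS]mulr_natl natrM.
Qed.

End Lift.

(** * Comparison with independent walkers *)

Section Correlation.
Variable n : nat.
Local Notation Lam := (@jump_generator R ('I_n -> S) _ (@sip_rate n) (@sip_jump n)).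
Implicit Types (del t M : R) (rho : S -> R).

Definition walk_step del rho y := rho y + del * walk_generator rho y.
Definition sip_step del (f : ('I_n -> S) -> R) y := f y + del * Lam f y.

Lemma sip_flow_euler t f M x : 0 <= t -> (forall y, `|f y| <= M) ->
  iter N (sip_step (t / N%:R)) f x @[N --> \oo] --> sip_flow t f x.
Proof.
move=> t0 fM.
have h := @euler_cvg _ _ _ _ (lazy_jump (@sip_jump n)) (@sip_lazy_ge0 n) (@sip_lazy_sum1 n)
  _ _ (ltW (sip_lam_gt0 n)) (@sip_labelledE n) t f M x t0 fM.
exact: h.
Qed.

(** [del * (2 * m) <= 1] makes the step a convex combination of [rho] and its average [walk rho]. *)
Lemma walk_step_bound del rho M : 0 <= del -> del * (2 * m) <= 1 ->
  (forall y, 0 <= rho y <= M) -> forall y, 0 <= walk_step del rho y <= M.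
Proof.
move=> d0 d1 rhoM y; have /andP[r0 rM] := rhoM y.
have /andP[w0 wM] : 0 <= walk rho y <= M.
  rewrite /walk sumr_ge0/=; last by move=> b _; rewrite mulr_ge0//; case/andP: (rhoM (step y b)).
  rewrite -[leRHS]mul1r -[X in _ <= X * _](p_sum1 y) mulr_suml; apply: ler_sum => b _.
  by rewrite ler_wpM2l//; case/andP: (rhoM (step y b)).
rewrite /walk_step /walk_generator mulrA.
have d2 : 0 <= del * (2 * m) by rewrite !mulr_ge0// ltW.
by apply/andP; split; nra.
Qed.

(** For a step this small, [1 + del L] is a convex combination of the identity and a Markov
    operator. *)
Lemma sip_step_le del f g : 0 <= del -> del * sip_lam n <= 1 ->
  (forall y, f y <= g y) -> forall y, sip_step del f y <= sip_step del g y.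
Proof.
move=> d0 d1 fg y; rewrite /sip_step !sip_labelledE.
have := @iter_markov_le _ _ _ _ (lazy_jump (@sip_jump n)) (@sip_lazy_ge0 n) 1 f g y fg.
have := fg y; rewrite /=.
set a := transition _ _ f y; set b := transition _ _ g y => h1 h2.
rewrite !mulrA; have d2 : 0 <= del * sip_lam n by rewrite !mulr_ge0// ltW// sip_lam_gt0.
nra.
Qed.

Lemma sip_stepD del f (c : R) y :
  sip_step del (fun z => f z + c) y = sip_step del f y + c.
Proof.
rewrite /sip_step /jump_generator addrAC; congr (_ + _ * _ + _).
by apply: eq_bigr => j _; rewrite opprD addrACA subrr addr0.
Qed.

Lemma iter_sip_step_le k del f g : 0 <= del -> del * sip_lam n <= 1 ->
  (forall y, f y <= g y) ->
  forall y, iter k (sip_step del) f y <= iter k (sip_step del) g y.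
Proof.
move=> d0 d1 fg; elim: k => // k IH y.
by rewrite !iterS; exact: sip_step_le.
Qed.

Lemma iter_sip_stepD k del f (c : R) y :
  iter k (sip_step del) (fun z => f z + c) y = iter k (sip_step del) f y + c.
Proof.
elim: k y => // k IH y; rewrite !iterS -sip_stepD.
by congr (sip_step _ _ y); apply/funext.
Qed.

(** The remainder is uniform in [a] and [b]: [C] depends on [K] and [s] alone. The bounds on the
    product and on its derivative feed the induction. *)
Lemma prod_first_order (I : eqType) (s : seq I) (K : R) : 0 <= K -> uniq s ->
  exists2 C : R, 0 <= C & forall (a b : I -> R) (d : R),
  (forall i, `|a i| <= K) -> (forall i, `|b i| <= K) -> 0 <= d <= 1 ->
  [/\ `|\prod_(i <- s) a i| <= C,
      `|\sum_(i <- s) b i * \prod_(k <- s | k != i) a k| <= C &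
      `|\prod_(i <- s) (a i + d * b i) - \prod_(i <- s) a i -
        d * \sum_(i <- s) b i * \prod_(k <- s | k != i) a k| <= C * d ^+ 2].
Proof.
move=> K0; elim: s => [_|j s IH /= /andP[js us]].
  exists 1 => // a b d aK bK /andP[d0 d1]; split; rewrite !big_nil.
  - by rewrite normr1.
  - by rewrite normr0.
  - by rewrite mulr0 subr0 subrr normr0 mul1r sqr_ge0.
(* With the new factor, [a j] times the old remainder costs [K C d^2], and [d b j] times the
   increment of the old product costs [2 K C d^2]. *)
have [C C0 hC] := IH us; exists (3 * K * C); first by rewrite !mulr_ge0.
move=> a b d aK bK d01; have [hA hD hP] := hC a b d aK bK d01.
have /andP[d0 d1] := d01.
have eD : \sum_(i <- j :: s) b i * \prod_(k <- j :: s | k != i) a k =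
    b j * \prod_(k <- s) a k + a j * \sum_(i <- s) b i * \prod_(k <- s | k != i) a k.
  rewrite big_cons big_cons eqxx /=; congr (_ * _ + _).
    rewrite [LHS]big_seq_cond [RHS]big_seq; apply: eq_bigl => k.
    by case: eqP => [->|]; rewrite ?andbT// (negbTE js).
  rewrite mulr_sumr big_seq [RHS]big_seq; apply: eq_bigr => i is_.
  rewrite big_cons; case: eqP => [e|_]; first by rewrite e is_ in js.
  by rewrite mulrCA.
rewrite eD !big_cons.
set A := \prod_(i <- s) a i in hA hP *; set D0 := \sum_(i <- s) _ in hD hP *.
set P := \prod_(i <- s) (a i + _) in hP *.
have KC : 0 <= K * C by rewrite mulr_ge0.
have mK x y : `|x| <= K -> `|y| <= C -> `|x * y| <= K * C.
  by move=> xK yC; rewrite normrM ler_pM.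
split.
- by rewrite (le_trans (mK _ _ (aK j) hA))//; lra.
- rewrite (le_trans (ler_normD _ _))//.
  by have := mK _ _ (bK j) hA; have := mK _ _ (aK j) hD; lra.
- rewrite [X in `|X|](_ : _ = a j * (P - A - d * D0) + d * b j * (P - A)); last by ring.
  have hPA : `|P - A| <= 2 * C * d.
    rewrite [X in `|X|](_ : _ = (P - A - d * D0) + d * D0); last by ring.
    rewrite (le_trans (ler_normD _ _))// normrM (ger0_norm d0).
    have : C * d ^+ 2 <= C * d by rewrite ler_wpM2l// expr2 ler_piMl.
    have : d * `|D0| <= d * C by rewrite ler_wpM2l.
    by move: hP; lra.
  rewrite (le_trans (ler_normD _ _))// !normrM (ger0_norm d0).
  have h1 : `|a j| * `|P - A - d * D0| <= K * (C * d ^+ 2) by rewrite ler_pM.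
  have h2 : d * `|b j| * `|P - A| <= d * K * (2 * C * d).
    by rewrite ler_pM ?mulr_ge0// ler_wpM2l.
  by move: h1 h2; lra.
Qed.

(** To first order the left side is the product function plus [del] times the generator of
    independent walkers, which [sip_generator_product_ge] bounds by the SIP generator. *)
Lemma product_fun_step M : 0 <= M -> exists2 C : R, 0 <= C &
  forall del rho, 0 <= del <= 1 -> (forall y, 0 <= rho y <= M) ->
  forall x : 'I_n -> S, product_fun (walk_step del rho) x <=
    sip_step del (product_fun rho) x + C * del ^+ 2.
Proof.
(* [K] bounds both [rho], by [M], and [walk_generator rho], by [4 m M]. *)
move=> M0; pose K := (4 * m + 1) * M.
have m0 := ltW m_gt0.
have K0 : 0 <= K by rewrite mulr_ge0// addr_ge0// mulr_ge0.
have [C C0 hC] := @prod_first_order _ (index_enum 'I_n) K K0 (index_enum_uniq _).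
exists C => // del rho /andP[d0 d1] rhoM x.
have nrho y : `|rho y| <= M by have /andP[r0 rM] := rhoM y; rewrite ger0_norm.
have nw y : `|walk_generator rho y| <= K.
  have nwk : `|walk rho y| <= M.
    rewrite /walk (le_trans (ler_norm_sum _ _ _))//.
    rewrite -[leRHS]mul1r -[X in _ <= X * _](p_sum1 y) mulr_suml; apply: ler_sum => b _.
    by rewrite normrM ger0_norm// ler_wpM2l.
  rewrite /walk_generator normrM ger0_norm ?mulr_ge0//.
  have h : `|walk rho y - rho y| <= M + M by rewrite (le_trans (ler_normB _ _))// lerD.
  have : 2 * m * `|walk rho y - rho y| <= 2 * m * (M + M) by rewrite ler_wpM2l// mulr_ge0.
  by rewrite /K; lra.
have MK : M <= K by rewrite /K ler_peMl// lerDr mulr_ge0.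
have [_ _] := hC (fun i => rho (x i)) (fun i => walk_generator rho (x i)) del
  (fun i => le_trans (nrho _) MK) (fun i => nw _) (introT andP (conj d0 d1)).
move=> /(le_trans (ler_norm _)).
have := sip_generator_product_ge x (fun y => proj1 (andP (rhoM y))).
rewrite /sip_step /product_fun /walk_step.
set L := jump_generator _ _ _ _; set P := \prod_(i < n) (rho (x i) + _).
set Q := \prod_(i < n) rho (x i).
rewrite (eq_bigr (fun i => walk_generator rho (x i) * others rho x i)); last first.
  by move=> i _; rewrite mulrC.
set D0 := \sum_(i < n) _ => h1 h2.
have h3 : del * D0 <= del * L by rewrite ler_wpM2l.
have : P - Q - del * D0 <= C * del ^+ 2 by [].
by move: h3; lra.
Qed.

(** Monotone steps that commute with adding constants carry each one-step error through unchanged.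
    For [k = N] and [del = t / N] the total is [C t^2 / N]. *)
Lemma product_fun_iter M : 0 <= M -> exists2 C : R, 0 <= C &
  forall del k rho, 0 <= del <= 1 -> del * (2 * m) <= 1 -> del * sip_lam n <= 1 ->
  (forall y, 0 <= rho y <= M) ->
  forall x : 'I_n -> S, product_fun (iter k (walk_step del) rho) x <=
    iter k (sip_step del) (product_fun rho) x + k%:R * (C * del ^+ 2).
Proof.
move=> M0; have [C C0 hC] := product_fun_step M0; exists C => // del k rho d01 dm dl.
have /andP[d0 d1] := d01.
elim: k rho => [|k IH] rho rhoM x; first by rewrite mul0r addr0.
rewrite !iterSr (le_trans (IH _ (walk_step_bound d0 dm rhoM) x))//.
rewrite -natr1 mulrDl mul1r addrA (addrAC _ _ (C * _)) lerD2r -iter_sip_stepD.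
apply: iter_sip_step_le => // y; exact: hC.
Qed.

End Correlation.

(** A lone particle can be attracted only by itself, at a rate proportional to [p x x = 0]: it
    performs the plain walk. *)
Lemma one_particle_iter k (del : R) (rho : S -> R) (x : 'I_1 -> S) :
  iter k (sip_step del) (fun y : 'I_1 -> S => rho (y ord0)) x =
  iter k (walk_step del) rho (x ord0).
Proof.
elim: k x => // k IH x; rewrite !iterS.
rewrite (_ : iter k _ _ = (fun y => iter k (walk_step del) rho (y ord0))); last exact/funext.
rewrite /sip_step sip_generator_split !big_ord1 p_diag mulr0 mul0r addr0.
by rewrite /walk_step walk_generatorE /relocate.
Qed.

(* Liggett's comparison with independent walkers, passed to the limit along Euler
   schemes. *)
Lemma sip_flow_product_ge n (t M : R) (rho : S -> R) (x : 'I_n -> S) :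
  0 <= t -> 0 <= M -> (forall y, 0 <= rho y <= M) ->
  \prod_i sip_flow t (fun y : 'I_1 -> S => rho (y ord0)) (fun=> x i) <=
  sip_flow t (product_fun rho) x.
Proof.
move=> t0 M0 rhoM.
have nrho y : `|rho y| <= M by have /andP[r0 rM] := rhoM y; rewrite ger0_norm.
have [C C0 hC] := @product_fun_iter n M M0.
have cL : product_fun (iter N (walk_step (t / N%:R)) rho) x @[N --> \oo] -->
    \prod_i sip_flow t (fun y : 'I_1 -> S => rho (y ord0)) (fun=> x i).
  apply: cvg_prodr => i _; under eq_fun do rewrite -(one_particle_iter _ _ _ (fun=> x i)).
  have n1 (y : 'I_1 -> S) : `|rho (y ord0)| <= M by [].
  have h := @sip_flow_euler 1 t (fun y => rho (y ord0)) M (fun=> x i) t0 n1.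
  exact: h.
have Pn (y : 'I_n -> S) : `|product_fun rho y| <= M ^+ n.
  by have /andP[h0 h1] := product_fun_bound y rhoM; rewrite ger0_norm.
have cH : C * t ^+ 2 * harmonic k @[k --> \oo] --> (0 : R).
  rewrite -[X in _ --> X](mulr0 (C * t ^+ 2)); apply: cvgM; first exact: cvg_cst.
  exact: cvg_harmonic.
have cR : iter N (sip_step (t / N%:R)) (product_fun rho) x +
      N%:R * (C * (t / N%:R) ^+ 2) @[N --> \oo] -->
    sip_flow t (product_fun rho) x + 0.
  apply: cvgD.
    have h := @sip_flow_euler n t _ _ x t0 Pn; exact: h.
  rewrite -cvg_shiftS (_ : [sequence _]_k = (fun k => C * t ^+ 2 * harmonic k)); last first.
    by apply/funext => k; rewrite /harmonic /=; field; rewrite nat1r pnatr_eq0.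
  exact: cH.
rewrite -[leRHS]addr0; apply: ler_cvg_to cL cR _; near=> N.
have N0 : 0 < N%:R :> R by rewrite ltr0n; near: N; exact: nbhs_infty_gt.
have small a : t * a < N%:R -> t / N%:R * a <= 1.
  by move=> h; rewrite mulrAC ler_pdivrMr// mul1r ltW.
apply: hC => //.
- rewrite divr_ge0//= -[leLHS]mulr1 small//; near: N; exact: nbhs_infty_gtr.
- apply: small; near: N; exact: nbhs_infty_gtr.
- apply: small; near: N; exact: nbhs_infty_gtr.
Unshelve. all: by end_near. Qed.

End Particles.
(** * Duality for the infinite system *)

Lemma EFin_lim_series (R : realType) (u : nat -> R) : cvgn (series u) ->
  ((limn (series u))%:E = \sum_(k <oo) (u k)%:E)%E.
Proof.
move=> cu; rewrite -EFin_lim//; congr (limn _); apply/funext => N.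
by rewrite /series /= -sumEFin.
Qed.

Section FiniteDuality.
Variables (R : realType) (G : geometry) (p : sites G -> sites G -> R) (m : R).
Local Notation S := (sites G).
Variable P : R -> R.-pker (config S) ~> (config S).
Variables (J0 : finType) (step : S -> J0 -> S).
Hypothesis m_gt0 : 0 < m.
Hypothesis p_ge0 : forall x y, 0 <= p x y.
Hypothesis step_inj : forall x, injective (step x).
Hypothesis step_surj : forall x y, p x y != 0 -> exists b, y = step x b.
Hypothesis p_sum1 : forall x, \sum_b p x (step x b) = 1.
Hypothesis sipP : SIP p m P.

Local Notation Q n := (transition (lazy_rate (@sip_rate R S p m J0 step n) (@sip_lam R m n))
  (lazy_jump (@sip_jump S J0 step n))).
Local Notation Fin := [set xi : config S | finite_config xi].

Definition poi (tau : R) k : R := expR (- tau) * (tau ^+ k / k`!%:R).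

Lemma poi_ge0 tau k : 0 <= tau -> 0 <= poi tau k.
Proof. by move=> t0; rewrite /poi mulr_ge0 ?expR_ge0// divr_ge0 ?exprn_ge0. Qed.

(** The series is placed in [\bar R], with the nonnegative weights [poi], so that it can be
    exchanged with integrals. *)
Lemma sip_flow_series n (x : 'I_n -> S) (t M : R) (f : ('I_n -> S) -> R) : 0 <= t ->
  (forall y, `|f y| <= M) ->
  ((sip_flow p m step t f x)%:E =
   \sum_(k <oo) (poi (sip_lam m n * t) k * iter k (Q n) f x)%:E)%E.
Proof.
move=> t0 fM.
have cv := @heat_cvg _ _ _ _ (lazy_jump (@sip_jump S J0 step n)) (@sip_lazy_ge0 _ _ _ _ _ _ m_gt0 p_ge0 p_sum1 n)
  (sip_lazy_sum1 p m step (n := n)) (sip_lam m n * t) f M x fM.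
rewrite /sip_flow /heat -[expR _ * _](lim_seriesZ (expR (- (sip_lam m n * t))) cv).
rewrite EFin_lim_series; last exact: is_cvg_seriesZ.
by apply: eq_eseriesr => k _; rewrite /poi -mulrA.
Qed.

Lemma sip_finite_point n (x : 'I_n -> S) (t : R) (xi : config S) :
  0 <= t -> finite_config xi ->
  P t (occupation x) [set xi] =
  (sip_flow p m step t (fun y : 'I_n -> S => \1_[set xi] (occupation y)) x)%:E.
Proof.
move=> t0 fxi; rewrite (sip_finite sipP)//; last exact: finite_occupation.
rewrite /chain_prob; congr EFin.
apply: (@sip_exp_labelled _ _ _ _ _ _ _ _ _ _ _ _ _ _ 1) => //.
by move=> y; rewrite indicE; case: (_ \in _); rewrite ?normr1 ?normr0.
Qed.

(** [sip_finite] speaks of single points, so the integral is first taken over a set of at most one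
    element. *)
Lemma sip_finite_slice n (x : 'I_n -> S) (t : R) (g : (S -> nat) -> R)
    (A : set (config S)) : 0 <= t -> (forall xi, 0 <= g xi) -> A `<=` Fin ->
  {in A &, forall xi xi', xi = xi'} ->
  (\int[P t (occupation x)]_(xi in A) (g xi)%:E =
   \sum_(k <oo) (poi (sip_lam m n * t) k *
      iter k (Q n) (fun y => g (occupation y) * \1_A (occupation y)) x)%:E)%E.
Proof.
move=> t0 g0 AF A1.
have [->|/set0P[a Aa]] := eqVneq A set0.
  rewrite integral_set0 eseries0// => k _ _.
  rewrite (_ : (fun y => _) = (fun=> 0)); last first.
    by apply/funext => y; rewrite indic0 mulr0.
  by rewrite iter_markov_cst ?mulr0//; exact: sip_lazy_sum1.
have eA : A = [set a].
  apply/seteqP; split => [xi Axi|_ ->//].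
  by apply: A1; exact: mem_set.
have fM (y : 'I_n -> S) : `|\1_[set a] (occupation y) : R| <= 1.
  by rewrite indicE; case: (_ \in _); rewrite ?normr1 ?normr0.
rewrite eA (eq_integral (cst (g a)%:E)); last first.
  by move=> xi; rewrite inE /= => ->.
rewrite integral_cst//=; last exact: measurable_config1.
rewrite (sip_finite_point _ t0); last exact: AF.
rewrite (sip_flow_series x t0 fM) -nneseriesZl; last first.
  move=> k _; rewrite lee_fin mulr_ge0//; first by rewrite poi_ge0// sip_clock_ge0.
  apply: iter_markov_ge0; first exact: (sip_lazy_ge0 m_gt0 p_ge0 p_sum1).
  by move=> y; rewrite indicE.
apply: eq_eseriesr => k _; rewrite -EFinM; congr EFin.
rewrite mulrCA; congr (_ * _); rewrite -iter_markovZ; congr (iter _ _ _ _).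
apply/funext => y; rewrite !indicE; case: (boolP (_ \in _)); rewrite ?mulr0//.
by rewrite inE /= => ->.
Qed.

(** The domain is cut into the slices [A k]. After exchanging sums, the slices are reassembled
    inside each power of [Q], their sum being an integral for the counting measure. *)
Lemma sip_finite_integral n (x : 'I_n -> S) (t : R) (g : (S -> nat) -> R) :
  0 <= t -> (forall xi, 0 <= g xi) ->
  (\int[P t (occupation x)]_(xi in Fin) (g xi)%:E =
   \sum_(k <oo) (poi (sip_lam m n * t) k *
      iter k (Q n) (fun y => g (occupation y)) x)%:E)%E.
Proof.
move=> t0 g0.
have [code codeI] := finite_config_code S.
pose A k : set (config S) := Fin `&` [set xi | code xi = k].
have FA : Fin = \bigcup_k A k.
  by apply/seteqP; split => [xi fxi|xi [k _ []//]]; exists (code xi).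
have mA k : measurable (A k) by apply: measurable_finite_config => xi [].
have tA : trivIset setT A.
  apply/trivIsetP => i j _ _ /eqP ij; apply/seteqP; split => // xi.
  by move=> [[_ /= e1] [_ /= e2]]; apply: ij; rewrite -e1 -e2.
have mF : measurable_fun Fin (fun xi => (g xi)%:E).
  by move=> _ Y _; apply: measurable_finite_config => xi [].
rewrite FA ge0_integral_bigcup//; first last.
- by move=> xi _; rewrite lee_fin.
- by rewrite -FA.
have q0 k (f : ('I_n -> S) -> R) y : (forall z, 0 <= f z) -> 0 <= iter k (Q n) f y.
  by move=> f0; apply: iter_markov_ge0 => //; exact: (sip_lazy_ge0 m_gt0 p_ge0 p_sum1).
have po k : 0 <= poi (sip_lam m n * t) k by rewrite poi_ge0// sip_clock_ge0.
have gA0 i y : 0 <= g (occupation y) * \1_(A i) (occupation y) :> R.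
  by rewrite mulr_ge0// indicE.
under eq_eseriesr => i _.
  rewrite (sip_finite_slice _ t0 g0); first last.
  - by move=> xi xi' /set_mem[f1 /= c1] /set_mem[f2 /= c2]; apply: codeI;
      rewrite ?inE// c1 c2.
  - by move=> xi [].
  over.
rewrite nneseries_interchange; last first.
  by move=> i k; rewrite lee_fin mulr_ge0// q0.
apply: eq_eseriesr => k _.
under eq_eseriesr do rewrite EFinM.
rewrite nneseriesZl; last by move=> i _; rewrite lee_fin q0.
rewrite [RHS]EFinM; congr (_ * _)%E.
rewrite -(@ge0_integral_count R (fun i => (iter k (Q n)
    (fun y => g (occupation y) * \1_(A i) (occupation y)) x)%:E)); last first.
  by move=> i; rewrite lee_fin q0.
apply: (@integral_iter_markov _ _ _ _ _ _ _ _ _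
  (fun i y => g (occupation y) * \1_(A i) (occupation y))) => //.
  exact: (sip_lazy_ge0 m_gt0 p_ge0 p_sum1).
move=> y; rewrite ge0_integral_count; last by move=> i; rewrite lee_fin.
pose c0 := code (occupation y).
have fy := finite_occupation y.
(* Only the slice of index [c0] contains [occupation y]. *)
rewrite (nneseriesD1 (n := c0))// ?eseries0 ?adde0.
- rewrite indicE mem_set ?mulr1//.
- move=> i _ ic; rewrite indicE memNset ?mulr0// => -[_ /= e].
  by rewrite -e eqxx in ic.
- by move=> i _; rewrite lee_fin.
Qed.

Lemma integral_evolve (nu : probability (config S) R) t (f : config S -> \bar R) :
  (forall eta, 0 <= f eta)%E -> measurable_fun setT f ->
  (\int[evolve (P t) nu]_eta f eta = \int[nu]_eta \int[P t eta]_zeta f zeta)%E.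
Proof.
move=> f0 mf.
pose l : R.-pker unit ~> (config S) :=
  kprobability (measurable_cst (nu : pprobability (config S) R)).
have := @integral_kcomp _ _ _ _ _ _ _ l (kernel.kernel_snd (P t)) tt f f0 mf.
move=> /= <-.
by apply: eq_measure_integral => A mA _.
Qed.

(** Pointwise duality holds on tempered configurations, which carry [nu]; averaging commutes with
    the Poisson mixture by Tonelli. The bound [M] makes the moments a bounded function for the
    flow. *)
Lemma duality_flow (nu : probability (config S) R) n (x : 'I_n -> S) (t M : R) :
  is_lattice G -> 0 <= t -> measurable (@tempered G : set (config S)) ->
  nu (~` @tempered G) = 0%E ->
  (forall y : 'I_n -> S, dual_moment m nu (occupation y) <= M%:E)%E ->
  dual_moment m (evolve (P t) nu) (occupation x) =
  (sip_flow p m step t (moment m nu) x)%:E.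
Proof.
move=> latG t0 mtemp nutemp hM.
have mDx (y : 'I_n -> S) := measurable_D m_gt0 y.
have mED (y : 'I_n -> S) : measurable_fun setT
    (fun eta : config S => (D m (occupation y) eta)%:E).
  by apply/measurable_EFinP; exact: measurable_D.
have mo0 (y : 'I_n -> S) : (0 <= dual_moment m nu (occupation y))%E.
  by apply: integral_ge0 => eta _; rewrite lee_fin D_ge0.
have moE (y : 'I_n -> S) : dual_moment m nu (occupation y) = (moment m nu y)%:E.
  by rewrite /moment fineK// ge0_fin_numE// (le_lt_trans (hM y))// ltry.
have moM (y : 'I_n -> S) : `|moment m nu y| <= M.
  by rewrite ger0_norm -lee_fin -moE.
have q0 k (f : ('I_n -> S) -> R) y : (forall z, 0 <= f z) -> 0 <= iter k (Q n) f y.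
  by move=> f0; apply: iter_markov_ge0 => //; exact: (sip_lazy_ge0 m_gt0 p_ge0 p_sum1).
have po k : 0 <= poi (sip_lam m n * t) k by rewrite poi_ge0// sip_clock_ge0.
pose h k (eta : config S) := (poi (sip_lam m n * t) k *
  iter k (Q n) (fun y => D m (occupation y) eta) x)%:E.
have h0 k eta : (0 <= h k eta)%E.
  by rewrite lee_fin mulr_ge0// q0// => y; exact: D_ge0.
have mh k : measurable_fun setT (h k).
  apply/measurable_EFinP/measurable_funM => //.
  apply: (@measurable_iter_markov _ _ _ _ _ _ _ (fun (eta : config S) (y : 'I_n -> S) => D m (occupation y) eta)).
  exact: mDx.
have mI : measurable_fun setT
    (fun eta : config S => \int[P t eta]_zeta (D m (occupation x) zeta)%:E)%E.
  apply: measurable_fun_integral_kernel => //.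
  - by move=> U mU; exact: measurable_kernel.
  - by move=> zeta; rewrite lee_fin D_ge0.
have mC : measurable (~` @tempered G : set (config S)) by exact: measurableC.
rewrite {1}/dual_moment integral_evolve//; last by move=> eta; rewrite lee_fin D_ge0.
transitivity (\int[nu]_eta \sum_(k <oo) h k eta)%E.
  rewrite (ge0_negligible_integral mC)//; last first.
    by move=> eta _; apply: integral_ge0 => zeta _; rewrite lee_fin D_ge0.
  rewrite [RHS](ge0_negligible_integral mC)//; first last.
  - by move=> eta _; apply: nneseries_ge0.
  - exact: ge0_emeasurable_sum.
  apply: eq_integral => eta; rewrite setTD setCK => /set_mem etat.
  rewrite (sip_duality sipP)//; last exact: finite_occupation.
  rewrite (sip_finite_integral x t0 (g := fun zeta => D m zeta eta))//.
  by move=> xi; exact: D_ge0.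
rewrite integral_nneseries// (sip_flow_series x t0 moM).
apply: eq_eseriesr => k _; rewrite /h EFinM.
under eq_integral do rewrite EFinM.
rewrite ge0_integralZl_EFin//; first last.
- apply/measurable_EFinP.
  apply: (@measurable_iter_markov _ _ _ _ _ _ _ (fun (eta : config S) (y : 'I_n -> S) => D m (occupation y) eta)).
  exact: mDx.
- by move=> eta _; rewrite lee_fin q0// => y; exact: D_ge0.
congr (_ * _)%E.
apply: (@integral_iter_markov _ _ _ _ _ _ _ _ _ (fun (eta : config S) (y : 'I_n -> S) => D m (occupation y) eta)) => //.
- exact: (sip_lazy_ge0 m_gt0 p_ge0 p_sum1).
- by move=> eta y; exact: D_ge0.
Qed.

End FiniteDuality.
(** * Temperedness on the lattice *)

Section LatticeBox.
Variable d : nat.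
Local Notation Z := 'rV[int]_d.

(** Enumerates the cube [[-N, N]^d]; writing [2 N + 1] as [N + N.+1] lets [big_split_ord] cut each
    coordinate range at 0. *)
Definition box N (f : {ffun 'I_d -> 'I_(N + N.+1)}) : Z :=
  \row_i ((f i)%:Z - N%:Z).

Lemma box_inj N : injective (@box N).
Proof.
move=> f g /rowP e; apply/ffunP => i; apply: val_inj; have := e i.
by rewrite !mxE => /addIr[].
Qed.

Lemma box_surj N (v : Z) : (forall i, `|v 0%R i|%N <= N)%N ->
  exists f : {ffun 'I_d -> 'I_(N + N.+1)}, v = box f.
Proof.
move=> vN.
have lt_i i : (`|(v 0%R i + N%:Z)%R|%N < N + N.+1)%N by have := vN i; lia.
exists [ffun i => Ordinal (lt_i i)]; apply/rowP => i; rewrite mxE ffunE /=.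
by have := vN i; lia.
Qed.

End LatticeBox.

Section PolynomialWeights.
Variable R : realType.

Definition inv_square (k : nat) : R := (k.+1 ^ 2)%:R^-1.

Lemma inv_square_ge0 k : 0 <= inv_square k.
Proof. by rewrite invr_ge0. Qed.

Lemma sum_inv_square_le n : \sum_(k < n) inv_square k <= 2.
Proof.
case: n => [|n]; first by rewrite big_ord0.
(* The sharper telescoping bound is the one that passes through the induction. *)
apply: (@le_trans _ _ (2 - n.+1%:R^-1)); last by rewrite gerBl invr_ge0.
elim: n => [|n IH]; first by rewrite big_ord_recr big_ord0 /inv_square /= invr1; lra.
rewrite big_ord_recr /=; apply: (le_trans (lerD IH (lexx _))).
rewrite /inv_square natrX -[n.+2%:R]natr1.
have x0 : 0 < n.+1%:R :> R by [].
set x := n.+1%:R in x0 *.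
have x1 : 0 < x + 1 by rewrite addr_gt0.
rewrite -subr_ge0 [leRHS](_ : _ = (x * (x + 1) ^+ 2)^-1); last first.
  by field; rewrite !gt_eqF.
by rewrite invr_ge0 mulr_ge0 ?exprn_ge0// ltW.
Qed.

Lemma sum_two_sided N :
  \sum_(k < N + N.+1) inv_square `|(k%:Z - N%:Z)%R|%N <= 4.
Proof.
rewrite big_split_ord /= [4](_ : _ = 2 + 2); last by rewrite -natrD.
apply: lerD.
  rewrite (reindex_inj rev_ord_inj) /=.
  apply: (@le_trans _ _ (\sum_(k < N.+1) inv_square k)); last exact: sum_inv_square_le.
  rewrite big_ord_recl /=; apply: (@le_trans _ _ (\sum_(i < N) inv_square (bump 0 i))).
    apply: ler_sum => i _; rewrite le_eqVlt; apply/orP; left; apply/eqP.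
    by congr inv_square; rewrite /bump /=; have := ltn_ord i; lia.
  by rewrite lerDr inv_square_ge0.
apply: (@le_trans _ _ (\sum_(k < N.+1) inv_square k)); last exact: sum_inv_square_le.
apply: ler_sum => i _; rewrite le_eqVlt; apply/orP; left; apply/eqP.
by congr inv_square; lia.
Qed.

Variable d : nat.
Local Notation Z := 'rV[int]_d.

(** A weight that is summable over the lattice while its inverse grows only polynomially. *)
Definition site_weight (x : Z) : R := \prod_(i < d) inv_square `|x 0%R i|%N.

Lemma site_weight_gt0 x : 0 < site_weight x.
Proof. by apply: prodr_gt0 => i _; rewrite invr_gt0 ltr0n expn_gt0. Qed.

(** On a cube containing [s], the sum factorizes over coordinates into [d] two-sided sums, each at
    most 4. *)
Lemma sum_site_weight (s : seq Z) : uniq s -> \sum_(x <- s) site_weight x <= 4 ^+ d.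
Proof.
move=> us.
pose N := (\max_(x <- s) \max_(i < d) `|x 0%R i|%N)%N.
have xN x : x \in s -> forall i, (`|x 0%R i| <= N)%N.
  move=> xs i; rewrite /N (big_rem x)//= (bigD1 i)//=.
  by rewrite -maxnA leq_maxl.
pose g (x : Z) : option {ffun 'I_d -> 'I_(N + N.+1)} := [pick f | x == box f].
apply: (@le_trans _ _ (\sum_(f : {ffun 'I_d -> 'I_(N + N.+1)}) site_weight (box f))).
  rewrite (_ : \sum_(x <- s) _ =
      \sum_(f : {ffun 'I_d -> 'I_(N + N.+1)} | box f \in s) site_weight (box f)).
    by rewrite [leRHS](bigID (fun f => box f \in s))/= lerDl sumr_ge0// => f _; exact: ltW (site_weight_gt0 _).
  rewrite -[RHS]big_filter -(big_map (@box d N) xpredT site_weight) /=.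
  apply: perm_big; apply: uniq_perm => //.
    by rewrite map_inj_uniq ?filter_uniq ?index_enum_uniq//; exact: box_inj.
  move=> x; apply/idP/mapP => [xs|[f]].
    have [f xf] := box_surj (xN x xs); exists f => //.
    by rewrite mem_filter -xf xs mem_index_enum.
  by rewrite mem_filter => /andP[fs _] ->.
rewrite /site_weight (eq_bigr (fun f : {ffun 'I_d -> 'I_(N + N.+1)} =>
    \prod_i inv_square `|((f i)%:Z - N%:Z)%R|%N)); last first.
  by move=> f _; apply: eq_bigr => i _; rewrite mxE.
rewrite -(bigA_distr_bigA (fun (i : 'I_d) (k : 'I_(N + N.+1)) =>
    inv_square `|(k%:Z - N%:Z)%R|%N)) /=.
rewrite [leRHS](_ : _ = \prod_(i < d) 4); last by rewrite prodr_const card_ord.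
apply: ler_prod => i _; rewrite sum_two_sided andbT.
by apply: sumr_ge0 => k _; exact: inv_square_ge0.
Qed.

Lemma site_weight_inv_le (x : Z) :
  (site_weight x)^-1 <= ((1 + \sum_(i < d) `|x 0%R i|%N) ^ (2 * d))%:R.
Proof.
rewrite /site_weight /inv_square -prodfV.
rewrite expnM natrX.
rewrite [leRHS](_ : _ = \prod_(i < d) (((1 + \sum_(i < d) `|x 0%R i|%N) ^ 2)%:R : R)); last first.
  by rewrite prodr_const card_ord.
apply: ler_prod => i _; rewrite invrK ler0n ler_nat /= leq_exp2r// -add1n leq_add2l.
by rewrite (bigD1 i)//= leq_addr.
Qed.

End PolynomialWeights.

(** * Temperedness from bounded first moments *)

Section Tempered.
Variables (R : realType) (d : nat).
Local Notation S := (sites (Lattice d)).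
Local Notation temp := (@tempered (Lattice d) : set (config S)).

Lemma measurable_tempered : measurable temp.
Proof.
rewrite (_ : temp = \bigcup_c \bigcup_k \bigcap_(x : S) [set eta : config S |
    [set j | (j <= c * (1 + \sum_(i < d) `|(x : 'rV[int]_d) 0%R i|) ^ k)%N] (eta x)]).
  apply: bigcupT_measurable => c; apply: bigcupT_measurable => k.
  by apply: countable_bigcap_measurable => x; exact: measurable_coord.
apply/seteqP; split=> [eta [c [k h]]|eta [c _ [k _ h]]].
  by exists c => //; exists k => // x _; exact: h.
by exists c, k => x; exact: (h x).
Qed.

Definition weighted_count (n : nat) (eta : config S) : \bar R :=
  if pickle_inv n is Some x then (site_weight R (x : 'rV[int]_d) * (eta x)%:R)%:E else 0%E.

Lemma weighted_count_ge0 n eta : (0 <= weighted_count n eta)%E.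
Proof.
rewrite /weighted_count; case: pickle_inv => // x.
by rewrite lee_fin mulr_ge0// ltW// site_weight_gt0.
Qed.

Lemma measurable_weighted_count n : measurable_fun setT (weighted_count n).
Proof.
rewrite /weighted_count; case: pickle_inv => [x|]; last exact: measurable_cst.
exact: (measurable_fun_coord (fun j => (site_weight R (x : 'rV[int]_d) * j%:R)%:E) x).
Qed.

(** The weighted number of particles has mean at most [4^d M], so it is almost surely a finite [r];
    then [eta x <= r / site_weight x], which is polynomial in [x]. *)
Lemma tempered_ae (nu : probability (config S) R) (M : R) : 0 <= M ->
  (forall x, \int[nu]_eta ((eta x)%:R : R)%:E <= M%:E)%E ->
  nu (~` temp) = 0%E.
Proof.
move=> M0 hM.
pose F eta := (\sum_(n <oo) weighted_count n eta)%E.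
have F0 eta : (0 <= F eta)%E by apply: nneseries_ge0 => n _ _; exact: weighted_count_ge0.
have mF : measurable_fun setT F.
  apply: ge0_emeasurable_sum => [n eta _ _|n _]; first exact: weighted_count_ge0.
  exact: measurable_weighted_count.
have intF : (\int[nu]_eta F eta <= (4 ^+ d * M)%:E)%E.
  rewrite integral_nneseries//; first last.
  - by move=> n eta _; exact: weighted_count_ge0.
  - exact: measurable_weighted_count.
  apply: lime_le.
    by apply: is_cvg_nneseries => n _ _; apply: integral_ge0 => eta _; exact: weighted_count_ge0.
  apply: nearW => N.
  pose s : seq S := pmap pickle_inv (iota 0 N).
  apply: (@le_trans _ _ (\sum_(x <- s) (site_weight R (x : 'rV[int]_d) * M)%:E)%E).
    rewrite /s big_pmap /index_iota subn0; apply: lee_sum => n _.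
    rewrite /weighted_count; case: pickle_inv => [x|] /=; last by rewrite integral0.
    under eq_integral do rewrite EFinM.
    rewrite ge0_integralZl_EFin//; last 2 first.
    - by apply: (measurable_fun_coord (fun j => (j%:R : R)%:E) x).
    - by rewrite ltW// site_weight_gt0.
    by rewrite EFinM lee_wpmul2l// lee_fin ltW// site_weight_gt0.
  rewrite sumEFin lee_fin -mulr_suml ler_wpM2r// sum_site_weight//.
  apply: (pmap_uniq (g := @pickle S)); last exact: iota_uniq.
  exact: pickle_invK.
have iF : nu.-integrable setT F.
  apply/integrableP; split => //.
  under eq_integral do rewrite gee0_abs//.
  by rewrite (le_lt_trans intF)// ltry.
have /integrable_ae := iF => /(_ measurableT) [N [mN N0 FN]].
apply: (subset_measure0 _ _ _ N0) => //; first exact: measurableC measurable_tempered.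
move=> eta /= nt; apply: FN => /= /(_ I) Ffin; apply: nt.
pose r := fine (F eta).
have r0 : 0 <= r by exact: fine_ge0.
exists (Num.bound r), (2 * d)%N => x.
have hx : site_weight R (x : 'rV[int]_d) * (eta x)%:R <= r.
  rewrite -lee_fin fineK// /F (nneseriesD1 (n := pickle x))//; last first.
    by move=> k _; exact: weighted_count_ge0.
  rewrite {1}/weighted_count pickleK_inv leeDl// nneseries_ge0// => n _ _.
  exact: weighted_count_ge0.
rewrite -(@ler_nat R) natrM.
have w0 := site_weight_gt0 R (x : 'rV[int]_d).
apply: (@le_trans _ _ (r * (site_weight R (x : 'rV[int]_d))^-1)).
  by rewrite ler_pdivlMr// mulrC.
apply: ler_pM => //; first by rewrite invr_ge0 ltW.
  by rewrite ltW// archi_boundP.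
exact: site_weight_inv_le.
Qed.

End Tempered.
(** * Measures determined by their factorial moments *)

Section BinomialShift.
Variable R : realType.
Implicit Types (v h : R) (k l : nat).

(** The [k]-th derivative of [v^l] divided by [k!]. At [v = 1] it is ['C(l, k)]; at [v = 0], since
    [0^0 = 1], it is the indicator of [l = k]. *)
Definition bpow k l v : R := 'C(l, k)%:R * v ^+ (l - k).

Lemma bpow_ge0 k l v : 0 <= v -> 0 <= bpow k l v.
Proof. by move=> v0; rewrite mulr_ge0// exprn_ge0. Qed.

Lemma bpow_le k l v w : 0 <= v -> v <= w -> bpow k l v <= bpow k l w.
Proof. by move=> v0 vw; rewrite ler_wpM2l// lerXn2r// nnegrE ?(le_trans v0). Qed.

Lemma bpow1 k l : bpow k l 1 = 'C(l, k)%:R.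
Proof. by rewrite /bpow expr1n mulr1. Qed.

Lemma bpow0 k l : bpow k l 0 = (l == k)%:R.
Proof.
rewrite /bpow expr0n; have [lk|kl|->] := ltngtP l k.
- by rewrite bin_small// mul0r.
- by rewrite subn_eq0 leqNgt kl mulr0.
- by rewrite binn subnn mulr1.
Qed.

(** Taylor expansion at [v], finite because the terms with [k + j > l] vanish. *)
Lemma bpow_shift k l v h : bpow k l (v - h) =
  \sum_(j < l.+1) (-1) ^+ j * ('C(k + j, k)%:R * h ^+ j * bpow (k + j) l v).
Proof.
have [lk|kl] := ltnP l k.
  rewrite /bpow bin_small// mul0r big1// => j _.
  by rewrite /bpow (@bin_small l) ?mul0r ?mulr0// (leq_trans lk)// leq_addr.
rewrite /bpow exprDn mulr_sumr.
rewrite (big_ord_widen l.+1 (fun j => 'C(l, k)%:R * (v ^+ (l - k - j) * (- h) ^+ j *+ 'C(l - k, j)))); last first.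
  by rewrite ltnS leq_subr.
rewrite big_mkcond /=; apply: eq_bigr => j _; rewrite ltnS.
case: leqP => [jlk|lkj]; last first.
  by rewrite (@bin_small l) ?mul0r ?mulr0// -ltn_subLR.
have -> : (l - (k + j) = l - k - j)%N by rewrite subnDA.
have e : ('C(l, k) * 'C(l - k, j) = 'C(l, k + j) * 'C(k + j, k))%N.
  have pos : (0 < k`! * j`! * (l - k - j)`!)%N by rewrite !muln_gt0 !fact_gt0.
  apply/eqP; rewrite -(eqn_pmul2r pos); apply/eqP.
  have e1 := bin_fact kl; have e2 := bin_fact jlk.
  have kjl : (k + j <= l)%N by rewrite -leq_subRL.
  have e3 := bin_fact kjl; have e4 := bin_fact (leq_addr j k).
  rewrite addKn in e4; rewrite subnDA in e3.
  transitivity (l`!); first by rewrite -e1 -e2; ring.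
  by rewrite -e3 -e4; ring.
rewrite (exprNn h) -[_ *+ 'C(_, _)]mulr_natl.
have := congr1 (fun a => a%:R : R) e; rewrite !natrM => e'.
rewrite [LHS](_ : _ = (-1) ^+ j * h ^+ j * v ^+ (l - k - j) *
  ('C(l, k)%:R * 'C(l - k, j)%:R)); last by ring.
by rewrite e'; ring.
Qed.

(** [h^k] times the left side is one term of the binomial expansion of [((1 + h) + h)^l]. *)
Lemma bpow_exp_le k l h : 0 < h -> bpow k l (1 + h) <= (h ^+ k)^-1 * (1 + h + h) ^+ l.
Proof.
move=> h0; rewrite /bpow; have [lk|kl] := ltnP l k.
  by rewrite bin_small// mul0r mulr_ge0 ?invr_ge0 ?exprn_ge0 ?addr_ge0 ?ltW.
rewrite ler_pdivlMl ?exprn_gt0// [(1 + h + h) ^+ l]exprDn (bigD1 (inord k : 'I_l.+1))//= inordK//.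
rewrite [leLHS](_ : _ = 'C(l, k)%:R * ((1 + h) ^+ (l - k) * h ^+ k)); last by ring.
rewrite -[X in _ <= X + _]mulr_natl lerDl sumr_ge0// => i _.
by rewrite mulrn_wge0// mulr_ge0 ?exprn_ge0 ?addr_ge0 ?ltW.
Qed.

(** The chord of the convex function [(1 + t)^L] over [[0, 1]]. *)
Lemma small_power_le L (t : R) : 0 <= t <= 1 -> (1 + t) ^+ L <= 1 + (2 ^+ L - 1) * t.
Proof.
move=> /andP[t0 t1]; elim: L => [|L IH]; first by rewrite !expr0 subrr mul0r addr0.
rewrite exprS; apply: (@le_trans _ _ ((1 + t) * (1 + (2 ^+ L - 1) * t))).
  by rewrite ler_wpM2l// addr_ge0.
have : (2 ^+ L - 1) * (t * t) <= (2 ^+ L - 1) * t.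
  rewrite ler_wpM2l ?ler_piMr// subr_ge0 -natrX ler1n expn_gt0//.
by rewrite exprS; lra.
Qed.

Lemma nneseries_finite (f : nat -> R) N : (forall j, 0 <= f j) ->
  (forall j, (N <= j)%N -> f j = 0) ->
  (\sum_(j <oo) (f j)%:E = (\sum_(j < N) f j)%:E)%E.
Proof.
move=> f0 fN; rewrite (nneseries_split 0 N)//; last by move=> k _; rewrite lee_fin.
rewrite add0n eseries0 ?adde0; last by move=> k Nk _; rewrite fN.
by rewrite sumEFin big_mkord.
Qed.

Lemma exp_binomial_series (w : R) l : 0 <= w ->
  (((1 + w) ^+ l)%:E = \sum_(k <oo) (w ^+ k * 'C(l, k)%:R)%:E)%E.
Proof.
move=> w0; rewrite (@nneseries_finite _ l.+1).
- rewrite exprDn; congr EFin; apply: eq_bigr => k _.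
  by rewrite expr1n mul1r mulr_natr.
- by move=> k; rewrite mulr_ge0 ?exprn_ge0.
- by move=> k lk; rewrite bin_small ?mulr0.
Qed.

(** The largest factor controls the product. This trades a joint exponential moment for moments at
    single sites, without independence. *)
Lemma prod_le_max_power (I : eqType) (s : seq I) (a : I -> R) :
  (forall y, 1 <= a y) -> \prod_(y <- s) a y <= 1 + \sum_(y <- s) a y ^+ size s.
Proof.
move=> a1; have a0 y : 0 <= a y by exact: le_trans (a1 y).
have [->|sn0] := eqVneq s [::]; first by rewrite !big_nil addr0.
suff [y ys h] : exists2 y, y \in s & \prod_(z <- s) a z <= a y ^+ size s.
  rewrite (le_trans h)// (big_rem y)//= addrCA lerDl addr_ge0// sumr_ge0// => z _.
  by rewrite exprn_ge0.
elim: s sn0 => // z s IH _; have [->|/IH[y ys h]] := eqVneq s [::].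
  by exists z; rewrite ?mem_head// big_seq1.
rewrite big_cons /=; have [zy|yz] := leP (a z) (a y).
  exists y; first by rewrite inE ys orbT.
  by rewrite exprS ler_pM// prodr_ge0.
exists z; first exact: mem_head.
rewrite exprS ler_wpM2l// (le_trans h)// lerXn2r// ?nnegrE//.
exact: ltW.
Qed.

End BinomialShift.

(* The integral of [site_gen u k] is a factorial moment at [u = 1] and a point
   probability at [u = 0].  Two measures with the same factorial moments agree
   at [u = 1], and agreement propagates down by steps of a fixed size [h]. *)
Section MomentDeterminacy.
Variables (R : realType) (S : countType) (m rho : R).
Hypothesis m_gt0 : 0 < m.
Hypothesis rho_ge0 : 0 <= rho.
Implicit Types (s : seq S) (u : S -> R) (k : S -> nat) (eta : config S).
Implicit Type mu : {measure set (config S) -> \bar R}.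

Definition bounded_moments mu := forall n (x : 'I_n -> S),
  (dual_moment m mu (occupation x) <= (rho ^+ n)%:E)%E.

(** Chosen so that [exp_gap * (1 + m / 2) * rho <= 1 / 2], the ratio of a geometric series. *)
Definition exp_gap : R := (2 * (1 + rho) * (1 + m / 2))^-1.

Lemma exp_gap_gt0 : 0 < exp_gap.
Proof.
rewrite invr_gt0; apply: mulr_gt0; last by rewrite addr_gt0// divr_gt0.
by rewrite mulr_gt0// ltr_pwDl.
Qed.

(** The binomial expansion of the power gives factorial moments; the [k]-th is at most
    [((1 + m / 2) rho)^k] by [Gamma_addn_le], and [exp_gap] makes the series geometric. *)
Lemma exp_moment_le mu x : bounded_moments mu ->
  (\int[mu]_eta ((1 + exp_gap) ^+ (eta x))%:E <= 2%:E)%E.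
Proof.
move=> hmu; have g0 := ltW exp_gap_gt0.
under eq_integral do rewrite exp_binomial_series//.
rewrite integral_nneseries//; first last.
- by move=> k eta _; rewrite lee_fin mulr_ge0 ?exprn_ge0.
- by move=> k; exact: (measurable_fun_coord (fun l => (exp_gap ^+ k * 'C(l, k)%:R)%:E) x).
have m2 : 0 < m / 2 by rewrite divr_gt0.
apply: lime_le.
  apply: is_cvg_nneseries => k _ _; apply: integral_ge0 => eta _.
  by rewrite lee_fin mulr_ge0 ?exprn_ge0.
apply: nearW => N.
apply: (@le_trans _ _ (\sum_(0 <= k < N) ((1 / 2) ^+ k)%:E)%E); last first.
  rewrite sumEFin lee_fin; apply: (@le_trans _ _ (2 - 2 * (1 / 2) ^+ N)); last first.
    by rewrite gerBl mulr_ge0// exprn_ge0// divr_ge0.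
  elim: N => [|N IH]; first by rewrite big_geq// expr0 mulr1 subrr.
  by rewrite big_nat_recr//= exprS; move: IH; lra.
apply: lee_sum => k _.
under eq_integral do rewrite (duality_factor_bin m_gt0) -(D_site m_gt0) mulrCA mulrC EFinM.
have Gc : 0 <= Gamma (m / 2 + k%:R) / Gamma (m / 2) / k`!%:R.
  apply: divr_ge0 => //; apply: divr_ge0; apply: ltW; last exact: (Gamma_gt0 m2).
  exact: (Gamma_shift_gt0 m_gt0).
have cle : Gamma (m / 2 + k%:R) / Gamma (m / 2) / k`!%:R <= (1 + m / 2) ^+ k.
  by rewrite ler_pdivrMr ?ltr0n ?fact_gt0//; exact: Gamma_addn_le.
set c := Gamma (m / 2 + k%:R) / _ / _ in Gc cle *.
have gc0 : 0 <= exp_gap ^+ k * c by rewrite mulr_ge0 ?exprn_ge0.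
rewrite ge0_integralZl_EFin//; first last.
- by apply/measurable_EFinP; exact: measurable_D.
- by move=> eta _; rewrite lee_fin D_ge0.
apply: (@le_trans _ _ ((exp_gap ^+ k * c)%:E * (rho ^+ k)%:E)%E).
  by rewrite lee_wpmul2l// ?lee_fin// hmu.
rewrite -EFinM lee_fin -mulrA.
apply: (@le_trans _ _ (exp_gap ^+ k * ((1 + m / 2) ^+ k * rho ^+ k))).
  by rewrite ler_wpM2l ?exprn_ge0// ler_wpM2r ?exprn_ge0.
rewrite -!exprMn lerXn2r// ?nnegrE ?divr_ge0// ?mulr_ge0 ?addr_ge0 ?(ltW m2)//.
rewrite /exp_gap ler_pdivrMl; last first.
  by apply: mulr_gt0; [rewrite mulr_gt0// ltr_pwDl|rewrite addr_gt0].
have : 0 <= (1 + m / 2) * 1 by rewrite mulr1 addr_ge0// ltW.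
set b := 1 + m / 2; lra.
Qed.

Definition site_gen s u k eta : R := \prod_(y <- s) bpow (k y) (eta y) (u y).

Lemma site_gen_ge0 s u k eta : (forall y, 0 <= u y) -> 0 <= site_gen s u k eta.
Proof. by move=> u0; apply: prodr_ge0 => y _; exact: bpow_ge0. Qed.

Lemma measurable_site_gen s u k : measurable_fun setT (site_gen s u k).
Proof.
elim: s => [|y s IH].
  rewrite (_ : site_gen _ _ _ = cst 1); first exact: measurable_cst.
  by apply/funext => eta; rewrite /site_gen big_nil.
rewrite (_ : site_gen _ _ _ = (fun eta => bpow (k y) (eta y) (u y) * site_gen s u k eta)).
  by apply: measurable_funM => //; exact: (measurable_fun_coord (fun l => bpow (k y) l (u y))).
by apply/funext => eta; rewrite /site_gen big_cons.
Qed.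

(** In [1 + h + h] the second [h] pays for the binomial coefficients in [bpow_exp_le]; the power
    [size s] pays for replacing a product over sites by a sum. *)
Lemma site_gen_bound s u k (h : R) eta : 0 < h -> (forall y, 0 <= u y <= 1 + h) ->
  (1 + h + h) ^+ size s <= 1 + exp_gap ->
  site_gen s u k eta <= (\prod_(y <- s) (h ^+ k y)^-1) *
    (1 + \sum_(y <- s) (1 + exp_gap) ^+ eta y).
Proof.
move=> h0 uh hs.
have w1 : 1 <= 1 + h + h by lra.
apply: (@le_trans _ _ (\prod_(y <- s) ((h ^+ k y)^-1 * (1 + h + h) ^+ eta y))).
  apply: ler_prod => y _; have /andP[u0 u1] := uh y.
  by rewrite bpow_ge0//= (le_trans (bpow_le _ _ u0 u1))// bpow_exp_le.
rewrite big_split /= ler_wpM2l//.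
  by apply: prodr_ge0 => y _; rewrite invr_ge0 exprn_ge0// ltW.
apply: (le_trans (prod_le_max_power s (a := fun y => (1 + h + h) ^+ eta y) _)).
  by move=> y; exact: exprn_ege1.
rewrite lerD2l; apply: ler_sum => y _; rewrite -exprM mulnC exprM.
by rewrite lerXn2r ?nnegrE ?exprn_ge0 ?addr_ge0 ?(ltW exp_gap_gt0)// ltW.
Qed.

Lemma site_gen_fin mu s u k (h : R) : bounded_moments mu -> mu setT = 1%E ->
  0 < h -> (forall y, 0 <= u y <= 1 + h) -> (1 + h + h) ^+ size s <= 1 + exp_gap ->
  (\int[mu]_eta (site_gen s u k eta)%:E < +oo)%E.
Proof.
move=> hmu mu1 h0 uh hs.
set A := \prod_(y <- s) (h ^+ k y)^-1.
have A0 : 0 <= A by apply: prodr_ge0 => y _; rewrite invr_ge0 exprn_ge0// ltW.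
have g0 : 0 <= 1 + exp_gap by rewrite addr_ge0// ltW// exp_gap_gt0.
have mE y : measurable_fun setT (fun eta : config S => ((1 + exp_gap) ^+ eta y)%:E).
  exact: (measurable_fun_coord (fun l => ((1 + exp_gap) ^+ l)%:E)).
apply: (@le_lt_trans _ _ (\int[mu]_eta (A%:E * (1 + \sum_(y <- s) ((1 + exp_gap) ^+ eta y)%:E)))%E).
  apply: ge0_le_integral => //.
  - by move=> eta _; rewrite lee_fin site_gen_ge0// => y; have /andP[] := uh y.
  - by apply/measurable_EFinP; exact: measurable_site_gen.
  - apply: measurable_funeM; apply: emeasurable_funD => //.
    exact: emeasurable_sum.
  - by move=> eta _; rewrite sumEFin -EFinD -EFinM lee_fin site_gen_bound.
rewrite ge0_integralZl_EFin//; first last.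
- by apply: emeasurable_funD => //; exact: emeasurable_sum.
- by move=> eta _; rewrite sumEFin -EFinD lee_fin addr_ge0// sumr_ge0// => y _; rewrite exprn_ge0.
rewrite ge0_integralD//; first last.
- exact: emeasurable_sum.
- by move=> eta _; rewrite sumEFin lee_fin sumr_ge0// => y _; rewrite exprn_ge0.
rewrite integral_cst// mul1e mu1 ge0_integral_sum//; last first.
  by move=> y eta _; rewrite lee_fin exprn_ge0.
rewrite lte_mul_pinfty ?lee_fin// lte_add_pinfty ?ltry//.
apply: lte_sum_pinfty => y _; rewrite (le_lt_trans (exp_moment_le _ hmu))//.
exact: ltry.
Qed.

Definition upd (T : Type) (u : S -> T) x v : S -> T := fun y => if y == x then v else u y.

Lemma site_gen_split s u k x eta : uniq s -> x \in s ->
  site_gen s u k eta = bpow (k x) (eta x) (u x) *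
    \prod_(y <- s | y != x) bpow (k y) (eta y) (u y).
Proof. by move=> us xs; rewrite /site_gen (bigD1_seq x). Qed.

Lemma site_gen_upd s u k x v i eta : uniq s -> x \in s ->
  site_gen s (upd u x v) (upd k x i) eta = bpow i (eta x) v *
    \prod_(y <- s | y != x) bpow (k y) (eta y) (u y).
Proof.
move=> us xs; rewrite (site_gen_split _ _ _ us xs) /upd eqxx; congr (_ * _).
by apply: eq_bigr => y /negbTE ->.
Qed.

Lemma upd_same (T : Type) (u : S -> T) x : upd u x (u x) = u.
Proof. by apply/funext => y; rewrite /upd; case: eqP => [->|]. Qed.

Definition same_gen mu1 mu2 s u := forall k,
  (\int[mu1]_eta (site_gen s u k eta)%:E = \int[mu2]_eta (site_gen s u k eta)%:E)%E.

(* Expanding at [u x - h] alternates in sign; moving the odd terms to the other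
   side leaves nonnegative series, to which Tonelli applies. *)
Lemma same_gen_step mu1 mu2 s u x (h : R) :
  bounded_moments mu1 -> mu1 setT = 1%E -> bounded_moments mu2 -> mu2 setT = 1%E ->
  uniq s -> x \in s -> 0 < h -> (1 + h + h) ^+ size s <= 1 + exp_gap ->
  (forall y, 0 <= u y <= 1) -> h <= u x ->
  same_gen mu1 mu2 s u -> same_gen mu1 mu2 s (upd u x (u x - h)).
Proof.
move=> b1 m1 b2 m2 us xs h0 hs u01 hu E k.
pose a j eta : R := 'C(k x + j, k x)%:R * h ^+ j * site_gen s u (upd k x (k x + j)%N) eta.
have u0 y : 0 <= u y by have /andP[] := u01 y.
have a0 j eta : 0 <= a j eta by rewrite !mulr_ge0 ?exprn_ge0 ?(ltW h0)// site_gen_ge0.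
have ma j : measurable_fun setT (fun eta => (a j eta)%:E).
  apply/measurable_EFinP; apply: measurable_funM => //; exact: measurable_site_gen.
(* Splits the Taylor expansion at [u x - h] by parity into two nonnegative series. *)
pose sel b j eta : R := if odd j == b then a j eta else 0.
have sel0 b j eta : 0 <= sel b j eta by rewrite /sel; case: ifP.
have msel b j : measurable_fun setT (fun eta => (sel b j eta)%:E).
  by rewrite /sel; case: (odd j == b); [exact: ma|exact: measurable_cst].
pose part b eta := (\sum_(j <oo) (sel b j eta)%:E)%E.
have part0 b eta : (0 <= part b eta)%E by apply: nneseries_ge0 => j _ _; rewrite lee_fin.
have mpart b : measurable_fun setT (part b).
  by apply: ge0_emeasurable_sum => // j eta _ _; rewrite lee_fin.
have partE b eta : part b eta = (\sum_(j < (eta x).+1) sel b j eta)%:E.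
  apply: nneseries_finite => // j jl; rewrite /sel; case: ifP => // _.
  rewrite /a (site_gen_split _ _ _ us xs) /upd eqxx /bpow (@bin_small (eta x)) ?mul0r ?mulr0//.
  by rewrite (leq_trans jl)// leq_addl.
have aE j eta : a j eta = 'C(k x + j, k x)%:R * h ^+ j * bpow (k x + j) (eta x) (u x) *
    \prod_(y <- s | y != x) bpow (k y) (eta y) (u y).
  by rewrite /a -[X in site_gen s X](upd_same u x) site_gen_upd// mulrA.
have shift eta : ((site_gen s (upd u x (u x - h)) k eta)%:E + part true eta =
    part false eta)%E.
  rewrite !partE -EFinD; congr EFin.
  rewrite -[in LHS](upd_same k x) site_gen_upd// bpow_shift mulr_suml -big_split /=.
  apply: eq_bigr => j _; rewrite /sel aE -signr_odd; case: (odd j) => /=.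
    by rewrite expr1; ring.
  by rewrite expr0; ring.
(* At [u x + h] all Taylor terms enter with a plus sign, so that value dominates the odd part and
   makes its integral finite; hence the margin [1 + h] in [site_gen_fin]. *)
have odd_le eta : (part true eta <= (site_gen s (upd u x (u x + h)) k eta)%:E)%E.
  rewrite partE lee_fin -[in leRHS](upd_same k x) site_gen_upd//.
  rewrite -[in u x + h](opprK h) bpow_shift mulr_suml; apply: ler_sum => j _.
  rewrite [leRHS](_ : _ = a j eta); first by rewrite /sel; case: ifP.
  by rewrite aE (exprNn h) -signr_odd; case: (odd j); rewrite ?expr1 ?expr0; ring.
have int_part mu b : (\int[mu]_eta part b eta = \sum_(j <oo) if odd j == b then
    ('C(k x + j, k x)%:R * h ^+ j)%:E *
    \int[mu]_eta (site_gen s u (upd k x (k x + j)%N) eta)%:E else 0)%E.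
  rewrite integral_nneseries//; last by move=> j eta _; rewrite lee_fin.
  apply: eq_eseriesr => j _; rewrite /sel; case: ifP => _; last by rewrite integral0.
  under eq_integral do rewrite /a EFinM.
  rewrite ge0_integralZl_EFin//.
  - by move=> eta _; rewrite lee_fin site_gen_ge0.
  - by apply/measurable_EFinP; exact: measurable_site_gen.
  - by rewrite mulr_ge0// exprn_ge0// ltW.
have same_part b : (\int[mu1]_eta part b eta = \int[mu2]_eta part b eta)%E.
  rewrite !int_part; apply: eq_eseriesr => j _; case: ifP => // _.
  by rewrite E.
have odd_fin mu : bounded_moments mu -> mu setT = 1%E ->
    (\int[mu]_eta part true eta \is a fin_num)%E.
  move=> bmu mu1'; rewrite ge0_fin_numE; last exact: integral_ge0.
  have u'01 y : 0 <= upd u x (u x + h) y <= 1 + h.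
    have /andP[uy0 uy1] := u01 y; have /andP[ux0 ux1] := u01 x.
    by rewrite /upd; case: eqP => _; lra.
  apply: (le_lt_trans _ (site_gen_fin k bmu mu1' h0 u'01 hs)).
  apply: ge0_le_integral => //.
  by apply/measurable_EFinP; exact: measurable_site_gen.
have u''0 y : 0 <= upd u x (u x - h) y.
  by rewrite /upd; case: eqP => // _; rewrite subr_ge0.
have eqn mu : (\int[mu]_eta (site_gen s (upd u x (u x - h)) k eta)%:E +
    \int[mu]_eta part true eta = \int[mu]_eta part false eta)%E.
  rewrite -ge0_integralD//.
  - by apply: eq_integral => eta _; exact: shift.
  - by move=> eta _; rewrite lee_fin site_gen_ge0.
  - by apply/measurable_EFinP; exact: measurable_site_gen.
have fin2 := odd_fin _ b2 m2.
rewrite -[LHS](addeK _ fin2) -[RHS](addeK _ fin2) -{1}(same_part true).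
by rewrite !eqn same_part.
Qed.

(** The step is the inverse of an integer, so that a whole number of steps leads from 1 exactly to
    0. *)
Lemma small_step L : exists2 q, (0 < q)%N & (1 + q%:R^-1 + q%:R^-1) ^+ L <= 1 + exp_gap.
Proof.
have g0 := exp_gap_gt0.
(* The first bound brings [2 / q] under 1, as [small_power_le] requires; the second brings
   [2^L * 2 / q] under [exp_gap]. *)
pose c : R := Num.max 2 (2 * 2 ^+ L / exp_gap).
have c2 : 2 <= c by rewrite le_max lexx.
have cg : 2 * 2 ^+ L / exp_gap <= c by rewrite le_max lexx orbT.
have c0 : 0 < c by rewrite (lt_le_trans _ c2).
have cq : c < (Num.bound c)%:R by rewrite archi_boundP// ltW.
exists (Num.bound c); first by rewrite -(ltr_nat R) (lt_trans c0).
have q0 := lt_trans c0 cq.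
set q : R := _%:R in q0 cq *.
rewrite -addrA (le_trans (small_power_le _ _))//.
  apply/andP; split; first by rewrite addr_ge0// invr_ge0 ltW.
  rewrite [leLHS](_ : _ = 2 / q); last by ring.
  by rewrite ler_pdivrMr// mul1r (le_trans c2)// ltW.
rewrite lerD2l (@le_trans _ _ (2 ^+ L * (q^-1 + q^-1)))//.
  by rewrite ler_wpM2r ?gerBl// addr_ge0// invr_ge0 ltW.
rewrite [leLHS](_ : _ = 2 * 2 ^+ L / q); last by ring.
rewrite ler_pdivrMr// [leRHS]mulrC -ler_pdivrMr//.
by rewrite (le_trans cg)// ltW.
Qed.

Section TwoMeasures.
Variables mu1 mu2 : {measure set (config S) -> \bar R}.
Hypotheses (bmu1 : bounded_moments mu1) (mass1 : mu1 setT = 1%E).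
Hypotheses (bmu2 : bounded_moments mu2) (mass2 : mu2 setT = 1%E).
Hypothesis same_moments : forall n (x : 'I_n -> S),
  dual_moment m mu1 (occupation x) = dual_moment m mu2 (occupation x).

(** At [u = 1] the product of binomials is a constant times [D] of the configuration equal to [k] on
    [s] and empty elsewhere. *)
Lemma same_gen1 s : uniq s -> same_gen mu1 mu2 s (fun=> 1).
Proof.
move=> us k; pose xi y := if y \in s then k y else 0%N.
have fxi : finite_config xi.
  apply: (@sub_finite_set _ _ [set y | y \in s]); last exact: finite_seq.
  by move=> y /=; rewrite /xi; case: ifP.
have [r er] := finite_config_occupation fxi.
pose c := \prod_(y <- s) (Gamma (m / 2 + (k y)%:R) / Gamma (m / 2) / (k y)`!%:R).
have c0 : 0 <= c.
  apply: prodr_ge0 => y _; apply: divr_ge0 => //; apply: divr_ge0; apply: ltW.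
    exact: (Gamma_shift_gt0 m_gt0).
  by apply: Gamma_gt0; rewrite divr_gt0.
have genE eta : (site_gen s (fun=> 1) k eta)%:E = (c%:E * (D m (occupation (tnth (in_tuple r))) eta)%:E)%E.
  rewrite -er (@D_seq _ _ _ m_gt0 xi eta s us); last by move=> y ys; rewrite /xi (negbTE ys).
  rewrite -EFinM mulrC -big_split /=; congr EFin; apply: eq_big_seq => y ys.
  by rewrite bpow1 /xi ys (duality_factor_bin m_gt0).
have int mu : (\int[mu]_eta (site_gen s (fun=> 1) k eta)%:E =
    c%:E * dual_moment m mu (occupation (tnth (in_tuple r))))%E.
  under eq_integral do rewrite genE.
  rewrite ge0_integralZl_EFin//.
  - by move=> eta _; rewrite lee_fin D_ge0.
  - by apply/measurable_EFinP; exact: measurable_D.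
by rewrite !int same_moments.
Qed.

(** Descent on the grid of points [i / q]: each point comes from a neighbour by lowering one
    coordinate by [1 / q], and the induction is on the distance to the corner equal to 1 on [s]. *)
Lemma same_gen0 s : uniq s -> same_gen mu1 mu2 s (fun=> 0).
Proof.
move=> us; have [q q0 hq] := small_step (size s).
have q0R : 0 < q%:R :> R by rewrite ltr0n.
suff grid i : (forall y, (i y <= q)%N) -> same_gen mu1 mu2 s (fun y => (i y)%:R / q%:R).
  rewrite (_ : (fun=> 0) = (fun y : S => 0%N%:R / q%:R)); first exact: (grid (fun=> 0%N)).
  by apply/funext => y; rewrite mul0r.
have [N] := ubnP (\sum_(y <- s) (q - i y))%N; elim: N i => // N IH i iN iq.
have [/hasP[x xs ix]|/hasPn full] := boolP (has (fun x => i x < q)%N s); last first.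
  have e mu k : (\int[mu]_eta (site_gen s (fun y => (i y)%:R / q%:R) k eta)%:E =
      \int[mu]_eta (site_gen s (fun=> 1) k eta)%:E)%E.
    apply: eq_integral => eta _; congr EFin; apply: eq_big_seq => y ys.
    have /full := ys; rewrite -leqNgt => qi.
    have -> : i y = q by apply/eqP; rewrite eqn_leq iq.
    by rewrite divff// gt_eqF.
  by move=> k; rewrite !e same_gen1.
pose i' := upd i x (i x).+1.
have i'q y : (i' y <= q)%N by rewrite /i' /upd; case: eqP.
have i'N : (\sum_(y <- s) (q - i' y) < N)%N.
  rewrite -ltnS (leq_trans _ iN)// ltnS (bigD1_seq x)//= [in leqRHS](bigD1_seq x)//=.
  rewrite (eq_bigr (fun y => q - i y)%N) => [|y /negbTE yx]; last by rewrite /i' /upd yx.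
  by rewrite ltn_add2r /i' /upd eqxx ltn_sub2l.
have := IH i' i'N i'q.
set u := fun y => _ => E.
have -> : (fun y => (i y)%:R / q%:R) = upd u x (u x - q%:R^-1) :> (S -> R).
  apply/funext => y; rewrite /upd /u /i' /upd eqxx; case: eqP => [->//|//].
  by rewrite -natr1 mulrDl mul1r addrK.
apply: same_gen_step => //.
- by rewrite invr_gt0.
- by move=> y; rewrite divr_ge0//= ler_pdivrMr// mul1r ler_nat.
- by rewrite /u /i' /upd eqxx -natr1 mulrDl mul1r lerDr divr_ge0.
Qed.

Lemma measurable_cylinder s k :
  measurable ([set eta | forall y, y \in s -> eta y = k y] : set (config S)).
Proof.
rewrite (_ : [set _ | _] = \bigcap_y [set eta : config S | [set l | y \in s -> l = k y] (eta y)]).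
  by apply: countable_bigcap_measurable => y; exact: measurable_coord.
by apply/seteqP; split => [eta h y _ /=|eta h y]; [exact: h|exact: (h y I)].
Qed.

Lemma same_cylinders s k : uniq s ->
  mu1 [set eta | forall y, y \in s -> eta y = k y] =
  mu2 [set eta | forall y, y \in s -> eta y = k y].
Proof.
move=> us; set A := [set eta : config S | _].
have mA : measurable A by exact: measurable_cylinder.
(* At [u = 0] each factor is the indicator of [eta y = k y]. *)
have AE eta : (site_gen s (fun=> 0) k eta)%:E = (\1_A eta)%:E :> \bar R.
  congr EFin; rewrite /site_gen indicE; have [/set_mem h|/negP h] := boolP (eta \in A).
    by rewrite big1_seq// => y /= ys; rewrite bpow0 h// eqxx.
  have [/allP a|/allPn[y ys yk]] := boolP (all (fun y => eta y == k y) s).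
    by case: h; apply/mem_set => y /a /eqP.
  by rewrite (big_rem y)//= bpow0 (negbTE yk) mul0r.
have int (mu : {measure set (config S) -> \bar R}) : (\int[mu]_eta (site_gen s (fun=> 0) k eta)%:E = mu A)%E.
  under eq_integral do rewrite AE.
  by rewrite integral_indic// setIT.
by rewrite -!int same_gen0.
Qed.

Lemma same_measure (A : set (config S)) : measurable A -> mu1 A = mu2 A.
Proof.
(* Adding the empty set makes the cylinders stable under intersection, since two incompatible ones
   are disjoint. *)
pose G : set (set (config S)) := [set B | B = set0 \/ exists s k,
  B = [set eta | forall y : S, y \in s -> eta y = k y]].
have GT : G setT by right; exists [::], (fun=> 0%N); apply/esym/seteqP; split.
have same B : G B -> mu1 B = mu2 B.
  move=> [->|[s [k ->]]]; first by rewrite !measure0.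
  have := same_cylinders k (undup_uniq s).
  rewrite (_ : [set eta | _] = [set eta : config S | forall y, y \in s -> eta y = k y])//.
  by apply/seteqP; split => eta h y ys; apply: h; move: ys; rewrite mem_undup.
have GI : setI_closed G.
  move=> B C [->|[s [k ->]]]; first by rewrite set0I; left.
  move=> [->|[r [l ->]]]; first by rewrite setI0; left.
  have [/allP h|/allPn[y yr]] := boolP (all (fun y => (y \in s) ==> (k y == l y)) r).
    right; exists (s ++ r), (fun y => if y \in s then k y else l y).
    apply/seteqP; split => [eta [h1 h2] y|eta h12].
      by rewrite mem_cat; case: ifP => [ys _|_ /= yr]; [exact: h1|exact: h2].
    split=> y yy; first by rewrite h12 ?mem_cat ?yy.
    rewrite h12 ?mem_cat ?yy ?orbT//; case: ifP => // ys.
    by have := h _ yy; rewrite ys => /eqP.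
  rewrite negb_imply => /andP[ys /eqP kl]; left; apply/seteqP; split => // eta [h1 h2].
  by apply: kl; rewrite -h1// h2.
have sub : G `<=` measurable.
  by move=> B [->|[s [k ->]]]; [exact: measurable0|exact: measurable_cylinder].
move=> mA; apply: (@g_sigma_algebra_measure_unique _ R _ G sub (fun=> setT)) => //.
- by rewrite bigcup_const.
- by move=> _; rewrite mass1 ltry.
apply: sub_sigma_algebra2 mA => _ [[y l] _ <-]; right; exists [:: y], (fun=> l).
by apply/seteqP; split => [eta /= e z|eta h] /=; [rewrite inE => /eqP ->|rewrite h ?mem_head].
Qed.

End TwoMeasures.

End MomentDeterminacy.
(** * Moments of product measures *)

Section ProductMeasure.
Variables (R : realType) (S : countType) (m : R).
Hypothesis m_gt0 : 0 < m.
Variable nu : probability (config S) R.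
Hypothesis nuP : product_measure nu.
Hypothesis nu_fin : forall y, (\int[nu]_eta (eta y)%:R%:E)%E \is a fin_num.
Implicit Types (s : seq S) (B : S -> set nat).

Lemma measurable_box s B :
  measurable ([set eta | forall y, y \in s -> B y (eta y)] : set (config S)).
Proof.
rewrite (_ : [set _ | _] = \bigcap_y [set eta : config S | [set l | y \in s -> B y l] (eta y)]).
  by apply: countable_bigcap_measurable => y; exact: measurable_coord.
by apply/seteqP; split => [eta h y _ /=|eta h y]; [exact: h|exact: (h y I)].
Qed.

Lemma measurable_site_prod s :
  measurable_fun setT (fun eta : config S => \prod_(y <- s) (eta y)%:R : R).
Proof.
elim: s => [|y s IH].
  rewrite (_ : (fun eta => _) = cst 1); first exact: measurable_cst.
  by apply/funext => eta; rewrite big_nil.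
rewrite (_ : (fun eta => _) = (fun eta : config S => (eta y)%:R * \prod_(z <- s) (eta z)%:R : R)).
  by apply: measurable_funM => //; exact: (measurable_fun_coord (fun l => l%:R : R)).
by apply/funext => eta; rewrite big_cons.
Qed.

Lemma natr_series (l : nat) :
  (l%:R%:E = \sum_(j <oo) ((j < l)%N%:R : R)%:E)%E.
Proof.
rewrite (@nneseries_finite _ _ l) => [|j|j lj]; first last.
- by rewrite ltnNge lj.
- by [].
rewrite (eq_bigr (fun=> 1)) => [|j _]; first by rewrite sumr_const card_ord.
by rewrite ltn_ord.
Qed.

(** [product_measure] speaks of boxes only. Writing [eta y] as the sum over [j] of the indicators of
    [j < eta y] moves the site [y] from the moment part [s1] to the box part [s2]. *)
Lemma product_moment_seq s1 s2 B : uniq (s1 ++ s2) ->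
  (\int[nu]_eta (\prod_(y <- s1) (eta y)%:R *
     \1_[set eta : config S | forall y, y \in s2 -> B y (eta y)] eta)%:E =
   (\prod_(y <- s1) \int[nu]_eta (eta y)%:R%:E) *
   \prod_(y <- s2) nu [set eta | B y (eta y)])%E.
Proof.
have [rho rhoE] := nuP.
have marg B' y : nu [set eta : config S | B' y (eta y)] = rho y (B' y).
  have := rhoE [:: y] B' isT; rewrite big_seq1 => <-; congr (nu _).
  apply/seteqP; split => eta /= h; last by apply: h; rewrite mem_head.
  by move=> x; rewrite inE => /eqP ->.
have mp := measurable_site_prod.
elim: s1 s2 B => [|y s1 IH] s2 B us.
  under eq_integral do rewrite big_nil mul1r.
  rewrite integral_indic//; last exact: measurable_box.
  rewrite setIT big_nil mul1e rhoE//.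
  by apply: eq_bigr => y _; rewrite marg.
pose B' j z : set nat := if z == y then [set l | (j < l)%N] else B z.
have ys2 : y \notin s2 by move: us; rewrite /= mem_cat negb_or => /andP[/andP[]].
have ys1 : uniq (s1 ++ y :: s2) by rewrite (uniq_catCA s1 [:: y] s2).
have term j eta : (\prod_(z <- s1) (eta z)%:R *
    \1_[set eta : config S | forall z, z \in y :: s2 -> B' j z (eta z)] eta =
    (j < eta y)%N%:R * (\prod_(z <- s1) (eta z)%:R *
     \1_[set eta : config S | forall z, z \in s2 -> B z (eta z)] eta) :> R).
  rewrite mulrCA; congr (_ * _); rewrite !indicE.
  have -> : (eta \in [set eta : config S | forall z, z \in y :: s2 -> B' j z (eta z)]) =
     (j < eta y)%N && (eta \in [set eta : config S | forall z, z \in s2 -> B z (eta z)]).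
    apply/idP/andP => [/set_mem h|[jy /set_mem h]].
      split; first by have := h y (mem_head _ _); rewrite /B' eqxx.
      apply/mem_set => z zs; have := h z; rewrite inE zs orbT => /(_ isT).
      by rewrite /B'; case: eqP => // zy; rewrite -zy zs in ys2.
    apply/mem_set => z; rewrite inE /B'; case: eqP => [->//|_ /= zs]; exact: h.
  by rewrite -mulnb natrM.
have mt j : measurable_fun setT (fun eta : config S => (\prod_(z <- s1) (eta z)%:R *
    \1_[set eta : config S | forall z, z \in y :: s2 -> B' j z (eta z)] eta : R)%:E).
  apply/measurable_EFinP; apply: measurable_funM => //.
  apply: measurable_indic; exact: measurable_box.
have t0 j (eta : config S) : (0 <= (\prod_(z <- s1) (eta z)%:R *
    \1_[set eta : config S | forall z, z \in y :: s2 -> B' j z (eta z)] eta : R)%:E)%E.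
  by rewrite lee_fin mulr_ge0 ?prodr_ge0// indicE.
transitivity (\int[nu]_eta \sum_(j <oo) (\prod_(z <- s1) (eta z)%:R *
    \1_[set eta : config S | forall z, z \in y :: s2 -> B' j z (eta z)] eta : R)%:E)%E.
  apply: eq_integral => eta _; under eq_eseriesr do rewrite term mulrC EFinM.
  rewrite nneseriesZl => [|j _]; last by rewrite lee_fin.
  by rewrite -natr_series -EFinM big_cons; congr EFin; ring.
rewrite integral_nneseries//.
pose c := fine ((\prod_(z <- s1) \int[nu]_eta (eta z)%:R%:E) *
  \prod_(z <- s2) nu [set eta | B z (eta z)])%E.
have e2 j : (\int[nu]_eta (\prod_(z <- s1) (eta z)%:R *
    \1_[set eta : config S | forall z, z \in y :: s2 -> B' j z (eta z)] eta : R)%:E =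
    c%:E * nu [set eta | (j < eta y)%N])%E.
  rewrite IH// [X in (_ * X)%E]big_cons {1}/B' eqxx /c fineK//; last first.
    by rewrite fin_numM// prode_fin_num// => z _; exact: fin_num_measure (measurable_coord _ _).
  rewrite muleCA muleC; congr (_ * _ * _)%E.
  apply: eq_big_seq => z zs; congr (nu _); rewrite /B'.
  by case: eqP => // zy; rewrite -zy zs in ys2.
under eq_eseriesr => j _ do rewrite e2.
rewrite nneseriesZl//.
have e3 : (\int[nu]_eta (eta y)%:R%:E = \sum_(j <oo) nu [set eta | (j < eta y)%N])%E.
  under eq_integral do rewrite natr_series.
  rewrite integral_nneseries//; last first.
    by move=> j; exact: (measurable_fun_coord (fun l => ((j < l)%N%:R : R)%:E)).
  apply: eq_eseriesr => j _.
  rewrite -(setIT [set eta : config S | (j < eta y)%N]) -integral_indic//; last first.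
    exact: (measurable_coord y [set l | (j < l)%N]).
  apply: eq_integral => eta _; rewrite indicE; congr (nat_of_bool _)%:R%:E.
  by apply/idP/idP => [/mem_set|/set_mem].
rewrite -e3 big_cons /c fineK; first by rewrite muleC muleA.
by rewrite fin_numM// prode_fin_num// => z _; exact: fin_num_measure (measurable_coord _ _).
Qed.

Lemma product_moment n (x : 'I_n -> S) : injective x ->
  dual_moment m nu (occupation x) =
  (\prod_i dual_moment m nu (occupation (fun _ : 'I_1 => x i)))%E.
Proof.
move=> xinj; have m2 : 0 <= 2 / m by rewrite divr_ge0// ltW.
have one y : (dual_moment m nu (occupation (fun _ : 'I_1 => y)) =
    (2 / m)%:E * \int[nu]_eta (eta y)%:R%:E)%E.
  rewrite -ge0_integralZl_EFin//; last exact: (measurable_fun_coord (fun l => (l%:R : R)%:E)).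
  by apply: eq_integral => eta _; rewrite D_site// duality_factor1// mulrC EFinM.
under [RHS]eq_bigr do rewrite one.
have us : uniq (codom x ++ [::]) by rewrite cats0 map_inj_uniq ?enum_uniq.
have := product_moment_seq (fun=> setT) us.
rewrite big_nil mule1 => e.
transitivity (((2 / m) ^+ n)%:E * \prod_(y <- codom x) \int[nu]_eta (eta y)%:R%:E)%E.
  rewrite -e -ge0_integralZl_EFin ?exprn_ge0//.
  - apply: eq_integral => eta _; rewrite -EFinM D_injective// big_split /=; congr EFin.
    rewrite indicE mem_set// mulr1 mulrC prodr_const card_ord; congr (_ * _).
    by rewrite /codom /image_mem big_map big_enum.
  - by move=> eta _; rewrite lee_fin mulr_ge0 ?prodr_ge0// indicE.
  - apply/measurable_EFinP; apply: measurable_funM; first exact: measurable_site_prod.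
    by apply: measurable_indic; exact: (measurable_box [::] (fun=> setT)).
rewrite big_split /= /codom /image_mem big_map big_enum /=; congr (_ * _)%E.
by rewrite prodEFin prodr_const card_ord.
Qed.

End ProductMeasure.
(** * Finite site sets and finite range *)

Lemma esum_finType (R : realType) (T : finType) (a : T -> R) :
  (forall x, 0 <= a x) -> (\esum_(x in [set: T]) (a x)%:E = (\sum_x a x)%:E)%E.
Proof.
move=> a0; rewrite esum_fset; [|exact: finite_finset|by move=> x _; rewrite lee_fin].
rewrite (@fsbigE _ _ _ _ _ (index_enum T))//=; first last.
- by move=> y _; rewrite mem_index_enum.
- exact: index_enum_uniq.
by under eq_bigl do rewrite in_setT; rewrite sumEFin.
Qed.

Section FiniteSites.
Variables (R : realType) (T : finType) (p : T -> T -> R) (m : R).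
Hypothesis m_gt0 : 0 < m.
Hypothesis p_ge0 : forall x y, 0 <= p x y.
Hypothesis p_sum1 : forall x, \sum_y p x y = 1.

Local Notation L := (@rw_generator R T p m).
Local Notation Q := (@transition R T T (fun y x => p x y) (fun y _ => y)).
Let c_ge0 (y x : T) : 0 <= p x y. Proof. exact: p_ge0. Qed.

Lemma rw_generatorE (f : T -> R) x : L f x = 2 * m * (Q f x - f x).
Proof.
rewrite /rw_generator /transition (@fsbigE _ _ _ _ _ (index_enum T))//=; first last.
- by move=> y _; rewrite mem_index_enum.
- exact: index_enum_uniq.
under eq_bigl do rewrite in_setT.
rewrite -[X in _ - X]mul1r -(p_sum1 x) mulr_suml -sumrB mulr_sumr.
by apply: eq_bigr => y _; ring.
Qed.

Lemma chain_prob_sum1 t x : 0 <= t -> \sum_z chain_prob L t x [set z] = 1.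
Proof.
move=> t0; pose c := (fun y x => p x y) : T -> T -> R.
have lam0 : 0 <= 2 * m by rewrite mulr_ge0// ltW.
have fM (z y : T) : `|\1_[set z] y : R| <= 1.
  by rewrite indicE; case: (_ \in _); rewrite ?normr1 ?normr0.
have e z : chain_prob L t x [set z] = heat c (fun y _ => y) (2 * m * t) \1_[set z] x.
  exact: (exp_semigroupE c_ge0 p_sum1 lam0 rw_generatorE x t0 (fM z)).
under eq_bigr do rewrite e.
rewrite -[RHS](@heat_cst _ _ _ c (fun y _ => y) p_sum1 (2 * m * t) 1 x).
rewrite (_ : (fun=> 1) = (fun y : T => \sum_z \1_[set z] y)); last first.
  apply/funext => y; rewrite (bigD1 y)//= indicE mem_set// big1 ?addr0// => z zy.
  by rewrite indicE memNset// => e'; rewrite e' eqxx in zy.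
elim: (index_enum T) => [|z s IH].
  rewrite big_nil (_ : (fun y => _) = (fun=> 0)) ?heat_cst//.
  by apply/funext => y; rewrite big_nil.
rewrite big_cons IH.
set f := (fun y => \sum_(z <- s) \1_[set z] y).
set g := (X in _ = heat _ _ _ X _).
have gf : f = g \- \1_[set z].
  by apply/funext => y; rewrite /= /g /f big_cons /= addrC addKr.
have n0 (h : T -> R) : exists M, forall y, `|h y| <= M.
  by exists (\sum_y `|h y|) => y; rewrite (bigD1 y)//= lerDl sumr_ge0.
have [M gM] := n0 g.
rewrite {1}gf (@heatB _ _ _ c _ c_ge0 p_sum1 _ _ _ (Num.max M 1)).
- by rewrite addrC subrK.
- by move=> y; rewrite (le_trans (gM y))// le_max lexx.
- by move=> y; rewrite (le_trans (fM z y))// le_max lexx orbT.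
Qed.

(* Two independent walkers on a finite set keep meeting: by Cauchy-Schwarz they
   meet with probability at least [1 / #|T|] when started together. *)
Lemma not_A1 : ~ @A1 R T p m.
Proof.
pose F t := ereal_sup [set irw_meet p m t xy.1 xy.2 | xy in [set: T * T]].
move=> A; have hF : F t @[t --> +oo%R] --> 0%E by exact: A.
(* Without sites the supremum is [-oo], which does not tend to 0. *)
have [x0 _|T0] := pickP (@predT T); last first.
  have e0 : F = fun=> -oo%E.
    apply/funext => t; rewrite /F (_ : [set _ | _ in _] = set0) ?ereal_sup0//.
    by apply/seteqP; split => // y [[a b] _ _]; have := T0 a.
  have : (-oo%E : \bar R) = 0%E.
    by move: hF; rewrite e0 => h; apply: (cvg_unique _ (cvg_cst _) h).
  by [].
pose N : R := #|T|%:R; have N0 : 0 < N by rewrite ltr0n; apply/card_gt0P; exists x0.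
have : (N^-1%:E <= (0 : \bar R))%E.
  apply: (cvge_to_ge hF); near=> t.
  have t0 : 0 <= t by near: t; exact: nbhs_pinfty_ge.
  apply: (@le_trans _ _ (irw_meet p m t x0 x0)); last first.
    by apply: ereal_sup_ubound; exists (x0, x0).
  rewrite /irw_meet esum_finType; last by move=> z; rewrite -expr2 sqr_ge0.
  rewrite lee_fin.
  pose a z := chain_prob L t x0 [set z].
  have : 0 <= \sum_z (a z - N^-1) ^+ 2 by apply: sumr_ge0 => z _; exact: sqr_ge0.
  rewrite (eq_bigr (fun z => a z * a z - 2 * N^-1 * a z + N^-1 ^+ 2)); last by move=> z _; ring.
  rewrite big_split sumrB /= -mulr_sumr chain_prob_sum1// sumr_const -mulr_natr.
  rewrite [X in _ -> X <= _](_ : _ = 2 * N^-1 * 1 - N^-1 ^+ 2 * N); last by field; rewrite gt_eqF.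
  lra.
by rewrite lee_fin leNgt invr_gt0 N0.
Unshelve. all: by end_near. Qed.

End FiniteSites.

(** * Finite range on the lattice *)

Section FiniteRange.
Variables (R : realType) (d : nat).
Local Notation S := (sites (Lattice d)).
Variables (p : S -> S -> R) (r : nat).
Hypothesis p_sum1 : forall x, (\esum_(y in [set: S]) (p x y)%:E)%E = 1%E.
Hypothesis p_ge0 : forall x y, 0 <= p x y.
Hypothesis p_range : forall x y : 'rV[int]_d, p x y != 0 ->
  forall i, (`|(y - x)%R 0%R i| <= r)%N.

Definition lattice_step (x : S) (b : {ffun 'I_d -> 'I_(r + r.+1)}) : S :=
  (x : 'rV[int]_d) + box b.

Lemma lattice_step_inj x : injective (lattice_step x).
Proof. by move=> a b /addrI/box_inj. Qed.

Lemma lattice_step_surj x y : p x y != 0 -> exists b, y = lattice_step x b.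
Proof.
move=> /p_range/box_surj[b e]; exists b.
by rewrite /lattice_step -e addrC subrK.
Qed.

Lemma lattice_step_sum1 x : \sum_b p x (lattice_step x b) = 1.
Proof.
apply: EFin_inj; rewrite -[RHS](p_sum1 x).
rewrite [RHS](_ : _ = (\esum_(y in lattice_step x @` setT) (p x y)%:E)%E); last first.
  rewrite [LHS]esum_mkcond [RHS]esum_mkcond; apply: eq_esum => y _.
  rewrite in_setT; case: ifPn => // /negP h.
  have [->//|/lattice_step_surj[b e]] := eqVneq (p x y) 0.
  by exfalso; apply: h; apply/mem_set; exists b.
by rewrite esum_image ?esum_finType// => a b _ _; exact: lattice_step_inj.
Qed.

End FiniteRange.
(** * The limit law *)

Section LimitLaw.
Variables (R : realType) (G : geometry) (p : sites G -> sites G -> R) (m : R).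
Local Notation S := (sites G).
Variable P : R -> R.-pker (config S) ~> (config S).
Variables (J0 : finType) (step : S -> J0 -> S).
Hypothesis m_gt0 : 0 < m.
Hypothesis p_ge0 : forall x y, 0 <= p x y.
Hypothesis p_sym : forall x y, p x y = p y x.
Hypothesis p_diag : forall x, p x x = 0.
Hypothesis step_inj : forall x, injective (step x).
Hypothesis step_surj : forall x y, p x y != 0 -> exists b, y = step x b.
Hypothesis p_sum1 : forall x, \sum_b p x (step x b) = 1.
Hypothesis sipP : SIP p m P.
Hypothesis latG : is_lattice G.
Hypothesis measurable_temp : measurable (@tempered G : set (config S)).
Hypothesis temp_ae : forall (lam : probability (config S) R) (M : R), 0 <= M ->
  (forall x, \int[lam]_eta ((eta x)%:R : R)%:E <= M%:E)%E ->
  lam (~` @tempered G) = 0%E.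

Variables (nu mu : probability (config S) R) (t : nat -> R).
Hypothesis meet0 : A2 p m.
Hypothesis nuPf : Pf m nu.
Hypothesis nu_product : product_measure nu.
Hypothesis t_ge0 : forall n, 0 <= t n.
Hypothesis t_cvg : t n @[n --> \oo] --> +oo.
Hypothesis mu_lim : moment_cvg m (fun n => evolve (P (t n)) nu) mu.

Local Notation flow := (@sip_flow R S p m J0 step).

Lemma Pf_tempered (lam : probability (config S) R) : Pf m lam ->
  lam (~` @tempered G) = 0%E.
Proof.
move=> /(Pf_bound 1)[c c0 hc]; apply: (@temp_ae _ (m / 2 * c)).
  by rewrite mulr_ge0// divr_ge0// ltW.
by move=> x; rewrite (first_moment m_gt0) [(m / 2 * c)%:E]EFinM lee_wpmul2l// lee_fin divr_ge0// ltW.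
Qed.

Lemma evolve_moment (lam : probability (config S) R) s n (x : 'I_n -> S) :
  Pf m lam -> 0 <= s ->
  dual_moment m (evolve (P s) lam) (occupation x) = (flow s (moment m lam) x)%:E.
Proof.
move=> lamP s0; have [c c0 hc] := Pf_bound n lamP.
exact: (duality_flow m_gt0 p_ge0 step_inj step_surj p_sum1 sipP x latG s0
  measurable_temp (Pf_tempered lamP) hc).
Qed.

Lemma limit_moment_le n c (x : 'I_n -> S) : 0 <= c ->
  (forall y : 'I_n -> S, dual_moment m nu (occupation y) <= c%:E)%E ->
  (dual_moment m mu (occupation x) <= c%:E)%E.
Proof.
move=> c0 hc; apply: (cvge_to_le (mu_lim (finite_occupation x))).
apply: nearW => k; rewrite evolve_moment// lee_fin.
have h (y : 'I_n -> S) : 0 <= moment m nu y <= c by rewrite moment_ge0// -lee_fin -(momentE m_gt0 (hc y)) hc.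
by have /andP[] := sip_flow_le_cst m_gt0 p_ge0 p_sum1 x (t_ge0 k) c0 h.
Qed.

Lemma limit_Pf : Pf m mu.
Proof.
have h n := cid2 (Pf_bound n nuPf).
apply: (@bound_Pf _ _ _ _ (fun n => s2val (h n))) => n x.
by apply: limit_moment_le; case: (h n).
Qed.

Lemma flow_cvg n (x : 'I_n -> S) :
  flow (t k) (moment m nu) x @[k --> \oo] --> moment m mu x.
Proof.
have [c c0 hc] := Pf_bound n limit_Pf.
have h := fine_cvg (F := \oo) (f := fun k => (flow (t k) (moment m nu) x)%:E).
apply: h; rewrite -(momentE m_gt0 (hc x)).
rewrite (_ : (fun k => _) = (fun k => dual_moment m (evolve (P (t k)) nu) (occupation x))).
  exact: mu_lim (finite_occupation x).
by apply/funext => k; rewrite evolve_moment.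
Qed.

Lemma moment_fixed n (x : 'I_n -> S) s : flow s (moment m mu) x = moment m mu x.
Proof.
have [c c0 hc] := Pf_bound n nuPf.
have mo (y : 'I_n -> S) : `|moment m nu y| <= c.
  by rewrite ger0_norm ?moment_ge0// -lee_fin -(momentE m_gt0 (hc y)) hc.
apply: heat_fixed => y; apply/eqP; rewrite -subr_eq0; apply/eqP.
set Q := transition _ _.
have cv : Q (flow (t k) (moment m nu)) y - flow (t k) (moment m nu) y @[k --> \oo] -->
    Q (moment m mu) y - moment m mu y.
  apply: cvgB; last exact: flow_cvg.
  by apply: cvg_sumr => j _; apply: cvgM; [exact: cvg_cst|exact: flow_cvg].
apply: (cvg_unique _ cv) => //; apply/cvgr0Pnorm_le => e e0; near=> k.
have l0 := sip_lam_gt0 m_gt0 n.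
(* Beyond this time the bound of [heat_mixing], [c / sqrt (sip_lam m n * t k)], is at most [e];
   taking [c + 1] instead of [c] also gives [t k > 0]. *)
have tk : ((c + 1) / e) ^+ 2 / sip_lam m n <= t k.
  by near: k; move/cvgryPge : t_cvg; apply.
have tk0 : 0 < t k.
  by rewrite (lt_le_trans _ tk)// divr_gt0// exprn_gt0// divr_gt0// ltr_wpDl.
have tau0 : 0 < sip_lam m n * t k by rewrite mulr_gt0.
apply: (le_trans (heat_mixing (lazy_jump (@sip_jump S J0 step n))
  (sip_lazy_ge0 m_gt0 p_ge0 p_sum1 (n := n)) (sip_lazy_sum1 p m step (n := n)) y tau0 mo)).
rewrite ler_pdivrMr ?sqrtr_gt0// mulrC -ler_pdivrMr//.
apply: (@le_trans _ _ ((c + 1) / e)); first by rewrite ler_pM2r ?invr_gt0// lerDl.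
rewrite -[leLHS]ger0_norm ?divr_ge0 ?addr_ge0 ?(ltW e0)// -sqrtr_sqr ler_sqrt ?(ltW tau0)//.
by rewrite [leRHS]mulrC -ler_pdivrMr.
Unshelve. all: by end_near. Qed.

Lemma sip_flow_dist n (x : 'I_n -> S) (f g h : ('I_n -> S) -> R) s C M : 0 <= s ->
  (forall y, `|f y| <= M) -> (forall y, `|g y| <= M) -> (forall y, `|h y| <= M) ->
  (forall y, `|f y - g y| <= C * h y) ->
  `|flow s f x - flow s g x| <= C * flow s h x.
Proof.
move=> s0 fM gM hM fg.
have MM : M <= M + M by rewrite lerDl (le_trans _ (fM x)).
have Ch y : `|C * h y| <= (1 + `|C|) * (M + M).
  have M0 : 0 <= M by exact: le_trans (fM x).
  rewrite normrM ler_pM//; first by rewrite lerDr.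
  exact: le_trans (hM y) MM.
have NCh y : `|- C * h y| <= (1 + `|C|) * (M + M) by rewrite mulNr normrN.
have fgM y : `|(f \- g) y| <= (1 + `|C|) * (M + M).
  have M0 : 0 <= M by exact: le_trans (fM x).
  rewrite (le_trans (ler_normB _ _))// (le_trans (lerD (fM y) (gM y)))//.
  by rewrite ler_peMl ?addr_ge0// lerDl.
rewrite -(sip_flowB m_gt0 p_ge0 p_sum1 s x fM gM).
rewrite ler_norml -mulNr -!(sip_flowZ m_gt0 p_ge0 p_sum1 s _ x hM).
apply/andP; split; [apply: (sip_flow_le m_gt0 p_ge0 p_sum1 x s0 NCh fgM)|
  apply: (sip_flow_le m_gt0 p_ge0 p_sum1 x s0 fgM Ch)] => y;
  by have := fg y; rewrite ler_norml ?mulNr => /andP[].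
Qed.

Definition density y : R := moment m nu (fun _ : 'I_1 => y).

Lemma moment_one (x : 'I_1 -> S) : moment m nu x = density (x ord0).
Proof.
by rewrite /density; congr (moment m nu _); apply/funext => i; rewrite ord1.
Qed.

Lemma moment_injective n (x : 'I_n -> S) : injective x ->
  moment m nu x = product_fun density x.
Proof.
move=> xinj; have [c c0 hc] := Pf_bound 1 nuPf.
rewrite /moment (product_moment m_gt0 nu_product)//; last first.
  by move=> y; rewrite (first_moment m_gt0) (momentE m_gt0 (hc _)).
rewrite (eq_bigr (fun i => (density (x i))%:E)); last first.
  by move=> i _; rewrite (momentE m_gt0 (hc _)).
by rewrite prodEFin.
Qed.

Lemma meet_small e : 0 < e -> \forall k \near \oo,
  forall w, chain_prob (sip2_generator p m) (t k) w [set v | v.1 = v.2] <= e.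
Proof.
move=> e0; pose F s := ereal_sup [set sip_meet p m s xy.1 xy.2 | xy in [set: S * S]].
have F0 : F s @[s --> +oo] --> 0%E by exact: meet0.
have hF : F (t k) @[k --> \oo] --> 0%E by exact: (cvg_comp _ _ t_cvg F0).
have : \forall k \near \oo, (F (t k) < e%:E)%E.
  have e0' : (0 < e%:E :> \bar R)%E by rewrite lte_fin.
  exact: (hF _ (open_ereal_lt' e0')).
apply: filterS => k Fk w; rewrite -lee_fin (le_trans _ (ltW Fk))//.
by apply: ereal_sup_ubound; exists w => //; case: w.
Qed.

(* Up to coincidences, which (A2) makes unlikely, the moments of [nu] factorize. *)
Lemma product_flow_cvg n (x : 'I_n -> S) :
  flow (t k) (product_fun density) x @[k --> \oo] --> moment m mu x.
Proof.
have [c c0 hc] := Pf_bound n nuPf; have [c1 c10 hc1] := Pf_bound 1 nuPf.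
have dens y : 0 <= density y <= c1.
  by rewrite moment_ge0//= -lee_fin -(momentE m_gt0 (hc1 _)) hc1.
have mo (y : 'I_n -> S) : `|moment m nu y| <= c.
  by rewrite ger0_norm ?moment_ge0// -lee_fin -(momentE m_gt0 (hc y)) hc.
have pr (y : 'I_n -> S) : `|product_fun density y| <= c1 ^+ n.
  by have /andP[h0 h1] := product_fun_bound y dens; rewrite ger0_norm.
have c1n : 0 <= c1 ^+ n by rewrite exprn_ge0.
pose C := c + c1 ^+ n.
have dist (y : 'I_n -> S) : `|moment m nu y - product_fun density y| <= C * (~~ injectiveb y)%:R.
  case: injectiveP => [yi|_] /=; first by rewrite moment_injective// subrr normr0 mulr0.
  by rewrite mulr1 (le_trans (ler_normB _ _))// lerD.
have C0 : 0 <= C by rewrite addr_ge0.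
have d0 : flow (t k) (moment m nu) x - flow (t k) (product_fun density) x @[k --> \oo] --> 0.
  apply/cvgr0Pnorm_le => e e0.
  (* Then [C n^2 e' <= e]; the [+ 1] keeps the denominator positive. *)
  pose e' := e / (C * (n%:R * n%:R) + 1).
  have q0 : 0 < C * (n%:R * n%:R) + 1 by rewrite ltr_wpDl// !mulr_ge0.
  have e'0 : 0 < e' by rewrite divr_gt0.
  near=> k.
  have M1 : c <= C + 1 by rewrite -addrA lerDl addr_ge0.
  have M2 : c1 ^+ n <= C + 1 by rewrite addrAC lerDr addr_ge0.
  have M3 : 1 <= C + 1 by rewrite lerDr.
  have hb (y : 'I_n -> S) : `|(~~ injectiveb y)%:R : R| <= C + 1.
    by rewrite (le_trans _ M3)//; case: injectiveb; rewrite /= ?normr0 ?normr1.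
  rewrite (le_trans (sip_flow_dist x (t_ge0 k) (fun y => le_trans (mo y) M1)
    (fun y => le_trans (pr y) M2) hb dist))//.
  apply: (@le_trans _ _ (C * (n%:R * n%:R * e'))).
    rewrite ler_wpM2l//.
    apply: (sip_flow_collision m_gt0 p_ge0 p_sym p_diag step_inj step_surj p_sum1) => //.
      exact: ltW.
    by near: k; exact: meet_small.
  rewrite [leLHS](_ : _ = e * (C * (n%:R * n%:R)) / (C * (n%:R * n%:R) + 1)); last first.
    by rewrite /e'; ring.
  by rewrite ler_pdivrMr// ler_wpM2l ?(ltW e0)// lerDl.
rewrite -[moment m mu x]subr0.
rewrite (_ : (fun k => _) = (fun k => flow (t k) (moment m nu) x -
    (flow (t k) (moment m nu) x - flow (t k) (product_fun density) x))).
  by apply: cvgB => //; exact: flow_cvg.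
by apply/funext => k; rewrite opprB addrC subrK.
Unshelve. all: by end_near. Qed.

(** The bound [c] on the one-particle density gives [c^n] for the product function, and the flow
    preserves it. *)
Lemma limit_moment_bounded : exists2 c : R, 0 <= c & bounded_moments m c mu.
Proof.
have [c c0 hc] := Pf_bound 1 nuPf; exists c => // n x.
have [cn cn0 hcn] := Pf_bound n limit_Pf.
have dens y : 0 <= density y <= c.
  by rewrite moment_ge0//= -lee_fin -(momentE m_gt0 (hc _)) hc.
rewrite (momentE m_gt0 (hcn x)) lee_fin.
have lim := @product_flow_cvg _ x.
apply: (ler_cvg_to lim (cvg_cst _)); apply: nearW => k.
have cn0' : 0 <= c ^+ n by rewrite exprn_ge0.
have h (y : 'I_n -> S) := product_fun_bound y dens.
by have /andP[] := sip_flow_le_cst m_gt0 p_ge0 p_sum1 x (t_ge0 k) cn0' h.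
Qed.

(** The inequality already holds at each time [t k] for the product function. A single particle has
    no coincidences, so its moment is the density itself and the left factors converge too. *)
Lemma limit_correlation n (x : 'I_n -> S) :
  (\prod_(i < n) K m mu (fun _ : 'I_1 => x i) <= K m mu x)%E.
Proof.
have [c c0 hc] := Pf_bound 1 nuPf.
have [c1 _ hc1] := Pf_bound 1 limit_Pf; have [cn _ hcn] := Pf_bound n limit_Pf.
have dens y : 0 <= density y <= c.
  by rewrite moment_ge0//= -lee_fin -(momentE m_gt0 (hc _)) hc.
rewrite /K (momentE m_gt0 (hcn x)).
rewrite (eq_bigr (fun i => (moment m mu (fun _ : 'I_1 => x i))%:E)); last first.
  by move=> i _; rewrite (momentE m_gt0 (hc1 _)).
rewrite prodEFin lee_fin.
have cl : \prod_i flow (t k) (fun y : 'I_1 -> S => density (y ord0)) (fun=> x i)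
    @[k --> \oo] --> \prod_i moment m mu (fun _ : 'I_1 => x i).
  apply: cvg_prodr => i _.
  rewrite (_ : (fun y : 'I_1 -> S => density (y ord0)) = moment m nu); last first.
    by apply/funext => y; rewrite moment_one.
  exact: flow_cvg.
have lim := @product_flow_cvg _ x.
apply: (ler_cvg_to cl lim); apply: nearW => k.
exact: (sip_flow_product_ge m_gt0 p_ge0 p_sym p_diag step_inj step_surj p_sum1 x (t_ge0 k) c0 dens).
Qed.

Lemma evolve_setT (lam : probability (config S) R) s :
  evolve (P s) lam setT = 1%E.
Proof.
rewrite -[LHS]mul1e -integral_cst// integral_evolve//.
under eq_integral do rewrite integral_cst// mul1e prob_kernel.
by rewrite integral_cst// mul1e; exact: probability_setT.
Qed.

(** Duality is applied once more, with [mu] as initial law; being in [P_f], [mu] charges only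
    tempered configurations. *)
Lemma limit_invariant : invariant_law P mu.
Proof.
move=> s A s0 mA; have [c c0 hc] := limit_moment_bounded.
have same n (x : 'I_n -> S) : dual_moment m (evolve (P s) mu) (occupation x) =
    dual_moment m mu (occupation x).
  by rewrite (evolve_moment _ limit_Pf s0) moment_fixed (momentE m_gt0 (hc _ x)).
apply: (same_measure m_gt0 c0) => //.
- by move=> n x; rewrite same hc.
- exact: evolve_setT.
- exact: probability_setT.
Qed.

End LimitLaw.

Theorem proposition2 (R : realType) (G : geometry)
    (p : sites G -> sites G -> R) (m : R)
    (P : R -> R.-pker (config (sites G)) ~> (config (sites G)))
    (nu mu : probability (config (sites G)) R) (t : nat -> R) :
  random_walk p -> 0 < m -> SIP p m P ->
  A1 p m -> A2 p m ->
  Pf m nu -> product_measure nu ->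
  (forall n, 0 <= t n) -> nondecreasing_seq t -> t n @[n --> \oo] --> +oo ->
  moment_cvg m (fun n => evolve (P (t n)) nu) mu ->
  [/\ Pf m mu,
      invariant_law P mu
    & forall (n : nat) (x : 'I_n -> sites G), (1 <= n)%N ->
        (\prod_(i < n) K m mu (fun _ : 'I_1 => x i) <= K m mu x)%E].
Proof.
case: G p P nu mu => [T|d] p P nu mu [p_ge0 p_sym p_sum1 p_diag _ p_homog] m_gt0 sipP a1 a2
  nuPf nu_prod t0 _ t_cvg mu_lim.
  exfalso; apply: (@not_A1 R T p m m_gt0 p_ge0 _ a1) => x.
  by apply: EFin_inj; rewrite -[RHS](p_sum1 x) esum_finType.
have [_ [r p_range]] := p_homog.
have step_sum1 := lattice_step_sum1 p_sum1 p_ge0 p_range.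
have step_surj := lattice_step_surj p_range.
have step_inj := @lattice_step_inj d r.
have lim := limit_Pf m_gt0 p_ge0 step_inj step_surj step_sum1 sipP isT
  (@measurable_tempered d) (@tempered_ae R d) nuPf t0 mu_lim.
split=> //.
- exact: (limit_invariant m_gt0 p_ge0 p_sym p_diag step_inj step_surj step_sum1 sipP isT
    (@measurable_tempered d) (@tempered_ae R d) a2 nuPf nu_prod t0 t_cvg mu_lim).
- move=> n x _.
  exact: (limit_correlation m_gt0 p_ge0 p_sym p_diag step_inj step_surj step_sum1 sipP isT
    (@measurable_tempered d) (@tempered_ae R d) a2 nuPf nu_prod t0 t_cvg mu_lim).
Qed.
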